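(* Let $s\ge2$ be an integer. The smooth Hensel-Steinitz algebra $HS^\infty(s)$ is closed under the holomorphic functional calculus: for any $a\in HS^\infty(s)$ and any function $g$ that is holomorphic on an open neighborhood containing the spectrum of $a$, we have $g(a)\in HS^\infty(s)$.
   Context: $\mathbb{Z}_s$ is the compact ring of $s$-adic integers $x=\sum_{j\ge0}x_js^j$, $0\le x_j\le s-1$ (i.e. $\varprojlim\mathbb{Z}/s^n\mathbb{Z}$), and $\mathbb{Z}_s^\times=\{x\in\mathbb{Z}_s: x_0\ne0\}$ (a clopen subset; the elements of $s$-adic norm $1$). $H=\ell^2(\mathbb{Z})$ has canonical basis $\{E_l\}_{l\in\mathbb{Z}}$; $VE_l=E_{sl}$ and $M_fE_l=f(l)E_l$ for $f\in C(\mathbb{Z}_s)$. $HS(s)\subseteq B(H)$ is the C$^*$-algebra generated by $V$ and all $M_f$, $f\in C(\mathbb{Z}_s)$. Every nonzero $l\in\mathbb{Z}$ is written uniquely as $l=s^ml'$ with $m\ge0$, $s\nmid l'$. For $F\in C_0(\mathbb{Z}_{\ge0}\times\mathbb{Z}_s^\times)$ put $M_FE_{s^ml'}=F(m,l')E_{s^ml'}$, $M_FE_0=0$. RD (rapid decay) means decaying faster than any inverse polynomial in the indices. $I_s^\infty\subseteq HS(s)$ is the set of norm-convergent sums $a=\sum_{n\ge0}V^nM_{F_n}+\sum_{n<0}M_{F_n}(V^* )^{-n}$ with $F_n\in C_0(\mathbb{Z}_{\ge0}\times\mathbb{Z}_s^\times)$ and $\{\sup_x|F_n(m,x)|\}_{m,n}$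 RD in $(m,n)$. For $\phi\in C^\infty(\mathbb{R}/\mathbb{Z})$ with Fourier coefficients $\phi_m$, $T(\phi)=\sum_{m\ge0}\phi_mV^m+\sum_{m<0}\phi_m(V^* )^{-m}$ (norm convergent). The smooth Hensel-Steinitz algebra is $HS^\infty(s)=\{T(\phi)+c:\phi\in C^\infty(\mathbb{R}/\mathbb{Z}),\,c\in I_s^\infty\}$. The spectrum and $g(a)$ (defined by the Cauchy integral formula) are taken in the unital C$^*$-algebra $HS(s)$. *)

(* Defs.v *)
From Stdlib Require Export Reals ZArith List Permutation.
From Stdlib Require Import Lra Lia ClassicalEpsilon ProofIrrelevance
  FunctionalExtensionality.
From Coquelicot Require Export Coquelicot.

Open Scope R_scope.

Definition ex_zseries (f : Z -> R) : Prop :=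
  ex_series (fun n => f (Z.of_nat n)) /\
  ex_series (fun n => f (- Z.of_nat n - 1)%Z).

Definition ZSeries (f : Z -> R) : R :=
  Series (fun n => f (Z.of_nat n)) + Series (fun n => f (- Z.of_nat n - 1)%Z).

Definition is_zseries {K : AbsRing} {V : NormedModule K} (u : Z -> V) (l : V) : Prop :=
  exists p q : V,
    is_series (fun n => u (Z.of_nat n)) p /\
    is_series (fun n => u (- Z.of_nat n - 1)%Z) q /\
    l = plus p q.

Lemma Z_two_sided (P : Z -> Prop) :
  (forall n, P (Z.of_nat n)) -> (forall n, P (- Z.of_nat n - 1)%Z) -> forall l, P l.
Proof.
intros H1 H2 l. destruct (Z_lt_le_dec l 0) as [h|h].
- replace l with (- Z.of_nat (Z.to_nat (- l - 1)) - 1)%Z by lia. apply H2.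
- rewrite <- (Z2Nat.id l h). apply H1.
Qed.

Lemma ex_zseries_le (f g : Z -> R) :
  (forall l, 0 <= f l <= g l) -> ex_zseries g -> ex_zseries f.
Proof.
assert (L : forall u v : nat -> R, (forall n, 0 <= u n <= v n) ->
  ex_series v -> ex_series u).
{ intros u v h; apply (ex_series_le (V := R_CompleteNormedModule) u v).
  intros n; unfold norm; simpl; unfold abs; simpl.
  destruct (h n); rewrite Rabs_pos_eq; lra. }
intros H [H1 H2]; split; [apply (L _ _ (fun n => H _) H1)|apply (L _ _ (fun n => H _) H2)].
Qed.

Lemma ex_zseries_plus (f g : Z -> R) :
  ex_zseries f -> ex_zseries g -> ex_zseries (fun l => f l + g l).
Proof.
intros [H1 H2] [H3 H4]; split.
- exact (ex_series_plus _ _ H1 H3).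
- exact (ex_series_plus _ _ H2 H4).
Qed.

Lemma ex_zseries_scal (c : R) (f : Z -> R) :
  ex_zseries f -> ex_zseries (fun l => c * f l).
Proof.
intros [H1 H2]; split.
- exact (ex_series_scal c _ H1).
- exact (ex_series_scal c _ H2).
Qed.

Lemma ZSeries_le (f g : Z -> R) :
  (forall l, 0 <= f l <= g l) -> ex_zseries g -> ZSeries f <= ZSeries g.
Proof.
intros H [H1 H2]; unfold ZSeries; apply Rplus_le_compat; apply Series_le; auto.
Qed.

Lemma ZSeries_ext (f g : Z -> R) : (forall l, f l = g l) -> ZSeries f = ZSeries g.
Proof.
intros H; unfold ZSeries; f_equal; apply Series_ext; auto.
Qed.

Lemma ZSeries_plus (f g : Z -> R) :
  ex_zseries f -> ex_zseries g -> ZSeries (fun l => f l + g l) = ZSeries f + ZSeries g.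
Proof.
intros [H1 H2] [H3 H4]; unfold ZSeries.
rewrite (Series_plus _ _ H1 H3), (Series_plus _ _ H2 H4); ring.
Qed.

Lemma ZSeries_scal (c : R) (f : Z -> R) :
  ZSeries (fun l => c * f l) = c * ZSeries f.
Proof.
unfold ZSeries; rewrite Rmult_plus_distr_l, <- !Series_scal_l; reflexivity.
Qed.

Lemma Series_const_0 : Series (fun _ => 0) = 0.
Proof.
rewrite (Series_ext _ (fun n => 0 * 0)) by (intros; ring).
rewrite Series_scal_l; ring.
Qed.

Lemma ZSeries_pos (f : Z -> R) : (forall l, 0 <= f l) -> ex_zseries f -> 0 <= ZSeries f.
Proof.
intros H He.
assert (E0 : ZSeries (fun _ => 0) = 0) by (unfold ZSeries; rewrite Series_const_0; ring).
rewrite <- E0; apply ZSeries_le; auto. intros l; split; [lra|auto].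
Qed.

Lemma Series_term_le (u : nat -> R) (n : nat) :
  (forall k, 0 <= u k) -> ex_series u -> u n <= Series u.
Proof.
intros H He.
apply Rle_trans with (sum_n u n).
- destruct n; [rewrite sum_O; apply Rle_refl|].
  rewrite sum_Sn; unfold plus; simpl.
  assert (0 <= sum_n u n); [|lra].
  clear He; induction n; [rewrite sum_O; auto|rewrite sum_Sn; unfold plus; simpl].
  specialize (H (S n)); lra.
- apply (is_lim_seq_incr_compare (sum_n u)).
  + apply Series_correct in He; exact He.
  + intros k; rewrite sum_Sn; unfold plus; simpl; specialize (H (S k)); lra.
Qed.

Lemma ZSeries_term_le (f : Z -> R) (l : Z) :
  (forall k, 0 <= f k) -> ex_zseries f -> f l <= ZSeries f.
Proof.
intros H [H1 H2].
assert (P1 : 0 <= Series (fun n => f (Z.of_nat n))).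
{ eapply Rle_trans; [|apply (Series_term_le _ 0%nat (fun k => H _) H1)]; simpl; auto. }
assert (P2 : 0 <= Series (fun n => f (- Z.of_nat n - 1)%Z)).
{ eapply Rle_trans; [|apply (Series_term_le _ 0%nat (fun k => H _) H2)]; simpl; auto. }
revert l; apply Z_two_sided; intros n; unfold ZSeries.
- assert (X := Series_term_le (fun n => f (Z.of_nat n)) n (fun k => H _) H1);
  simpl in X; lra.
- assert (X := Series_term_le (fun n => f (- Z.of_nat n - 1)%Z) n (fun k => H _) H2);
  simpl in X; lra.
Qed.

Lemma ex_series_delta (N : nat) (u : nat -> R) :
  (forall n, (N <= n)%nat -> u n = 0) -> ex_series u.
Proof.
intros H; apply (ex_series_incr_n u N).
apply ex_series_ext with (fun _ => 0); [intros n; rewrite H; auto; lia|].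
exists 0; apply filterlim_ext with (fun _ => 0).
- intros n; rewrite sum_n_const; ring.
- apply filterlim_const.
Qed.

Record l2 : Type := Mk_l2 {
  l2_fun :> Z -> C;
  l2_sq : ex_zseries (fun l => Cmod (l2_fun l) ^ 2) }.

Lemma l2_ext (x y : l2) : (forall l, x l = y l) -> x = y.
Proof.
destruct x as [x hx], y as [y hy]; simpl; intros H.
assert (x = y) by (apply functional_extensionality; exact H); subst y.
f_equal; apply proof_irrelevance.
Qed.

Lemma Cmod_sq_plus (t : R) (u v : C) : 0 < t ->
  Cmod (u + v) ^ 2 <= (1 + t) * Cmod u ^ 2 + (1 + / t) * Cmod v ^ 2.
Proof.
intros ht.
assert (h := Cmod_triangle u v).
assert (h0 := Cmod_ge_0 (u + v)). assert (h1 := Cmod_ge_0 u). assert (h2 := Cmod_ge_0 v).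
apply Rle_trans with ((Cmod u + Cmod v) ^ 2).
- apply pow_incr; lra.
- assert (0 <= / t * (t * Cmod u - Cmod v) ^ 2).
  { apply Rmult_le_pos; [left; apply Rinv_0_lt_compat; lra|apply pow2_ge_0]. }
  replace (/ t * (t * Cmod u - Cmod v) ^ 2)
    with (t * Cmod u ^ 2 - 2 * Cmod u * Cmod v + / t * Cmod v ^ 2) in H by (field; lra).
  lra.
Qed.

Lemma l2_plus_sq (x y : l2) : ex_zseries (fun l => Cmod (x l + y l) ^ 2).
Proof.
apply ex_zseries_le with
  (fun l => (1 + 1) * Cmod (x l) ^ 2 + (1 + / 1) * Cmod (y l) ^ 2).
- intros l; split; [apply pow2_ge_0|apply Cmod_sq_plus; lra].
- apply ex_zseries_plus; apply ex_zseries_scal; apply l2_sq.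
Qed.

Lemma l2_scal_sq (c : C) (x : l2) : ex_zseries (fun l => Cmod (c * x l) ^ 2).
Proof.
apply ex_zseries_le with (fun l => Cmod c ^ 2 * Cmod (x l) ^ 2).
- intros l; split; [apply pow2_ge_0|rewrite Cmod_mult, Rpow_mult_distr; lra].
- apply ex_zseries_scal; apply l2_sq.
Qed.

Lemma l2_zero_sq : ex_zseries (fun _ => Cmod 0 ^ 2).
Proof.
rewrite Cmod_0; split; apply (ex_series_delta 0); intros; ring.
Qed.

Definition l2_plus (x y : l2) : l2 := Mk_l2 _ (l2_plus_sq x y).
Definition l2_scal (c : C) (x : l2) : l2 := Mk_l2 _ (l2_scal_sq c x).
Definition l2_opp (x : l2) : l2 := l2_scal (- (1))%C x.
Definition l2_zero : l2 := Mk_l2 _ l2_zero_sq.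

Definition l2_norm (x : l2) : R := sqrt (ZSeries (fun l => Cmod (x l) ^ 2)).

(** Linear in the first argument. *)
Definition inner (x y : l2) : C :=
  (ZSeries (fun l => Re (x l * Cconj (y l))%C),
   ZSeries (fun l => Im (x l * Cconj (y l))%C)).

Definition l2_AbelianMonoid_mixin : AbelianMonoid.mixin_of l2.
Proof.
apply (AbelianMonoid.Mixin l2 l2_plus l2_zero).
- intros x y; apply l2_ext; intros l; simpl; ring.
- intros x y z; apply l2_ext; intros l; simpl; ring.
- intros x; apply l2_ext; intros l; simpl; ring.
Defined.
Canonical l2_AbelianMonoid := AbelianMonoid.Pack l2 l2_AbelianMonoid_mixin l2.

Definition l2_AbelianGroup_mixin : AbelianGroup.mixin_of l2_AbelianMonoid.
Proof.
apply (AbelianGroup.Mixin l2_AbelianMonoid l2_opp).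
intros x; apply l2_ext; intros l; simpl; ring.
Defined.
Canonical l2_AbelianGroup :=
  AbelianGroup.Pack l2 (AbelianGroup.Class _ _ l2_AbelianGroup_mixin) l2.

Definition l2_ModuleSpace_mixin : ModuleSpace.mixin_of C_Ring l2_AbelianGroup.
Proof.
apply (ModuleSpace.Mixin C_Ring l2_AbelianGroup l2_scal).
- intros a b x; apply l2_ext; intros l; simpl; apply Cmult_assoc.
- intros x; apply l2_ext; intros l; simpl; apply Cmult_1_l.
- intros a x y; apply l2_ext; intros l; simpl; apply Cmult_plus_distr_l.
- intros a b x; apply l2_ext; intros l; simpl; apply Cmult_plus_distr_r.
Defined.
Canonical l2_ModuleSpace :=
  ModuleSpace.Pack C_Ring l2 (ModuleSpace.Class _ _ _ l2_ModuleSpace_mixin) l2.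

Lemma l2_norm_ge_0 (x : l2) : 0 <= l2_norm x.
Proof. apply sqrt_pos. Qed.

Lemma l2_norm_sq (x : l2) : l2_norm x ^ 2 = ZSeries (fun l => Cmod (x l) ^ 2).
Proof.
unfold l2_norm; apply pow2_sqrt.
apply ZSeries_pos; [intros; apply pow2_ge_0|apply l2_sq].
Qed.

Lemma l2_norm_scal (c : C) (x : l2) : l2_norm (l2_scal c x) = Cmod c * l2_norm x.
Proof.
unfold l2_norm.
rewrite (ZSeries_ext _ (fun l => Cmod c ^ 2 * Cmod (x l) ^ 2)).
2: { intros l; simpl l2_fun; rewrite Cmod_mult, Rpow_mult_distr; reflexivity. }
rewrite ZSeries_scal, sqrt_mult_alt by apply pow2_ge_0.
rewrite sqrt_pow2 by apply Cmod_ge_0; reflexivity.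
Qed.

Lemma l2_norm_eq_0 (x : l2) : l2_norm x = 0 -> x = l2_zero.
Proof.
intros H; apply l2_ext; intros l; simpl; apply Cmod_eq_0.
assert (h : Cmod (x l) ^ 2 <= 0).
{ replace 0 with (l2_norm x ^ 2) by (rewrite H; ring).
  rewrite l2_norm_sq.
  apply (ZSeries_term_le (fun l => Cmod (x l) ^ 2) l);
    [intros; apply pow2_ge_0|apply l2_sq]. }
assert (h0 := pow2_ge_0 (Cmod (x l))).
apply Rsqr_0_uniq; rewrite Rsqr_pow2; lra.
Qed.

Lemma l2_zero_plus (y : l2) : l2_plus l2_zero y = y.
Proof. apply l2_ext; intros l; simpl; ring. Qed.

Lemma l2_plus_zero (y : l2) : l2_plus y l2_zero = y.
Proof. apply l2_ext; intros l; simpl; ring. Qed.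

Lemma l2_norm_triangle (x y : l2) : l2_norm (l2_plus x y) <= l2_norm x + l2_norm y.
Proof.
assert (hx := l2_norm_ge_0 x). assert (hy := l2_norm_ge_0 y).
destruct (Rle_lt_or_eq_dec _ _ hx) as [px|zx].
2: { assert (E := l2_norm_eq_0 x (eq_sym zx)); rewrite E at 1; rewrite l2_zero_plus; lra. }
destruct (Rle_lt_or_eq_dec _ _ hy) as [py|zy].
2: { assert (E := l2_norm_eq_0 y (eq_sym zy)); rewrite E at 1; rewrite l2_plus_zero; lra. }
assert (H : l2_norm (l2_plus x y) ^ 2 <= (l2_norm x + l2_norm y) ^ 2).
{ set (t := l2_norm y / l2_norm x).
  assert (ht : 0 < t) by (apply Rdiv_lt_0_compat; assumption).
  rewrite l2_norm_sq.
  apply Rle_trans with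
    (ZSeries (fun l => (1 + t) * Cmod (x l) ^ 2 + (1 + / t) * Cmod (y l) ^ 2)).
  - apply ZSeries_le.
    + intros l; split; [apply pow2_ge_0|apply Cmod_sq_plus; exact ht].
    + apply ex_zseries_plus; apply ex_zseries_scal; apply l2_sq.
  - rewrite ZSeries_plus by (apply ex_zseries_scal; apply l2_sq).
    rewrite !ZSeries_scal, <- !l2_norm_sq.
    right; unfold t; field; split; lra. }
apply Rsqr_incr_0_var; [rewrite !Rsqr_pow2; exact H|lra].
Qed.

Definition l2_ball (x : l2) (eps : R) (y : l2) : Prop := l2_norm (minus y x) < eps.

Lemma l2_norm_zero : l2_norm zero = 0.
Proof.
replace (zero : l2) with (l2_scal 0 l2_zero).
- rewrite l2_norm_scal, Cmod_0; ring.
- apply l2_ext; intros l; simpl; ring.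
Qed.

Definition l2_UniformSpace_mixin : UniformSpace.mixin_of l2.
Proof.
apply (UniformSpace.Mixin l2 l2_zero l2_ball); unfold l2_ball.
- intros x e; rewrite minus_eq_zero.
  eapply Rle_lt_trans; [right; exact l2_norm_zero|apply cond_pos].
- intros x y e H; replace (minus x y) with (l2_scal (- (1))%C (minus y x)).
  + rewrite l2_norm_scal, Cmod_opp, Cmod_1; lra.
  + apply l2_ext; intros l; simpl; ring.
- intros x y z e1 e2 H1 H2.
  replace (minus z x) with (l2_plus (minus z y) (minus y x)).
  + eapply Rle_lt_trans; [apply l2_norm_triangle|lra].
  + apply l2_ext; intros l; simpl; ring.
Defined.
Canonical l2_UniformSpace := UniformSpace.Pack l2 l2_UniformSpace_mixin l2.

Canonical l2_NormedModuleAux :=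
  NormedModuleAux.Pack C_AbsRing l2
    (NormedModuleAux.Class C_AbsRing l2
       (ModuleSpace.class C_Ring l2_ModuleSpace) l2_UniformSpace_mixin) l2.

Definition l2_NormedModule_mixin : NormedModule.mixin_of C_AbsRing l2_NormedModuleAux.
Proof.
apply (NormedModule.Mixin C_AbsRing l2_NormedModuleAux l2_norm 1).
- exact l2_norm_triangle.
- intros c x; right; apply l2_norm_scal.
- intros x y eps H; exact H.
- intros x y eps H; rewrite Rmult_1_l; exact H.
- exact l2_norm_eq_0.
Defined.
Canonical l2_NormedModule :=
  NormedModule.Pack C_AbsRing l2
    (NormedModule.Class _ _ _ l2_NormedModule_mixin) l2.

Lemma E_sq (l : Z) : ex_zseries (fun k => Cmod (if Z.eq_dec k l then 1 else 0) ^ 2).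
Proof.
split; apply (ex_series_delta (S (Z.to_nat (Z.abs l)))); intros n hn;
  (destruct (Z.eq_dec _ l); [lia|rewrite Cmod_0; ring]).
Qed.

Definition E (l : Z) : l2 := Mk_l2 _ (E_sq l).

Record BH : Type := Mk_BH { op :> l2 -> l2; op_linear : is_linear op }.

Lemma BH_ext (a b : BH) : (forall x, a x = b x) -> a = b.
Proof.
destruct a as [a ha], b as [b hb]; simpl; intros H.
assert (a = b) by (apply functional_extensionality; exact H); subst b.
f_equal; apply proof_irrelevance.
Qed.

Lemma BH_one_lin : is_linear (fun x : l2 => x).
Proof. exact (is_linear_id (V := l2_NormedModule)). Qed.

Lemma BH_zero_lin : is_linear (fun _ : l2 => zero : l2).
Proof. exact (is_linear_zero (U := l2_NormedModule) (V := l2_NormedModule)). Qed.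

Lemma BH_mult_lin (a b : BH) : is_linear (fun x => a (b x)).
Proof. apply is_linear_comp; apply op_linear. Qed.

Lemma BH_plus_lin (a b : BH) : is_linear (fun x => plus (a x) (b x)).
Proof.
apply (is_linear_comp (fun x => (a x, b x)) (fun p => plus (fst p) (snd p))).
- apply is_linear_prod; apply op_linear.
- apply is_linear_plus.
Qed.

Lemma BH_scal_lin (c : C) (a : BH) : is_linear (fun x => scal c (a x)).
Proof.
apply (is_linear_comp a (fun y : l2 => scal c y)); [apply op_linear|].
apply (is_linear_scal_r (V := l2_NormedModule) c); intros; apply Cmult_comm.
Qed.

Definition BH_one : BH := Mk_BH _ BH_one_lin.
Definition BH_zero : BH := Mk_BH _ BH_zero_lin.
Definition BH_mult (a b : BH) : BH := Mk_BH _ (BH_mult_lin a b).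
Definition BH_plus (a b : BH) : BH := Mk_BH _ (BH_plus_lin a b).
Definition BH_scal (c : C) (a : BH) : BH := Mk_BH _ (BH_scal_lin c a).
Definition BH_opp (a : BH) : BH := BH_scal (- (1))%C a.

Definition BH_norm (a : BH) : R :=
  real (Lub_Rbar (fun r => exists x : l2, norm x <= 1 /\ r = norm (a x))).

Definition BH_AbelianMonoid_mixin : AbelianMonoid.mixin_of BH.
Proof.
apply (AbelianMonoid.Mixin BH BH_plus BH_zero).
- intros x y; apply BH_ext; intros l; simpl; apply plus_comm.
- intros x y z; apply BH_ext; intros l; simpl; apply plus_assoc.
- intros x; apply BH_ext; intros l; simpl; apply plus_zero_r.
Defined.
Canonical BH_AbelianMonoid := AbelianMonoid.Pack BH BH_AbelianMonoid_mixin BH.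

Definition BH_AbelianGroup_mixin : AbelianGroup.mixin_of BH_AbelianMonoid.
Proof.
apply (AbelianGroup.Mixin BH_AbelianMonoid BH_opp).
intros x; apply BH_ext; intros v; apply l2_ext; intros l; simpl; ring.
Defined.
Canonical BH_AbelianGroup :=
  AbelianGroup.Pack BH (AbelianGroup.Class _ _ BH_AbelianGroup_mixin) BH.

Definition BH_Ring_mixin : Ring.mixin_of BH_AbelianGroup.
Proof.
apply (Ring.Mixin BH_AbelianGroup BH_mult BH_one).
- intros a b c; apply BH_ext; reflexivity.
- intros a; apply BH_ext; reflexivity.
- intros a; apply BH_ext; reflexivity.
- intros a b c; apply BH_ext; reflexivity.
- intros a b c; apply BH_ext; intros x; apply (linear_plus _ (op_linear a)).
Defined.
Canonical BH_Ring := Ring.Pack BH (Ring.Class _ _ BH_Ring_mixin) BH.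

Definition BH_ModuleSpace_mixin : ModuleSpace.mixin_of C_Ring BH_AbelianGroup.
Proof.
apply (ModuleSpace.Mixin C_Ring BH_AbelianGroup BH_scal).
- intros a b x; apply BH_ext; intros v; simpl; apply (scal_assoc a b (op x v)).
- intros x; apply BH_ext; intros v; simpl; apply (scal_one (op x v)).
- intros a x y; apply BH_ext; intros v; simpl; apply (scal_distr_l a (op x v) (op y v)).
- intros a b x; apply BH_ext; intros v; simpl; apply (scal_distr_r a b (op x v)).
Defined.
Canonical BH_ModuleSpace :=
  ModuleSpace.Pack C_Ring BH (ModuleSpace.Class _ _ _ BH_ModuleSpace_mixin) BH.

Lemma norm_zero_l2 : norm (zero : l2) = 0.
Proof. exact (norm_zero (V := l2_NormedModule)). Qed.

Lemma norm_l2_ge_0 (x : l2) : 0 <= norm x.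
Proof. exact (l2_norm_ge_0 x). Qed.

Lemma BH_norm_spec (a : BH) :
  0 <= BH_norm a /\
  (forall x : l2, norm x <= 1 -> norm (a x) <= BH_norm a) /\
  (forall M, (forall x : l2, norm x <= 1 -> norm (a x) <= M) -> BH_norm a <= M).
Proof.
unfold BH_norm.
set (A := fun r => exists x : l2, norm x <= 1 /\ r = norm (a x)).
destruct (Lub_Rbar_correct A) as [Hub Hlub].
destruct (linear_norm _ (op_linear a)) as [M [hM HM]].
assert (Z0 : norm (zero : l2) <= 1) by (rewrite norm_zero_l2; lra).
assert (Hlo : Rbar_le (norm (a zero)) (Lub_Rbar A)) by (apply Hub; exists zero; auto).
assert (Hhi : Rbar_le (Lub_Rbar A) M).
{ apply Hlub; intros r [x [hx ->]]; simpl.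
  eapply Rle_trans; [apply HM|]. assert (h := norm_l2_ge_0 x); nra. }
destruct (Lub_Rbar A) as [L| |] eqn:EL; simpl in Hlo, Hhi; try tauto.
simpl; split; [|split].
- eapply Rle_trans; [apply norm_l2_ge_0|exact Hlo].
- intros x hx; apply (Hub (norm (a x))); exists x; auto.
- intros N HN; apply (Hlub N); intros r [x [hx ->]]; apply HN; exact hx.
Qed.

Lemma BH_norm_ge_0 (a : BH) : 0 <= BH_norm a.
Proof. apply BH_norm_spec. Qed.

Lemma BH_norm_le (a : BH) (x : l2) : norm (a x) <= BH_norm a * norm x.
Proof.
destruct (BH_norm_spec a) as [H0 [H1 _]].
assert (hx := norm_l2_ge_0 x).
destruct (Rle_lt_or_eq_dec _ _ hx) as [px|zx].
- assert (hn : forall y : l2, norm (scal (RtoC (/ norm x)) y) = / norm x * norm y).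
  { intros y; change (l2_norm (l2_scal (RtoC (/ norm x)) y) = / norm x * l2_norm y).
    rewrite l2_norm_scal, Cmod_R, Rabs_pos_eq; [reflexivity|].
    left; apply Rinv_0_lt_compat; exact px. }
  specialize (H1 (scal (RtoC (/ norm x)) x)).
  rewrite (linear_scal _ (op_linear a)), !hn in H1.
  rewrite Rinv_l in H1 by lra.
  specialize (H1 (Rle_refl 1)).
  apply (Rmult_le_compat_r (norm x)) in H1; [|lra].
  replace (/ norm x * norm (a x) * norm x) with (norm (a x)) in H1 by (field; lra).
  exact H1.
- destruct (linear_norm _ (op_linear a)) as [M [hM HM]].
  specialize (HM x); rewrite <- zx in HM |- *; lra.
Qed.

Lemma BH_norm_bound (a : BH) (M : R) :
  0 <= M -> (forall x : l2, norm (a x) <= M * norm x) -> BH_norm a <= M.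
Proof.
intros hM H; apply BH_norm_spec; intros x hx.
eapply Rle_trans; [apply H|]. assert (h := norm_l2_ge_0 x); nra.
Qed.

Lemma BH_norm_triangle (a b : BH) : BH_norm (BH_plus a b) <= BH_norm a + BH_norm b.
Proof.
assert (ha := BH_norm_ge_0 a). assert (hb := BH_norm_ge_0 b).
apply BH_norm_bound; [lra|]; intros x; simpl.
eapply Rle_trans; [apply (norm_triangle (V := l2_NormedModule))|].
assert (h1 := BH_norm_le a x). assert (h2 := BH_norm_le b x). lra.
Qed.

Lemma BH_norm_scal (c : C) (a : BH) : BH_norm (BH_scal c a) <= Cmod c * BH_norm a.
Proof.
apply BH_norm_bound.
- apply Rmult_le_pos; [apply Cmod_ge_0|apply BH_norm_ge_0].
- intros x; simpl; eapply Rle_trans; [apply (norm_scal (V := l2_NormedModule) c (op a x))|].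
  change (abs c) with (Cmod c).
  assert (h := BH_norm_le a x). assert (h' := Cmod_ge_0 c).
  rewrite Rmult_assoc; apply Rmult_le_compat_l; assumption.
Qed.

Lemma BH_norm_eq_0 (a : BH) : BH_norm a = 0 -> a = BH_zero.
Proof.
intros H; apply BH_ext; intros x; simpl; apply (norm_eq_zero (V := l2_NormedModule)).
assert (h := BH_norm_le a x). rewrite H in h.
assert (h' := norm_l2_ge_0 (a x)). lra.
Qed.

Definition BH_ball (a : BH) (eps : R) (b : BH) : Prop := BH_norm (minus b a) < eps.

Definition BH_UniformSpace_mixin : UniformSpace.mixin_of BH.
Proof.
apply (UniformSpace.Mixin BH BH_zero BH_ball); unfold BH_ball.
- intros x e; rewrite minus_eq_zero.
  eapply Rle_lt_trans; [|apply (cond_pos e)].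
  apply BH_norm_bound; [lra|]; intros v; change (op zero v) with (zero : l2).
  rewrite norm_zero_l2; lra.
- intros x y e H; replace (minus x y) with (BH_scal (- (1))%C (minus y x)).
  + eapply Rle_lt_trans; [apply BH_norm_scal|]; rewrite Cmod_opp, Cmod_1; lra.
  + apply BH_ext; intros v; apply l2_ext; intros l; simpl; ring.
- intros x y z e1 e2 H1 H2.
  replace (minus z x) with (BH_plus (minus z y) (minus y x)).
  + eapply Rle_lt_trans; [apply BH_norm_triangle|lra].
  + apply BH_ext; intros v; apply l2_ext; intros l; simpl; ring.
Defined.
Canonical BH_UniformSpace := UniformSpace.Pack BH BH_UniformSpace_mixin BH.

Canonical BH_NormedModuleAux :=
  NormedModuleAux.Pack C_AbsRing BH
    (NormedModuleAux.Class C_AbsRing BH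
       (ModuleSpace.class C_Ring BH_ModuleSpace) BH_UniformSpace_mixin) BH.

Definition BH_NormedModule_mixin : NormedModule.mixin_of C_AbsRing BH_NormedModuleAux.
Proof.
apply (NormedModule.Mixin C_AbsRing BH_NormedModuleAux BH_norm 1).
- exact BH_norm_triangle.
- exact BH_norm_scal.
- intros x y eps H; exact H.
- intros x y eps H; rewrite Rmult_1_l; exact H.
- exact BH_norm_eq_0.
Defined.
Canonical BH_NormedModule :=
  NormedModule.Pack C_AbsRing BH
    (NormedModule.Class _ _ _ BH_NormedModule_mixin) BH.

(** Definite description: used only for predicates [P] that determine a bounded
    operator uniquely, such as prescribed values on the basis. *)
Definition the_op (P : BH -> Prop) : BH := epsilon (inhabits BH_zero) P.

Definition is_adjoint (a b : BH) : Prop :=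
  forall x y : l2, inner (a x) y = inner x (b y).

Definition adjoint (a : BH) : BH := the_op (is_adjoint a).

(** The inverse limit of the [Z/s^n Z]: for [0 < s] the case [m = n] of the
    compatibility condition makes [zs_res n] the representative in [0, s^n). *)
Record Zs (s : Z) : Type := Mk_Zs {
  zs_res : nat -> Z;
  zs_compat : forall m n : nat, (m <= n)%nat ->
    (zs_res n mod s ^ Z.of_nat m)%Z = zs_res m }.
Arguments zs_res {s} _ _.

Lemma Zs_of_Z_compat (s l : Z) (m n : nat) : (m <= n)%nat ->
  ((l mod s ^ Z.of_nat n) mod s ^ Z.of_nat m = l mod s ^ Z.of_nat m)%Z.
Proof.
intros h.
destruct (Z.eq_dec (s ^ Z.of_nat n) 0) as [e|e].
- rewrite e, Zmod_0_r; reflexivity.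
- rewrite (Z.mod_eq l _ e).
  replace (Z.of_nat n) with (Z.of_nat (n - m) + Z.of_nat m)%Z at 1 by lia.
  rewrite Z.pow_add_r by lia.
  match goal with |- ((l - ?A * ?B * ?q) mod _ = _)%Z =>
    replace (l - A * B * q)%Z with (l + (- (A * q)) * B)%Z by ring end.
  apply Z_mod_plus_full.
Qed.

Definition Zs_of_Z (s l : Z) : Zs s :=
  Mk_Zs s (fun n => l mod s ^ Z.of_nat n)%Z (Zs_of_Z_compat s l).

(** The inverse limit topology: points within [eps] of each other agree modulo
    [s^n] for all [n < 1 / eps]. *)
Definition Zs_ball {s : Z} (x : Zs s) (eps : R) (y : Zs s) : Prop :=
  0 < eps /\ forall n : nat, INR n * eps < 1 -> zs_res x n = zs_res y n.

Definition Zs_UniformSpace_mixin (s : Z) : UniformSpace.mixin_of (Zs s).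
Proof.
apply (UniformSpace.Mixin (Zs s) (Zs_of_Z s 0) Zs_ball); unfold Zs_ball.
- intros x e; split; [apply cond_pos|reflexivity].
- intros x y e [h H]; split; [exact h|]; intros n hn; symmetry; auto.
- intros x y z e1 e2 [h1 H1] [h2 H2]; split; [lra|].
  intros n hn; assert (h := pos_INR n).
  rewrite H1, H2; [reflexivity| |]; nra.
Defined.
Canonical Zs_UniformSpace (s : Z) :=
  UniformSpace.Pack (Zs s) (Zs_UniformSpace_mixin s) (Zs s).

Definition Zs_unit {s : Z} (x : Zs s) : Prop := zs_res x 1 <> 0%Z.

Definition nat_UniformSpace_mixin : UniformSpace.mixin_of nat.
Proof.
apply (UniformSpace.Mixin nat 0%nat (fun m _ n => m = n)); congruence.
Defined.
(** Discrete. *)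
Canonical nat_UniformSpace := UniformSpace.Pack nat nat_UniformSpace_mixin nat.

Definition compact_set {T : UniformSpace} (K : T -> Prop) : Prop :=
  forall (I : Type) (O : I -> T -> Prop),
    (forall i, open (O i)) -> (forall x, K x -> exists i, O i x) ->
    exists L : list I, forall x, K x -> exists i, In i L /\ O i x.

(** The restriction of [F] to the subspace [X] belongs to [C_0(X)]. *)
Definition C0_on {T : UniformSpace} (X : T -> Prop) (F : T -> C) : Prop :=
  continuous_on (U := C_UniformSpace) X F /\
  forall eps : posreal, exists K : T -> Prop,
    compact_set K /\ (forall x, K x -> X x) /\
    forall x, X x -> ~ K x -> Cmod (F x) < eps.

Definition V (s : Z) : BH := the_op (fun a => forall l, a (E l) = E (s * l)).

Definition M (s : Z) (f : Zs s -> C) : BH :=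
  the_op (fun a => forall l, a (E l) = scal (f (Zs_of_Z s l)) (E l)).

Definition is_Cstar_subalgebra (A : BH -> Prop) : Prop :=
  (forall a b, A a -> A b -> A (plus a b)) /\
  (forall (c : C) a, A a -> A (scal c a)) /\
  (forall a b, A a -> A b -> A (mult a b)) /\
  (forall a, A a -> A (adjoint a)) /\
  closed A.

Definition HS (s : Z) (a : BH) : Prop :=
  forall A : BH -> Prop, is_Cstar_subalgebra A ->
    A (V s) ->
    (forall f : Zs s -> C, (forall x, continuous (U := C_UniformSpace) f x) -> A (M s f)) ->
    A a.

(** Only the values [F (m, x)] with [Zs_unit x] matter. *)
Definition M2 (s : Z) (F : nat * Zs s -> C) : BH :=
  the_op (fun a =>
    a (E 0) = zero /\
    forall (m : nat) (l : Z), ~ (s | l)%Z ->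
      a (E (s ^ Z.of_nat m * l)) = scal (F (m, Zs_of_Z s l)) (E (s ^ Z.of_nat m * l))).

Definition rapid_decay {s : Z} (F : Z -> nat * Zs s -> C) : Prop :=
  forall N : nat, exists B : R, forall (n : Z) (m : nat) (x : Zs s), Zs_unit x ->
    (1 + INR m + IZR (Z.abs n)) ^ N * Cmod (F n (m, x)) <= B.

Definition I_smooth (s : Z) (c : BH) : Prop :=
  exists F : Z -> nat * Zs s -> C,
    (forall n, C0_on (fun p : nat * Zs s => Zs_unit (snd p)) (F n)) /\
    rapid_decay F /\
    is_zseries (fun n : Z =>
      if (0 <=? n)%Z then mult (pow_n (V s) (Z.to_nat n)) (M2 s (F n))
      else mult (M2 s (F n)) (pow_n (adjoint (V s)) (Z.to_nat (- n)))) c.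

(** Elements of [C^oo(R/Z)], as 1-periodic functions on [R]. *)
Definition smooth_periodic (phi : R -> C) : Prop :=
  (forall t, phi (t + 1) = phi t) /\
  forall n t, ex_derive_n (fun u => Re (phi u)) n t /\
              ex_derive_n (fun u => Im (phi u)) n t.

Definition fourier_coef (phi : R -> C) (m : Z) : C :=
  RInt (V := C_R_CompleteNormedModule)
    (fun t => Cmult (phi t) (cos (2 * PI * IZR m * t), - sin (2 * PI * IZR m * t))) 0 1.

Definition is_T (s : Z) (phi : R -> C) (b : BH) : Prop :=
  is_zseries (fun m : Z =>
    scal (fourier_coef phi m)
      (if (0 <=? m)%Z then pow_n (V s) (Z.to_nat m)
       else pow_n (adjoint (V s)) (Z.to_nat (- m)))) b.

Definition HS_smooth (s : Z) (a : BH) : Prop :=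
  exists (phi : R -> C) (b c : BH),
    smooth_periodic phi /\ is_T s phi b /\ I_smooth s c /\ a = plus b c.

Definition inverse_of (a b : BH) : Prop := mult a b = one /\ mult b a = one.

Definition spectrum (s : Z) (a : BH) (z : C) : Prop :=
  ~ exists b, HS s b /\ inverse_of (minus (scal z (one : BH)) a) b.

Definition resolvent (a : BH) (z : C) : BH :=
  the_op (inverse_of (minus (scal z (one : BH)) a)).

Definition holomorphic_on (U : C -> Prop) (g : C -> C) : Prop :=
  forall z, U z -> ex_derive (K := C_AbsRing) (V := C_NormedModule) g z.

Definition R_ModuleSpace_mixin (V : NormedModule C_AbsRing) :
  ModuleSpace.mixin_of R_Ring (NormedModule.AbelianGroup C_AbsRing V).
Proof.
apply (ModuleSpace.Mixin R_Ring (NormedModule.AbelianGroup C_AbsRing V)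
         (fun (r : R) (v : V) => scal (RtoC r) v)).
- intros x y u; rewrite scal_assoc; f_equal; symmetry; apply RtoC_mult.
- intros u; apply (scal_one u).
- intros x u v; apply (scal_distr_l (RtoC x) u v).
- intros x y u; etransitivity; [|exact (scal_distr_r (RtoC x) (RtoC y) u)].
  f_equal; apply RtoC_plus.
Defined.

Definition R_NormedModuleAux (V : NormedModule C_AbsRing) : NormedModuleAux R_AbsRing :=
  NormedModuleAux.Pack R_AbsRing V
    (NormedModuleAux.Class R_AbsRing V
       (ModuleSpace.Class _ _ _ (R_ModuleSpace_mixin V))
       (UniformSpace.class (NormedModule.UniformSpace C_AbsRing V))) V.

Definition R_NormedModule_mixin (V : NormedModule C_AbsRing) :
  NormedModule.mixin_of R_AbsRing (R_NormedModuleAux V).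
Proof.
apply (NormedModule.Mixin R_AbsRing (R_NormedModuleAux V)
         (fun v : V => norm v) (norm_factor (V := V))).
- intros x y; apply (norm_triangle (V := V) x y).
- intros r x; eapply Rle_trans; [apply (norm_scal (V := V) (RtoC r) x)|].
  change (abs (RtoC r)) with (Cmod r); rewrite Cmod_R; apply Rle_refl.
- intros x y eps H; apply (norm_compat1 (V := V) x y eps H).
- intros x y eps H; apply (norm_compat2 (V := V) x y eps H).
- intros x H; apply (norm_eq_zero (V := V) x H).
Defined.

(** [is_RInt] needs real scalars, so complex spaces are integrated into through
    their underlying real normed space. *)
Definition realify (V : NormedModule C_AbsRing) : NormedModule R_AbsRing :=
  NormedModule.Pack R_AbsRing V
    (NormedModule.Class _ _ _ (R_NormedModule_mixin V)) V.

Record C1_path : Type := Mk_C1_path {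
  path : R -> C;
  velocity : R -> C;
  path_derive : forall t, 0 <= t <= 1 ->
    is_derive (K := R_AbsRing) (V := C_R_NormedModule) path t (velocity t);
  velocity_continuous : forall t, 0 <= t <= 1 ->
    continuous (U := C_UniformSpace) velocity t }.

Definition on_chain (G : list C1_path) (z : C) : Prop :=
  exists p t, In p G /\ 0 <= t <= 1 /\ z = path p t.

(** A chain is a cycle when its boundary vanishes, that is when initial and
    final points agree with multiplicity; a piecewise [C^1] closed curve is the
    cycle of its [C^1] pieces. *)
Definition is_cycle (G : list C1_path) : Prop :=
  Permutation (map (fun p => path p 0) G) (map (fun p => path p 1) G).

Definition is_contour_int {V : NormedModule C_AbsRing}
    (h : C -> V) (G : list C1_path) (v : V) : Prop :=
  is_RInt (V := realify V)
    (fun t => fold_right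
       (fun p acc => plus (scal (velocity p t) (h (path p t))) acc) zero G : V) 0 1 v.

Definition two_pi_i : C := (0, 2 * PI).

Definition winding_number (G : list C1_path) (z : C) (n : Z) : Prop :=
  is_contour_int (V := C_NormedModule) (fun w => / (w - z))%C G (two_pi_i * IZR n)%C.

Definition surrounds (G : list C1_path) (K U : C -> Prop) : Prop :=
  is_cycle G /\
  (forall z, on_chain G z -> U z /\ ~ K z) /\
  (forall z, K z -> winding_number G z 1) /\
  (forall z, ~ U z -> winding_number G z 0).

Definition is_cauchy_calculus (a : BH) (g : C -> C) (G : list C1_path) (b : BH) : Prop :=
  exists v : BH,
    is_contour_int (fun z => scal (g z) (resolvent a z)) G v /\
    b = scal (/ two_pi_i)%C v.

(* Main.v *)
(** Idea. Every nonzero integer is [s^k l] with [s] not dividing [l], and for each such [l] the span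
    of the [E (s^k l)], [k >= 0], is invariant; on it [V] is the unilateral shift. An element
    [a = T(phi) + c] of the smooth algebra is thus a family, continuous in [l], of Toeplitz matrices
    perturbed by rapidly decreasing ones. Suppose that [B] inverts [z - a]. Testing on approximate
    eigenvectors shows that [z - phi] does not vanish, so [1 / (z - phi)] is smooth and gives a
    Toeplitz parametrix [Y] for which [(z - a) Y - 1] decays along columns and [Y (z - a) - 1] along
    rows. Writing [B - Y] as [B (1 - (z - a) Y)] and as [(1 - Y (z - a)) B] shows that the entries of
    [B - Y] decay rapidly in both indices, with constants that depend only on bounds for [z] and [B];
    only the boundedness of [B] enters. These estimates survive integration along the contour, and
    the entries of the integral extend continuously from integers [l] to s-adic units. *)

Require Import Defs.
From Stdlib Require Import Lra Lia Znumtheory ClassicalEpsilon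
  FunctionalExtensionality PropExtensionality.
Open Scope R_scope.

(** The difficulty is uniformity: that every resolvent lies in the smooth algebra says nothing about
    the integral. Membership is therefore recast as a list of conditions on matrix entries
    ([smooth_entries]), each of which survives integration once its constants are common to the
    whole contour. For the same reason the lower bound for [z - phi] has to be explicit; it is the
    inverse of [norm B]. The Toeplitz operators with symbols [z - phi] and [1 / (z - phi)] fail to
    be inverse to each other only because a shift can push an index below level 0. At level k this
    concerns only coefficients whose index exceeds k in absolute value, and these are small. A
    one-sided remainder is enough on each side: multiplying by a bounded [B] on the left keeps a
    column estimate, on the right a row estimate. The vector [E 0] lies in no block. [V] fixes it,
    so there an operator of the algebra acts as its symbol at t = 0, and the resolvent has to be
    shown to do so through the same coefficients [psi] that describe its Toeplitz part on the
    blocks. *)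

Lemma ex_choice {A B : Type} (P : A -> B -> Prop) :
  (forall x, exists y, P x y) -> exists f : A -> B, forall x, P x (f x).
Proof.
intros H; exists (fun x => proj1_sig (constructive_indefinite_description _ (H x))).
intros x; exact (proj2_sig (constructive_indefinite_description _ (H x))).
Qed.

(** * Polynomial weights on the integers *)

Definition br (n : Z) : R := 1 + IZR (Z.abs n).

(** A fixed summable majorant. Series over the integers are compared with multiples of it, at the
    price of two powers of [br]. *)
Definition wt (n : Z) : R := / br n ^ 2.

Lemma br_ge_1 (n : Z) : 1 <= br n.
Proof. unfold br; assert (h := IZR_le 0 (Z.abs n) (Z.abs_nonneg n)); lra. Qed.

Lemma br_pow_ge_1 (n : Z) (N : nat) : 1 <= br n ^ N.
Proof. apply pow_R1_Rle, br_ge_1. Qed.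

Lemma br_pow_pos (n : Z) (N : nat) : 0 < br n ^ N.
Proof. assert (h := br_pow_ge_1 n N); lra. Qed.

Lemma wt_pos (n : Z) : 0 < wt n.
Proof. apply Rinv_0_lt_compat, br_pow_pos. Qed.

Lemma br_mono (m n : Z) : (Z.abs m <= Z.abs n)%Z -> br m <= br n.
Proof. intros h; unfold br; apply IZR_le in h; lra. Qed.

Lemma br_pow_mono (m n : Z) (N : nat) : (Z.abs m <= Z.abs n)%Z -> br m ^ N <= br n ^ N.
Proof.
intros h; apply pow_incr; split; [assert (h1 := br_ge_1 m); lra|apply br_mono, h].
Qed.

(** Submultiplicativity is what lets decay pass through a shift of indices: a power of [br] at one
    index splits over the other index and the shift. *)
Lemma br_add (m n : Z) : br (m + n) <= br m * br n.
Proof.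
unfold br.
assert (h := IZR_le _ _ (Z.abs_triangle m n)); rewrite plus_IZR in h.
assert (h1 := IZR_le 0 _ (Z.abs_nonneg m)); assert (h2 := IZR_le 0 _ (Z.abs_nonneg n)).
nra.
Qed.

Lemma br_opp (n : Z) : br (- n) = br n.
Proof. unfold br; rewrite Z.abs_opp; reflexivity. Qed.

Lemma br_pow_add (m n : Z) (N : nat) : br (m + n) ^ N <= br m ^ N * br n ^ N.
Proof.
rewrite <- Rpow_mult_distr; apply pow_incr; split; [assert (h1 := br_ge_1 (m + n)); lra|].
apply br_add.
Qed.

Lemma le_div_of_mult (x y c : R) : 0 < c -> c * x <= y -> x <= y / c.
Proof.
intros hc h; apply (Rmult_le_reg_l c); [exact hc|].
replace (c * (y / c)) with y by (field; lra); exact h.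
Qed.

Lemma ex_series_bounded (u : nat -> R) (B : R) :
  (forall n, 0 <= u n) -> (forall n, sum_n u n <= B) -> ex_series u /\ Series u <= B.
Proof.
intros H HB.
assert (h : ex_finite_lim_seq (sum_n u)).
{ apply ex_finite_lim_seq_incr with B; auto.
  intros n; rewrite sum_Sn; unfold plus; simpl; specialize (H (S n)); lra. }
destruct h as [l hl].
assert (hs : is_series u l) by exact hl.
split; [exists l; exact hs|].
rewrite (is_series_unique _ _ hs).
apply (is_lim_seq_le (sum_n u) (fun _ => B) l B HB hl (is_lim_seq_const B)).
Qed.

(** Telescoping: 1 / (2 + n)^2 is at most 1 / (1 + n) - 1 / (2 + n). The subtracted term makes the
    induction go through. *)
Lemma sum_inv_sq (n : nat) :
  sum_n (fun k => / (1 + INR k) ^ 2) n <= 2 - / (1 + INR n).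
Proof.
induction n as [|n IH].
- rewrite sum_O; simpl; lra.
- rewrite sum_Sn; unfold plus; simpl plus; rewrite S_INR.
  assert (h := pos_INR n).
  assert (/ (1 + (INR n + 1)) ^ 2 <= / (1 + INR n) - / (1 + (INR n + 1))).
  { replace (/ (1 + INR n) - / (1 + (INR n + 1)))
      with (/ ((1 + INR n) * (1 + (INR n + 1)))) by (field; lra).
    apply Rinv_le_contravar; nra. }
  simpl in *; lra.
Qed.

Lemma ex_zseries_wt : ex_zseries wt.
Proof.
(* Each half of the integers is enumerated so that the n-th element has absolute value at least
   n. *)
assert (A : forall f : nat -> Z, (forall n, (Z.of_nat n <= Z.abs (f n))%Z) ->
  ex_series (fun n => wt (f n))).
{ intros f hf.
  apply (ex_series_bounded _ 2); [intros n; left; apply wt_pos|].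
  intros n; apply Rle_trans with (sum_n (fun k => / (1 + INR k) ^ 2) n).
  - apply sum_n_m_le; intros k; unfold wt.
    apply Rinv_le_contravar.
    + apply pow_lt; assert (h := pos_INR k); lra.
    + apply pow_incr; unfold br; rewrite INR_IZR_INZ.
      specialize (hf k); apply IZR_le in hf.
      assert (h := IZR_le 0 _ (Zle_0_nat k)); lra.
  - eapply Rle_trans; [apply sum_inv_sq|].
    assert (h := pos_INR n).
    assert (0 < / (1 + INR n)) by (apply Rinv_0_lt_compat; lra); lra. }
split; apply A; intros n; lia.
Qed.

Definition wtot : R := ZSeries wt.

Lemma wtot_ge_1 : 1 <= wtot.
Proof.
eapply Rle_trans; [|apply (ZSeries_term_le wt 0%Z)].
- unfold wt, br; simpl; lra.
- intros k; left; apply wt_pos.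
- apply ex_zseries_wt.
Qed.

(** * Series in normed modules *)

Lemma minus_minus_r {G : AbelianGroup} (x y : G) : minus x (minus x y) = y.
Proof.
change (plus x (opp (plus x (opp y))) = y).
rewrite opp_plus, opp_opp, plus_assoc, plus_opp_r; apply plus_zero_l.
Qed.

Lemma plus_plus_swap {G : AbelianMonoid} (a b c d : G) :
  plus (plus a b) (plus c d) = plus (plus a c) (plus b d).
Proof.
rewrite <- !plus_assoc; f_equal; rewrite !plus_assoc; f_equal; apply plus_comm.
Qed.

Section NormedSeries.
Context {K : AbsRing} {V : NormedModule K}.

Lemma norm_lim_le (u : nat -> V) (l : V) (B : R) :
  (forall n, norm (u n) <= B) -> filterlim u eventually (locally l) -> norm l <= B.
Proof.
intros HB Hl; apply le_epsilon; intros eps heps.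
(* Balls and norms agree only up to [norm_factor], hence this radius. *)
assert (hn : 0 < eps / (2 * norm_factor (V := V))).
{ apply Rdiv_lt_0_compat; [lra|]; assert (h := norm_factor_gt_0 (V := V)); lra. }
assert (Hb := Hl (ball l (mkposreal _ hn)) (locally_ball l _)).
destruct Hb as [n Hn]; specialize (Hn n (Nat.le_refl n)).
apply norm_compat2 in Hn; simpl in Hn.
replace (norm_factor (V := V) * (eps / (2 * norm_factor (V := V)))) with (eps / 2) in Hn
  by (field; assert (h := norm_factor_gt_0 (V := V)); lra).
replace l with (minus (u n) (minus (u n) l)).
- eapply Rle_trans; [apply norm_triangle|]; rewrite norm_opp.
  specialize (HB n); lra.
- apply minus_minus_r.
Qed.

Lemma norm_sum_n_le (u : nat -> V) (w : nat -> R) (n : nat) :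
  (forall k, norm (u k) <= w k) -> norm (sum_n u n) <= sum_n w n.
Proof.
intros H; induction n as [|n IH].
- rewrite !sum_O; apply H.
- rewrite !sum_Sn; eapply Rle_trans; [apply norm_triangle|].
  change (norm (sum_n u n) + norm (u (S n)) <= sum_n w n + w (S n)); specialize (H (S n)); lra.
Qed.

Lemma sum_n_le_Series (w : nat -> R) (n : nat) :
  (forall k, 0 <= w k) -> ex_series w -> sum_n w n <= Series w.
Proof.
intros H He; apply (is_lim_seq_incr_compare (sum_n w)).
- apply Series_correct in He; exact He.
- intros k; rewrite sum_Sn; unfold plus; simpl; specialize (H (S k)); lra.
Qed.

Lemma is_series_norm_le (u : nat -> V) (l : V) (w : nat -> R) :
  (forall k, norm (u k) <= w k) -> ex_series w -> is_series u l -> norm l <= Series w.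
Proof.
intros H He Hl; apply (norm_lim_le (sum_n u)); [|exact Hl].
intros n; eapply Rle_trans; [apply norm_sum_n_le, H|].
apply sum_n_le_Series; [|exact He].
intros k; apply Rle_trans with (norm (u k)); [apply norm_ge_0|apply H].
Qed.

Lemma is_series_unique_V (u : nat -> V) (l l' : V) :
  is_series u l -> is_series u l' -> l = l'.
Proof. apply filterlim_locally_unique. Qed.

Lemma is_zseries_ext (u v : Z -> V) (l : V) :
  (forall n, u n = v n) -> is_zseries u l -> is_zseries v l.
Proof.
intros H [p [q [hp [hq hl]]]]; exists p, q; split; [|split; [|exact hl]];
  (eapply is_series_ext; [|eassumption]); intros n; apply H.
Qed.

Lemma is_zseries_unique (u : Z -> V) (l l' : V) :
  is_zseries u l -> is_zseries u l' -> l = l'.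
Proof.
intros [p [q [hp [hq hl]]]] [p' [q' [hp' [hq' hl']]]].
rewrite hl, hl', (is_series_unique_V _ _ _ hp hp'), (is_series_unique_V _ _ _ hq hq').
reflexivity.
Qed.

Lemma is_zseries_plus (u v : Z -> V) (l l' : V) :
  is_zseries u l -> is_zseries v l' -> is_zseries (fun n => plus (u n) (v n)) (plus l l').
Proof.
intros [p [q [hp [hq hl]]]] [p' [q' [hp' [hq' hl']]]].
exists (plus p p'), (plus q q'); split; [|split].
- apply (is_series_plus _ _ _ _ hp hp').
- apply (is_series_plus _ _ _ _ hq hq').
- rewrite hl, hl'; apply plus_plus_swap.
Qed.

(** The form in which all sums of operators, vectors and numbers are estimated: a termwise bound by
    [wt], with [wtot] as the only loss. *)
Lemma is_zseries_norm_le (u : Z -> V) (l : V) (c : R) :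
  (forall n, norm (u n) <= c * wt n) -> is_zseries u l -> norm l <= c * wtot.
Proof.
intros H [p [q [hp [hq ->]]]].
eapply Rle_trans; [apply norm_triangle|].
destruct ex_zseries_wt as [e1 e2].
unfold wtot, ZSeries; rewrite Rmult_plus_distr_l, <- !Series_scal_l.
apply Rplus_le_compat.
- apply (is_series_norm_le _ p (fun n => c * wt (Z.of_nat n)) (fun n => H _)
    (ex_series_scal c _ e1) hp).
- apply (is_series_norm_le _ q (fun n => c * wt (- Z.of_nat n - 1)%Z) (fun n => H _)
    (ex_series_scal c _ e2) hq).
Qed.

Lemma sum_n_single (u : nat -> V) (n0 : nat) :
  (forall n, n <> n0 -> u n = zero) ->
  forall n, sum_n u n = if le_dec n0 n then u n0 else zero.
Proof.
intros H; induction n as [|n IH].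
- rewrite sum_O; destruct (le_dec n0 0) as [h|h].
  + replace n0 with 0%nat by lia; reflexivity.
  + apply H; lia.
- rewrite sum_Sn, IH; destruct (le_dec n0 n) as [h|h], (le_dec n0 (S n)) as [h'|h']; try lia.
  + rewrite (H (S n)) by lia; apply plus_zero_r.
  + replace n0 with (S n) by lia; apply plus_zero_l.
  + rewrite (H (S n)) by lia; apply plus_zero_l.
Qed.

Lemma is_series_single (u : nat -> V) (n0 : nat) :
  (forall n, n <> n0 -> u n = zero) -> is_series u (u n0).
Proof.
intros H; apply (filterlim_ext_loc (fun _ => u n0)); [|apply filterlim_const].
exists n0; intros n hn; rewrite (sum_n_single u n0 H); destruct (le_dec n0 n); [reflexivity|lia].
Qed.

Lemma is_series_zero (u : nat -> V) : (forall n, u n = zero) -> is_series u zero.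
Proof.
intros H; assert (h := is_series_single u 0 (fun n _ => H n)); rewrite (H 0%nat) in h; exact h.
Qed.

Lemma is_zseries_single (u : Z -> V) (n0 : Z) :
  (forall n, n <> n0 -> u n = zero) -> is_zseries u (u n0).
Proof.
pattern n0; apply Z_two_sided; clear n0; intros k H.
- exists (u (Z.of_nat k)), zero; split; [|split].
  + apply (is_series_single (fun n => u (Z.of_nat n))); intros n hn; apply H; lia.
  + apply is_series_zero; intros n; apply H; lia.
  + symmetry; apply plus_zero_r.
- exists zero, (u (- Z.of_nat k - 1)%Z); split; [|split].
  + apply is_series_zero; intros n; apply H; lia.
  + apply (is_series_single (fun n => u (- Z.of_nat n - 1)%Z)); intros n hn; apply H; lia.
  + symmetry; apply plus_zero_l.
Qed.

End NormedSeries.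

Lemma ex_zseries_complete {K : AbsRing} {V : CompleteNormedModule K} (u : Z -> V) (c : R) :
  (forall n, norm (u n) <= c * wt n) -> exists l, is_zseries u l.
Proof.
intros H; destruct ex_zseries_wt as [e1 e2].
destruct (ex_series_le (fun n => u (Z.of_nat n)) (fun n => c * wt (Z.of_nat n)) (fun n => H _)
    (ex_series_scal c _ e1)) as [p hp].
destruct (ex_series_le (fun n => u (- Z.of_nat n - 1)%Z) (fun n => c * wt (- Z.of_nat n - 1)%Z)
    (fun n => H _) (ex_series_scal c _ e2)) as [q hq].
exists (plus p q), p, q; auto.
Qed.

Lemma is_series_linear {K : AbsRing} {U V : NormedModule K} (f : U -> V) (u : nat -> U) (l : U) :
  is_linear f -> is_series u l -> is_series (fun n => f (u n)) (f l).
Proof.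
intros hf hu.
apply (filterlim_ext (fun n => f (sum_n u n))).
- intros n; induction n as [|n IH].
  + rewrite !sum_O; reflexivity.
  + rewrite !sum_Sn, (linear_plus f hf), IH; reflexivity.
- eapply filterlim_comp; [exact hu|apply (linear_cont f l hf)].
Qed.

Lemma is_zseries_linear {K : AbsRing} {U V : NormedModule K} (f : U -> V) (u : Z -> U) (l : U) :
  is_linear f -> is_zseries u l -> is_zseries (fun n => f (u n)) (f l).
Proof.
intros hf [p [q [hp [hq ->]]]]; exists (f p), (f q); split; [|split].
- apply (is_series_linear f _ _ hf hp).
- apply (is_series_linear f _ _ hf hq).
- apply (linear_plus f hf).
Qed.

Lemma is_zseries_minus {K : AbsRing} {V : NormedModule K} (u v : Z -> V) (l l' : V) :
  is_zseries u l -> is_zseries v l' -> is_zseries (fun n => minus (u n) (v n)) (minus l l').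
Proof.
intros h h'; apply (is_zseries_plus _ _ _ _ h (is_zseries_linear opp _ _ is_linear_opp h')).
Qed.

Lemma is_zseries_Cmul (c : C) (u : Z -> C) (l : C) : is_zseries (V := C_NormedModule) u l ->
  is_zseries (V := C_NormedModule) (fun n => c * u n)%C (c * l)%C.
Proof.
exact (is_zseries_linear (U := C_NormedModule) (V := C_NormedModule) (fun x : C => scal c x) u l
  (is_linear_scal_r (V := C_NormedModule) c Cmult_comm)).
Qed.

(** * Nonnegative sums over Z through finite lists *)

(** A nonnegative sum over the integers is the supremum of its sums over duplicate-free lists.
    Unlike the two-sided series this does not depend on an enumeration, so reindexing by an
    injection is immediate. *)
Definition lsum {A : Type} (f : A -> R) (L : list A) : R :=
  fold_right (fun l acc => f l + acc) 0 L.

Lemma lsum_cons {A : Type} (f : A -> R) (l : A) (L : list A) :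
  lsum f (l :: L) = f l + lsum f L.
Proof. reflexivity. Qed.

Lemma lsum_app {A : Type} (f : A -> R) (L L' : list A) :
  lsum f (L ++ L') = lsum f L + lsum f L'.
Proof. induction L as [|l L IH]; simpl; [ring|rewrite IH; ring]. Qed.

Lemma lsum_ext {A : Type} (f g : A -> R) (L : list A) :
  (forall l, In l L -> f l = g l) -> lsum f L = lsum g L.
Proof.
induction L as [|l L IH]; simpl; intros H; [reflexivity|].
rewrite H, IH by auto; reflexivity.
Qed.

Lemma lsum_map {A B : Type} (f : B -> R) (h : A -> B) (L : list A) :
  lsum f (map h L) = lsum (fun l => f (h l)) L.
Proof. induction L as [|l L IH]; simpl; [reflexivity|rewrite IH; reflexivity]. Qed.

Lemma sum_n_lsum (u : nat -> R) (n : nat) : sum_n u n = lsum u (seq 0 (S n)).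
Proof.
induction n as [|n IH].
- rewrite sum_O; simpl; ring.
- rewrite sum_Sn, IH, (seq_S (S n)), lsum_app; simpl; unfold plus; simpl; ring.
Qed.

Lemma ZSeries_single (f : Z -> R) (n0 : Z) :
  (forall n, n <> n0 -> f n = 0) -> ex_zseries f /\ ZSeries f = f n0.
Proof.
intros H.
destruct (is_zseries_single (K := R_AbsRing) (V := R_NormedModule) f n0 H)
  as [p [q [hp [hq hl]]]].
split; [split; [exists p|exists q]; assumption|].
unfold ZSeries; rewrite (is_series_unique _ _ hp), (is_series_unique _ _ hq).
symmetry; exact hl.
Qed.

Lemma lsum_le_ZSeries (f : Z -> R) (L : list Z) :
  (forall l, 0 <= f l) -> ex_zseries f -> NoDup L -> lsum f L <= ZSeries f.
Proof.
revert f; induction L as [|l L IH]; intros f H He hL; simpl.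
- apply ZSeries_pos; assumption.
- inversion hL as [|? ? h1 h2]; subst.
  (* Split [f] into its value at [l] and the rest; the tail of the list does not see the
     difference. *)
  set (d := fun n => if Z.eq_dec n l then f l else 0).
  set (f' := fun n => if Z.eq_dec n l then 0 else f n).
  assert (hd : ex_zseries d /\ ZSeries d = d l).
  { apply ZSeries_single; intros n hn; unfold d; destruct (Z.eq_dec n l); [tauto|reflexivity]. }
  assert (H' : forall n, 0 <= f' n <= f n).
  { intros n; unfold f'; specialize (H n); destruct (Z.eq_dec n l); lra. }
  assert (He' : ex_zseries f') by (apply (ex_zseries_le _ f H' He)).
  rewrite (ZSeries_ext f (fun n => d n + f' n)).
  2: { intros n; unfold d, f'; destruct (Z.eq_dec n l); [subst|]; ring. }
  rewrite ZSeries_plus by tauto.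
  replace (f l) with (ZSeries d).
  2: { rewrite (proj2 hd); unfold d; destruct (Z.eq_dec l l); [reflexivity|tauto]. }
  apply Rplus_le_compat_l.
  rewrite (lsum_ext f f').
  + apply IH; [apply H'|exact He'|exact h2].
  + intros n hn; unfold f'; destruct (Z.eq_dec n l); [subst; tauto|reflexivity].
Qed.

Lemma NoDup_map_seq (h : nat -> Z) (n : nat) :
  (forall i j, h i = h j -> i = j) -> NoDup (map h (seq 0 n)).
Proof.
intros H; apply FinFun.Injective_map_NoDup; [exact H|apply seq_NoDup].
Qed.

Lemma ZSeries_le_lsum (f : Z -> R) (B : R) :
  (forall l, 0 <= f l) -> (forall L, NoDup L -> lsum f L <= B) ->
  ex_zseries f /\ ZSeries f <= B.
Proof.
intros H HB.
set (a := fun n => f (Z.of_nat n)). set (b := fun n => f (- Z.of_nat n - 1)%Z).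
(* The two halves are bounded jointly. First n tends to infinity with k fixed, then k, so that the
   bound [B] is not spent twice. *)
assert (Hab : forall n k, sum_n a n + sum_n b k <= B).
{ intros n k; rewrite !sum_n_lsum; unfold a, b.
  rewrite <- (lsum_map f Z.of_nat), <- (lsum_map f (fun n => - Z.of_nat n - 1)%Z).
  rewrite <- lsum_app; apply HB; apply NoDup_app.
  - apply NoDup_map_seq; intros; lia.
  - apply NoDup_map_seq; intros; lia.
  - intros x h1 h2; apply in_map_iff in h1, h2.
    destruct h1 as [? [? ?]], h2 as [? [? ?]]; lia. }
assert (Ha0 : forall n, 0 <= sum_n a n).
{ intros n; rewrite sum_n_lsum; clear -H; induction (seq 0 (S n)); simpl; [lra|].
  unfold a at 1; specialize (H (Z.of_nat a0)); lra. }
assert (Ha : forall n, 0 <= a n) by (intros; apply H).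
assert (Hb : forall n, 0 <= b n) by (intros; apply H).
assert (X : forall k, ex_series a /\ Series a <= B - sum_n b k).
{ intros k; apply ex_series_bounded; [exact Ha|]; intros n; specialize (Hab n k); lra. }
assert (Y : ex_series b /\ Series b <= B - Series a).
{ apply ex_series_bounded; [exact Hb|]; intros k; destruct (X k); lra. }
split; [split; [exact (proj1 (X 0%nat))|exact (proj1 Y)]|].
unfold ZSeries; fold a b; lra.
Qed.

(** * The Hilbert space l2(Z) *)

Lemma l2_coord_le (y : l2) (j : Z) : Cmod (y j) <= norm y.
Proof.
apply Rsqr_incr_0_var; [|apply norm_l2_ge_0]; rewrite !Rsqr_pow2.
change (Cmod (y j) ^ 2 <= l2_norm y ^ 2); rewrite l2_norm_sq.
apply (ZSeries_term_le (fun l => Cmod (y l) ^ 2)); [intros; apply pow2_ge_0|apply l2_sq].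
Qed.

Lemma l2_coord_linear (j : Z) :
  is_linear (U := l2_NormedModule) (V := C_NormedModule) (fun y : l2 => y j).
Proof.
apply Build_is_linear; [reflexivity|reflexivity|].
exists 1; split; [lra|]; intros y; rewrite Rmult_1_l; apply l2_coord_le.
Qed.

Lemma lsum_le_norm (y : l2) (L : list Z) :
  NoDup L -> lsum (fun l => Cmod (y l) ^ 2) L <= norm y ^ 2.
Proof.
intros hL; change (norm y) with (l2_norm y); rewrite l2_norm_sq.
apply lsum_le_ZSeries; [intros; apply pow2_ge_0|apply l2_sq|exact hL].
Qed.

Lemma norm_le_lsum (y : l2) (B : R) : 0 <= B ->
  (forall L, NoDup L -> lsum (fun l => Cmod (y l) ^ 2) L <= B ^ 2) -> norm y <= B.
Proof.
intros hB H; apply Rsqr_incr_0_var; [|exact hB]; rewrite !Rsqr_pow2.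
change (l2_norm y ^ 2 <= B ^ 2); rewrite l2_norm_sq.
apply ZSeries_le_lsum; [intros; apply pow2_ge_0|exact H].
Qed.

Lemma ex_l2_lsum (f : Z -> C) (B : R) : 0 <= B ->
  (forall L, NoDup L -> lsum (fun l => Cmod (f l) ^ 2) L <= B ^ 2) ->
  exists y : l2, (forall l, y l = f l) /\ norm y <= B.
Proof.
intros hB H.
assert (h : ex_zseries (fun l => Cmod (f l) ^ 2)).
{ apply (ZSeries_le_lsum _ (B ^ 2)); [intros; apply pow2_ge_0|exact H]. }
exists (Mk_l2 f h); split; [reflexivity|].
apply norm_le_lsum; assumption.
Qed.

Lemma E_coord (l j : Z) : E l j = if Z.eq_dec j l then RtoC 1 else RtoC 0.
Proof. reflexivity. Qed.

Lemma E_norm_le (l : Z) : norm (E l) <= 1.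
Proof.
apply norm_le_lsum; [lra|]; intros L hL.
eapply Rle_trans; [apply lsum_le_ZSeries; [intros; apply pow2_ge_0|apply E_sq|exact hL]|].
destruct (ZSeries_single (fun k => Cmod (E l k) ^ 2) l) as [_ h].
- intros n hn; rewrite E_coord; destruct (Z.eq_dec n l); [tauto|rewrite Cmod_0; ring].
- eapply Rle_trans; [right; exact h|].
  rewrite E_coord; destruct (Z.eq_dec l l); [rewrite Cmod_1; lra|tauto].
Qed.

Definition fin_comb (y : l2) (L : list Z) : l2 :=
  fold_right (fun l acc => plus (scal (y l) (E l)) acc) zero L.

Lemma fin_comb_coord (y : l2) (L : list Z) (j : Z) : NoDup L ->
  fin_comb y L j = if in_dec Z.eq_dec j L then y j else RtoC 0.
Proof.
induction L as [|l L IH]; intros hL; [reflexivity|].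
inversion hL as [|? ? h1 h2]; subst.
change (fin_comb y (l :: L) j) with (Cplus (Cmult (y l) (E l j)) (fin_comb y L j)).
rewrite (IH h2), E_coord.
destruct (Z.eq_dec j l) as [->|n].
- destruct (in_dec Z.eq_dec l (l :: L)) as [_|h]; [|elim h; left; reflexivity].
  destruct (in_dec Z.eq_dec l L); [tauto|ring].
- destruct (in_dec Z.eq_dec j (l :: L)) as [[h|h]|h]; destruct (in_dec Z.eq_dec j L) as [h'|h'];
    try congruence; try tauto; try ring.
  elim h; right; exact h'.
Qed.

(** The squared norm is a supremum over lists, so some list carries all of it but [eps ^ 2]. What
    remains of [y] lives off that list. *)
Lemma fin_comb_approx (y : l2) (eps : R) : 0 < eps ->
  exists L, norm (minus y (fin_comb y L)) <= eps.
Proof.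
intros he.
assert (HL : exists L, NoDup L /\ norm y ^ 2 - eps ^ 2 < lsum (fun l => Cmod (y l) ^ 2) L).
{ apply NNPP; intros hn.
  assert (h : ZSeries (fun l => Cmod (y l) ^ 2) <= norm y ^ 2 - eps ^ 2).
  { apply ZSeries_le_lsum; [intros; apply pow2_ge_0|]; intros L hL.
    apply Rnot_lt_le; intros h; apply hn; exists L; auto. }
  rewrite <- l2_norm_sq in h; change (l2_norm y) with (norm y) in h.
  assert (0 < eps ^ 2) by (apply pow_lt; exact he); lra. }
destruct HL as [L [hL H]]; exists L.
apply norm_le_lsum; [lra|]; intros L' hL'.
assert (hc : forall j, minus y (fin_comb y L) j =
  if in_dec Z.eq_dec j L then RtoC 0 else y j).
{ intros j; change (minus y (fin_comb y L) j) with (y j + (- (1)) * fin_comb y L j)%C.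
  rewrite fin_comb_coord by exact hL; destruct (in_dec Z.eq_dec j L); ring. }
set (L2 := filter (fun j => if in_dec Z.eq_dec j L then false else true) L').
assert (E1 : lsum (fun l => Cmod (minus y (fin_comb y L) l) ^ 2) L'
             = lsum (fun l => Cmod (y l) ^ 2) L2).
{ unfold L2; clear - hc; induction L' as [|j L' IH]; [reflexivity|].
  rewrite lsum_cons, IH, hc; simpl filter.
  destruct (in_dec Z.eq_dec j L); [rewrite Cmod_0; simpl pow; ring|reflexivity]. }
eapply Rle_trans; [right; exact E1|].
assert (hN : NoDup (L ++ L2)).
{ apply NoDup_app; [exact hL|apply NoDup_filter; exact hL'|].
  intros j h1 h2; apply filter_In in h2; destruct h2 as [_ h2].
  destruct (in_dec Z.eq_dec j L); [discriminate|tauto]. }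
assert (h := lsum_le_norm y _ hN); rewrite lsum_app in h.
change (norm y) with (l2_norm y) in *; lra.
Qed.

Lemma linear_fin_comb {W : NormedModule C_AbsRing} (f g : l2 -> W) (y : l2) (L : list Z) :
  is_linear f -> is_linear g -> (forall l, f (E l) = g (E l)) ->
  f (fin_comb y L) = g (fin_comb y L).
Proof.
intros hf hg H; induction L as [|l L IH].
- exact (eq_trans (linear_zero f hf) (eq_sym (linear_zero g hg))).
- change (fin_comb y (l :: L)) with (plus (scal (y l) (E l)) (fin_comb y L)).
  rewrite (linear_plus f hf), (linear_plus g hg), IH.
  rewrite (linear_scal f hf), (linear_scal g hg), H; reflexivity.
Qed.

(** Density of the finite combinations of the [E l]. The two maps agree on such a combination, so
    their difference at [y] is their difference at the small remainder. *)
Lemma linear_ext_basis {W : NormedModule C_AbsRing} (f g : l2 -> W) :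
  is_linear f -> is_linear g -> (forall l, f (E l) = g (E l)) -> forall y, f y = g y.
Proof.
intros hf hg H y.
destruct (linear_norm f hf) as [Mf [hMf Hf]], (linear_norm g hg) as [Mg [hMg Hg]].
assert (h : norm (minus (f y) (g y)) <= 0).
{ apply le_epsilon; intros eps he; rewrite Rplus_0_l.
  destruct (fin_comb_approx y (eps / (Mf + Mg))) as [L hL]; [apply Rdiv_lt_0_compat; lra|].
  set (d := minus y (fin_comb y L)) in *.
  assert (Ed : minus (f y) (g y) = minus (f d) (g d)).
  { unfold d; rewrite (linear_minus f _ _ hf), (linear_minus g _ _ hg).
    rewrite (linear_fin_comb f g y L hf hg H).
    unfold minus; rewrite (opp_plus (G := W) (g y)), opp_opp.
    symmetry; etransitivity; [apply plus_plus_swap|].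
    rewrite plus_opp_l; apply plus_zero_r. }
  rewrite Ed; eapply Rle_trans; [apply norm_triangle|]; rewrite norm_opp.
  specialize (Hf d); specialize (Hg d).
  apply Rle_trans with ((Mf + Mg) * norm d); [lra|].
  apply Rle_trans with ((Mf + Mg) * (eps / (Mf + Mg))).
  - apply Rmult_le_compat_l; [lra|exact hL].
  - right; field; lra. }
assert (h0 := norm_ge_0 (minus (f y) (g y))).
assert (hz : minus (f y) (g y) = zero) by (apply norm_eq_zero; lra).
rewrite <- (minus_minus_r (f y) (g y)), hz; unfold minus; rewrite opp_zero, plus_zero_r; reflexivity.
Qed.

Lemma BH_ext_basis (a b : BH) : (forall l, a (E l) = b (E l)) -> a = b.
Proof. intros H; apply BH_ext, linear_ext_basis; [apply op_linear|apply op_linear|exact H]. Qed.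

Lemma coord_comp_linear (a : BH) (j : Z) :
  is_linear (U := l2_NormedModule) (V := C_NormedModule) (fun y : l2 => a y j).
Proof. apply (is_linear_comp a (fun y : l2 => y j)); [apply op_linear|apply l2_coord_linear]. Qed.

(** * Weighted partial isometries of the basis *)

Definition wpi_fun (sg : Z -> option Z) (w : Z -> C) (y : Z -> C) (l : Z) : C :=
  match sg l with Some j => (w l * y j)%C | None => RtoC 0 end.

Fixpoint pmap (sg : Z -> option Z) (L : list Z) : list Z :=
  match L with
  | nil => nil
  | l :: L => match sg l with Some j => j :: pmap sg L | None => pmap sg L end
  end.

Lemma in_pmap (sg : Z -> option Z) (L : list Z) (j : Z) :
  In j (pmap sg L) -> exists l, In l L /\ sg l = Some j.
Proof.
induction L as [|l L IH]; simpl; [tauto|].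
destruct (sg l) as [i|] eqn:e; simpl.
- intros [->|h]; [exists l; auto|destruct (IH h) as [k [? ?]]; exists k; auto].
- intros h; destruct (IH h) as [k [? ?]]; exists k; auto.
Qed.

Lemma NoDup_pmap (sg : Z -> option Z) (L : list Z) :
  (forall l l' j, sg l = Some j -> sg l' = Some j -> l = l') ->
  NoDup L -> NoDup (pmap sg L).
Proof.
intros hi hL; induction hL as [|l L hl hL IH]; simpl; [constructor|].
destruct (sg l) as [j|] eqn:e; [|exact IH]; constructor; [|exact IH].
intros h; apply in_pmap in h; destruct h as [k [h1 h2]].
apply hl; rewrite (hi l k j e h2); exact h1.
Qed.

Lemma wpi_bound (sg : Z -> option Z) (w : Z -> C) (K : R) (y : l2) :
  0 <= K -> (forall l, sg l <> None -> Cmod (w l) <= K) ->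
  (forall l l' j, sg l = Some j -> sg l' = Some j -> l = l') ->
  forall L, NoDup L -> lsum (fun l => Cmod (wpi_fun sg w y l) ^ 2) L <= (K * norm y) ^ 2.
Proof.
intros hK hw hi L hL.
assert (hN := NoDup_pmap sg L hi hL).
rewrite Rpow_mult_distr.
apply Rle_trans with (K ^ 2 * lsum (fun l => Cmod (y l) ^ 2) (pmap sg L)).
- clear hL hN; induction L as [|l L IH]; [simpl; lra|].
  rewrite lsum_cons; unfold wpi_fun at 1; simpl pmap; destruct (sg l) as [j|] eqn:e.
  + rewrite lsum_cons, Rmult_plus_distr_l; apply Rplus_le_compat; [|exact IH].
    rewrite Cmod_mult, Rpow_mult_distr; apply Rmult_le_compat_r; [apply pow2_ge_0|].
    apply pow_incr; split; [apply Cmod_ge_0|apply hw; congruence].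
  + rewrite Cmod_0, pow_ne_zero, Rplus_0_l by lia; exact IH.
- apply Rmult_le_compat_l; [apply pow2_ge_0|apply lsum_le_norm, hN].
Qed.

(** [V], its adjoint, the [M2 s F] and the block intertwiners are all of this shape. As [sg] is
    injective where defined, the squares of the coordinates are only rearranged, and a bound for the
    weights bounds the norm. *)
Lemma ex_wpi (sg : Z -> option Z) (w : Z -> C) (K : R) :
  0 <= K -> (forall l, sg l <> None -> Cmod (w l) <= K) ->
  (forall l l' j, sg l = Some j -> sg l' = Some j -> l = l') ->
  exists X : BH, (forall y l, X y l = wpi_fun sg w y l) /\ norm X <= K.
Proof.
intros hK hw hi.
assert (HX : forall y : l2, exists x : l2, (forall l, x l = wpi_fun sg w y l) /\ norm x <= K * norm y).
{ intros y; apply ex_l2_lsum.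
  - apply Rmult_le_pos; [exact hK|apply norm_l2_ge_0].
  - apply wpi_bound; assumption. }
destruct (ex_choice _ HX) as [f Hf].
assert (hl : is_linear (U := l2_NormedModule) (V := l2_NormedModule) f).
{ apply Build_is_linear.
  - intros x y; apply l2_ext; intros l; rewrite (proj1 (Hf _)).
    change (plus (f x) (f y) l) with (f x l + f y l)%C; rewrite !(proj1 (Hf _)).
    unfold wpi_fun; destruct (sg l) as [j|]; [|ring].
    change (plus x y j) with (x j + y j)%C; ring.
  - intros c y; apply l2_ext; intros l; rewrite (proj1 (Hf _)).
    change (scal c (f y) l) with (c * f y l)%C; rewrite !(proj1 (Hf _)).
    unfold wpi_fun; destruct (sg l) as [j|]; [|ring].
    change (scal c y j) with (c * y j)%C; ring.
  (* The constant must be positive, and [K] may be 0. *)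
  - exists (K + 1); split; [lra|]; intros y; eapply Rle_trans; [apply Hf|].
    assert (h := norm_l2_ge_0 y); nra. }
exists (Mk_BH f hl); split; [intros; apply Hf|].
apply BH_norm_bound; [exact hK|intros; apply Hf].
Qed.

(** * Norms and completeness of B(H) *)

Lemma norm_apply_le (a : BH) (y : l2) : norm (a y) <= norm a * norm y.
Proof. apply BH_norm_le. Qed.

Lemma norm_mult_le (a b : BH) : norm (mult a b : BH) <= norm a * norm b.
Proof.
apply BH_norm_bound.
- apply Rmult_le_pos; apply BH_norm_ge_0.
- intros y; eapply Rle_trans; [apply (norm_apply_le a (b y))|].
  rewrite Rmult_assoc; apply Rmult_le_compat_l; [apply BH_norm_ge_0|apply norm_apply_le].
Qed.

Lemma norm_one_le : norm (one : BH) <= 1.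
Proof. apply BH_norm_bound; [lra|]; intros y; change (norm y <= 1 * norm y); lra. Qed.

Lemma norm_apply_E_le (a : BH) (l : Z) : norm (a (E l)) <= norm a.
Proof.
eapply Rle_trans; [apply norm_apply_le|].
assert (h := E_norm_le l); assert (h' := BH_norm_ge_0 a).
rewrite <- (Rmult_1_r (norm a)) at 2; apply Rmult_le_compat_l; assumption.
Qed.

(** Evaluation is bounded as a function of the operator, so a norm-convergent series of operators
    can be read vector by vector and entry by entry. *)
Lemma apply_linear (y : l2) :
  is_linear (U := BH_NormedModule) (V := l2_NormedModule) (fun a : BH => a y).
Proof.
apply Build_is_linear; [reflexivity|reflexivity|].
exists (norm y + 1); split; [assert (h := norm_l2_ge_0 y); lra|].
intros a; eapply Rle_trans; [apply norm_apply_le|].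
assert (h := BH_norm_ge_0 a); change (norm a) with (BH_norm a); nra.
Qed.

Lemma entry_linear (y : l2) (j : Z) :
  is_linear (U := BH_NormedModule) (V := C_NormedModule) (fun a : BH => a y j).
Proof. apply (is_linear_comp (fun a : BH => a y) (fun x : l2 => x j)); [apply apply_linear|apply l2_coord_linear]. Qed.

Lemma mult_l_linear (a : BH) :
  is_linear (U := BH_NormedModule) (V := BH_NormedModule) (fun b : BH => mult a b : BH).
Proof.
apply Build_is_linear.
- intros x y; apply (mult_distr_l (K := BH_Ring) a x y).
- intros c x; apply BH_ext; intros y; apply (linear_scal a (op_linear a)).
- exists (norm a + 1); split; [assert (h := BH_norm_ge_0 a); change (norm a) with (BH_norm a); lra|].
  intros b; eapply Rle_trans; [apply norm_mult_le|].
  assert (h := BH_norm_ge_0 b); change (norm b) with (BH_norm b); nra.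
Qed.

Lemma mult_r_linear (a : BH) :
  is_linear (U := BH_NormedModule) (V := BH_NormedModule) (fun b : BH => mult b a : BH).
Proof.
apply Build_is_linear.
- intros x y; apply (mult_distr_r (K := BH_Ring) x y a).
- intros c x; apply BH_ext; reflexivity.
- exists (norm a + 1); split; [assert (h := BH_norm_ge_0 a); change (norm a) with (BH_norm a); lra|].
  intros b; eapply Rle_trans; [apply norm_mult_le|].
  assert (h := BH_norm_ge_0 b); change (norm b) with (BH_norm b); nra.
Qed.

Lemma Re_le_Cmod (z : C) : Rabs (Re z) <= Cmod z.
Proof. eapply Rle_trans; [apply Rmax_l|apply Rmax_Cmod]. Qed.

Lemma Im_le_Cmod (z : C) : Rabs (Im z) <= Cmod z.
Proof. eapply Rle_trans; [apply Rmax_r|apply Rmax_Cmod]. Qed.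

Lemma Cmod_le_add (z : C) : Cmod z <= Rabs (Re z) + Rabs (Im z).
Proof.
destruct z as [x y]; replace (x, y) with (RtoC x + (0, y))%C
  by (unfold Cplus; simpl; f_equal; ring).
eapply Rle_trans; [apply Cmod_triangle|]; rewrite Cmod_R; simpl.
rewrite Rplus_0_r, Rplus_0_l; apply Rplus_le_compat_l; unfold Cmod; simpl.
rewrite Rmult_0_l, Rplus_0_l, Rmult_1_r; fold (Rsqr y); rewrite sqrt_Rsqr_abs; apply Rle_refl.
Qed.

Lemma C_ball_Cmod (x y : C) (eps : R) : Cmod (y - x) < eps -> ball (M := C_UniformSpace) x eps y.
Proof.
intros h; split; (eapply Rle_lt_trans; [|exact h]); [apply (Re_le_Cmod (y - x))|apply (Im_le_Cmod (y - x))].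
Qed.

Lemma locally_Cmod (x : C) (eps : R) : 0 < eps ->
  locally (T := C_UniformSpace) x (fun y => Cmod (y - x) < eps).
Proof.
intros he; assert (he2 : 0 < eps / 2) by lra.
exists (mkposreal _ he2); intros y [h1 h2].
change (Rabs (Re (y - x)) < eps / 2) in h1; change (Rabs (Im (y - x)) < eps / 2) in h2.
eapply Rle_lt_trans; [apply Cmod_le_add|lra].
Qed.

Lemma C_cauchy_lim (u : nat -> C) :
  (forall eps, 0 < eps -> exists N, forall n m, (N <= n)%nat -> (N <= m)%nat ->
    Cmod (u n - u m) <= eps) ->
  exists l : C, forall eps, 0 < eps -> exists N, forall n, (N <= n)%nat -> Cmod (u n - l) <= eps.
Proof.
intros H.
assert (A : forall p : C -> R, (forall x y, Rabs (p x - p y) <= Cmod (x - y)) ->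
  exists l, is_lim_seq (fun n => p (u n)) (Finite l)).
{ intros p hp; apply ex_lim_seq_cauchy_corr; intros eps.
  destruct (H (eps / 2)) as [N HN]; [assert (h := cond_pos eps); lra|].
  exists N; intros n m hn hm; eapply Rle_lt_trans; [apply hp|].
  specialize (HN n m hn hm); assert (h := cond_pos eps); lra. }
assert (hRe : forall x y : C, Rabs (Re x - Re y) <= Cmod (x - y)) by (intros; apply (Re_le_Cmod (x - y))).
assert (hIm : forall x y : C, Rabs (Im x - Im y) <= Cmod (x - y)) by (intros; apply (Im_le_Cmod (x - y))).
destruct (A Re hRe) as [a ha], (A Im hIm) as [b hb].
exists (a, b); intros eps he.
apply is_lim_seq_spec in ha; apply is_lim_seq_spec in hb.
assert (he2 : 0 < eps / 2) by lra.
destruct (ha (mkposreal _ he2)) as [N1 H1], (hb (mkposreal _ he2)) as [N2 H2].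
exists (max N1 N2); intros n hn.
specialize (H1 n ltac:(lia)); specialize (H2 n ltac:(lia)); simpl in H1, H2.
change (Rabs (Re (u n - (a, b))) < eps / 2) in H1; change (Rabs (Im (u n - (a, b))) < eps / 2) in H2.
eapply Rle_trans; [apply Cmod_le_add|lra].
Qed.

Definition is_Clim (u : nat -> C) (l : C) : Prop :=
  filterlim u eventually (locally (T := C_NormedModule) l).

Lemma C_cauchy_filterlim (u : nat -> C) :
  (forall eps, 0 < eps -> exists N, forall n m, (N <= n)%nat -> (N <= m)%nat ->
    Cmod (u n - u m) <= eps) ->
  exists l : C, is_Clim u l.
Proof.
intros H; destruct (C_cauchy_lim u H) as [l hl]; exists l.
apply (filterlim_locally_ball_norm (U := C_NormedModule)); intros eps.
destruct (hl (eps / 2)) as [N HN]; [assert (h := cond_pos eps); lra|].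
exists N; intros n hn; specialize (HN n hn); unfold ball_norm.
eapply Rle_lt_trans; [exact HN|]; assert (h := cond_pos eps); lra.
Qed.

Lemma is_Clim_unique (u : nat -> C) (a b : C) : is_Clim u a -> is_Clim u b -> a = b.
Proof. exact (filterlim_locally_unique (V := C_NormedModule) u a b). Qed.

Lemma is_Clim_plus (u v : nat -> C) (a b : C) :
  is_Clim u a -> is_Clim v b -> is_Clim (fun n => u n + v n)%C (a + b)%C.
Proof.
intros hu hv.
exact (filterlim_comp_2 (G := locally (T := C_NormedModule) a)
  (H := locally (T := C_NormedModule) b) u v Cplus hu hv
  (filterlim_plus (V := C_NormedModule) a b)).
Qed.

Lemma is_Clim_scal (c : C) (u : nat -> C) (a : C) :
  is_Clim u a -> is_Clim (fun n => c * u n)%C (c * a)%C.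
Proof.
intros hu.
exact (filterlim_comp _ _ _ u (fun z => Cmult c z) eventually _ _ hu
  (filterlim_scal_r (V := C_NormedModule) c a)).
Qed.

Lemma is_Clim_Cmod (u : nat -> C) (a : C) :
  is_Clim u a -> is_lim_seq (fun n => Cmod (u n)) (Finite (Cmod a)).
Proof.
intros hu.
exact (filterlim_comp _ _ _ u Cmod eventually _ _ hu (filterlim_norm (V := C_NormedModule) a)).
Qed.

(** Fatou's lemma on finite lists: a Cauchy estimate passes to a coordinatewise limit that is not
    yet known to be square summable. *)
Lemma lsum_lim_le (p q : Z -> C) (r : nat -> Z -> C) (L : list Z) (B : R) (N : nat) :
  (forall l, is_Clim (fun m => r m l) (q l)) ->
  (forall m, (N <= m)%nat -> lsum (fun l => Cmod (p l - r m l) ^ 2) L <= B) ->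
  lsum (fun l => Cmod (p l - q l) ^ 2) L <= B.
Proof.
intros H HB.
assert (Hl : is_lim_seq (fun m => lsum (fun l => Cmod (p l - r m l) ^ 2) L)
  (Finite (lsum (fun l => Cmod (p l - q l) ^ 2) L))).
{ clear HB; induction L as [|l L IH]; [apply is_lim_seq_const|].
  apply (is_lim_seq_plus' _ _ _ _); [|exact IH].
  assert (h : is_lim_seq (fun m => Cmod (p l - r m l)) (Finite (Cmod (p l - q l)))).
  { apply is_Clim_Cmod, is_Clim_plus; [apply filterlim_const|].
    apply (filterlim_comp _ _ _ (fun m => r m l) Copp eventually _ _ (H l)
      (filterlim_opp (V := C_NormedModule) (q l))). }
  simpl; apply is_lim_seq_mult'; [exact h|].
  apply is_lim_seq_mult'; [exact h|apply is_lim_seq_const]. }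
apply (is_lim_seq_incr_n _ N) in Hl.
apply (is_lim_seq_le (fun n => lsum (fun l => Cmod (p l - r (n + N)%nat l) ^ 2) L) (fun _ => B)
  (Finite (lsum (fun l => Cmod (p l - q l) ^ 2) L)) (Finite B)); [|exact Hl|apply is_lim_seq_const].
intros n; apply HB; lia.
Qed.

Lemma minus_swap_norm {K : AbsRing} {V : NormedModule K} (x y : V) :
  norm (minus x y) = norm (minus y x).
Proof. rewrite <- norm_opp, opp_minus; reflexivity. Qed.

Lemma BH_cauchy_lim (u : nat -> BH) :
  (forall eps, 0 < eps -> exists N, forall n m, (N <= n)%nat -> (N <= m)%nat ->
    norm (minus (u n) (u m)) <= eps) ->
  exists a : BH, forall eps, 0 < eps -> exists N, forall n, (N <= n)%nat ->
    norm (minus (u n) a) <= eps.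
Proof.
intros H.
assert (Hyl : forall p : l2 * Z, exists c : C, is_Clim (fun n => u n (fst p) (snd p)) c).
{ intros [y l]; apply C_cauchy_filterlim; intros eps he.
  assert (hy := norm_l2_ge_0 y).
  destruct (H (eps / (norm y + 1))) as [N HN]; [apply Rdiv_lt_0_compat; lra|].
  exists N; intros n m hn hm; specialize (HN n m hn hm).
  apply Rle_trans with (norm (minus (u n) (u m) y)).
  - eapply Rle_trans; [|apply (l2_coord_le _ l)]; right; f_equal.
    change (u n y l - u m y l = u n y l + (- (1)) * u m y l)%C; ring.
  - eapply Rle_trans; [apply norm_apply_le|].
    apply Rle_trans with (eps / (norm y + 1) * norm y).
    + apply Rmult_le_compat_r; assumption.
    + apply Rle_trans with (eps / (norm y + 1) * (norm y + 1)); [|right; field; lra].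
      apply Rmult_le_compat_l; [left; apply Rdiv_lt_0_compat|]; lra. }
destruct (ex_choice _ Hyl) as [f0 Hf0].
set (f := fun y l => f0 (y, l)).
assert (Hf : forall y l, is_Clim (fun n => u n y l) (f y l)) by (intros y l; exact (Hf0 (y, l))).
clearbody f.
assert (Hd : forall eps, 0 < eps -> exists N, forall n, (N <= n)%nat -> forall y L, NoDup L ->
  lsum (fun l => Cmod (u n y l - f y l) ^ 2) L <= (eps * norm y) ^ 2).
{ intros eps he; destruct (H eps he) as [N HN]; exists N; intros n hn y L hL.
  apply (lsum_lim_le (fun l => u n y l) (f y) (fun m l => u m y l) L _ N (Hf y)).
  intros m hm.
  apply Rle_trans with (norm (minus (u n) (u m) y) ^ 2).
  - eapply Rle_trans; [|apply (lsum_le_norm _ L hL)]; right; apply lsum_ext; intros l _.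
    f_equal; f_equal; change (u n y l - u m y l = u n y l + (- (1)) * u m y l)%C; ring.
  - apply pow_incr; split; [apply norm_l2_ge_0|].
    eapply Rle_trans; [apply norm_apply_le|].
    apply Rmult_le_compat_r; [apply norm_l2_ge_0|apply HN; assumption]. }
(* The coordinatewise limit [f] is reached through the difference [u N0 - f]: its square sums are
   already bounded by those of the argument, so it is a bounded operator [g], and the limit is
   [u N0 - g]. *)
destruct (Hd 1 Rlt_0_1) as [N0 HN0].
assert (Hg : forall y, exists d : l2, (forall l, d l = u N0 y l - f y l)%C /\ norm d <= 1 * norm y).
{ intros y; apply ex_l2_lsum; [assert (h := norm_l2_ge_0 y); lra|].
  intros L hL; apply HN0; [lia|exact hL]. }
destruct (ex_choice _ Hg) as [g Hg'].
assert (Hplus : forall x y l, f (plus x y) l = (f x l + f y l)%C).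
{ intros x y l; apply (is_Clim_unique (fun n => u n (plus x y) l)); [apply Hf|].
  apply (filterlim_ext (fun n => u n x l + u n y l)%C).
  - intros n; rewrite (linear_plus _ (op_linear (u n))); reflexivity.
  - apply is_Clim_plus; apply Hf. }
assert (Hscal : forall c x l, f (scal c x) l = (c * f x l)%C).
{ intros c x l; apply (is_Clim_unique (fun n => u n (scal c x) l)); [apply Hf|].
  apply (filterlim_ext (fun n => c * u n x l)%C).
  - intros n; rewrite (linear_scal _ (op_linear (u n))); reflexivity.
  - apply is_Clim_scal, Hf. }
assert (hl : is_linear (U := l2_NormedModule) (V := l2_NormedModule) g).
{ apply Build_is_linear.
  - intros x y; apply l2_ext; intros l; rewrite (proj1 (Hg' _)), Hplus.
    change (plus (g x) (g y) l) with (g x l + g y l)%C; rewrite !(proj1 (Hg' _)).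
    rewrite (linear_plus _ (op_linear (u N0))).
    change (plus (u N0 x) (u N0 y) l) with (u N0 x l + u N0 y l)%C; ring.
  - intros c y; apply l2_ext; intros l; rewrite (proj1 (Hg' _)), Hscal.
    change (scal c (g y) l) with (c * g y l)%C; rewrite !(proj1 (Hg' _)).
    rewrite (linear_scal _ (op_linear (u N0))).
    change (scal c (u N0 y) l) with (c * u N0 y l)%C; ring.
  - exists 1; split; [lra|]; intros y; apply Hg'. }
set (G := Mk_BH g hl).
exists (minus (u N0) G); intros eps he.
destruct (Hd eps he) as [N HN]; exists N; intros n hn.
apply BH_norm_bound; [lra|]; intros y.
apply norm_le_lsum; [apply Rmult_le_pos; [lra|apply norm_l2_ge_0]|].
intros L hL; eapply Rle_trans; [|apply (HN n hn y L hL)].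
right; apply lsum_ext; intros l _; f_equal; f_equal.
change (u n y l + (- (1)) * (u N0 y l + (- (1)) * g y l) = u n y l - f y l)%C.
rewrite (proj1 (Hg' y)); ring.
Qed.

Definition BH_filter_lim (F : (BH -> Prop) -> Prop) : BH :=
  epsilon (inhabits BH_zero) (fun a => forall eps : posreal, F (ball a eps)).

(** Choose centres of balls of radius 1 / (n + 1) that belong to the filter. Two such balls meet, so
    the centres form a Cauchy sequence, and its limit is a limit of the filter. *)
Lemma BH_filter_lim_spec (F : (BH -> Prop) -> Prop) :
  ProperFilter F -> cauchy F -> forall eps : posreal, F (ball (BH_filter_lim F) eps).
Proof.
intros FF HF; apply (epsilon_spec (inhabits BH_zero) (fun a => forall eps : posreal, F (ball a eps))).
assert (he : forall n : nat, 0 < / (INR n + 1)).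
{ intros n; apply Rinv_0_lt_compat; assert (h := pos_INR n); lra. }
destruct (ex_choice _ (fun n => HF (mkposreal _ (he n)))) as [x Hx].
assert (Hsm : forall eps, 0 < eps -> exists N, forall n, (N <= n)%nat -> / (INR n + 1) <= eps).
{ intros eps hp; destruct (archimed_cor1 eps hp) as [N [h1 h2]]; exists N; intros n hn.
  left; eapply Rle_lt_trans; [|exact h1]; apply Rinv_le_contravar.
  - apply lt_0_INR; exact h2.
  - apply le_INR in hn; lra. }
destruct (BH_cauchy_lim x) as [a Ha].
{ intros eps hp; destruct (Hsm (eps / 2)) as [N HN]; [lra|]; exists N; intros n m hn hm.
  destruct (filter_ex _ (filter_and _ _ (Hx n) (Hx m))) as [b [h1 h2]].
  change (norm (minus b (x n)) < / (INR n + 1)) in h1.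
  change (norm (minus b (x m)) < / (INR m + 1)) in h2.
  specialize (HN n hn) as h3; specialize (HN m hm) as h4.
  replace (minus (x n) (x m)) with (plus (minus (x n) b) (minus b (x m))).
  - eapply Rle_trans; [apply (norm_triangle (V := BH_NormedModule))|].
    change (BH_norm (minus (x n) b) + BH_norm (minus b (x m)) <= eps).
    assert (h5 : BH_norm (minus (x n) b) = BH_norm (minus b (x n)))
      by exact (minus_swap_norm (V := BH_NormedModule) (x n) b).
    change (BH_norm (minus b (x n)) < / (INR n + 1)) in h1.
    change (BH_norm (minus b (x m)) < / (INR m + 1)) in h2; lra.
  - symmetry; apply (minus_trans (G := BH_AbelianGroup)). }
exists a; intros eps.
destruct (Ha (eps / 2)) as [N1 H1]; [assert (h := cond_pos eps); lra|].
destruct (Hsm (eps / 2)) as [N2 H2]; [assert (h := cond_pos eps); lra|].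
specialize (H1 (max N1 N2) ltac:(lia)); specialize (H2 (max N1 N2) ltac:(lia)).
apply (filter_imp (ball (x (max N1 N2)) (mkposreal _ (he (max N1 N2))))); [|apply Hx].
intros b hb; change (norm (minus b (x (max N1 N2))) < / (INR (max N1 N2) + 1)) in hb.
change (norm (minus b a) < eps).
replace (minus b a) with (plus (minus b (x (max N1 N2))) (minus (x (max N1 N2)) a))
  by (symmetry; apply (minus_trans (G := BH_AbelianGroup))).
eapply Rle_lt_trans; [apply (norm_triangle (V := BH_NormedModule))|].
change (BH_norm (minus b (x (max N1 N2))) + BH_norm (minus (x (max N1 N2)) a) < eps).
change (BH_norm (minus b (x (max N1 N2))) < / (INR (max N1 N2) + 1)) in hb.
change (BH_norm (minus (x (max N1 N2)) a) <= eps / 2) in H1; lra.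
Qed.

Definition BH_CompleteSpace_mixin : CompleteSpace.mixin_of BH_UniformSpace.
Proof.
apply (CompleteSpace.Mixin BH_UniformSpace BH_filter_lim BH_filter_lim_spec).
intros F1 F2 H1 H2.
(* Filters that refine each other have the same members, hence are equal, and the choice returns the
   same limit for both. *)
replace F2 with F1; [intros eps; apply ball_center|].
apply functional_extensionality; intros P; apply propositional_extensionality; split; auto.
Defined.

Definition BH_CompleteNormedModule : CompleteNormedModule C_AbsRing :=
  CompleteNormedModule.Pack C_AbsRing BH
    (CompleteNormedModule.Class C_AbsRing BH (NormedModule.class C_AbsRing BH_NormedModule)
       BH_CompleteSpace_mixin) BH.

(** Completeness over the real scalars, which the Riemann integral of an operator-valued function
    needs. *)
Definition BH_R_CompleteNormedModule : CompleteNormedModule R_AbsRing :=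
  CompleteNormedModule.Pack R_AbsRing BH
    (CompleteNormedModule.Class R_AbsRing BH
       (NormedModule.class R_AbsRing (realify BH_NormedModule))
       BH_CompleteSpace_mixin) BH.

Definition C_CompleteNormedModule : CompleteNormedModule C_AbsRing :=
  CompleteNormedModule.Pack C_AbsRing C
    (CompleteNormedModule.Class C_AbsRing C (NormedModule.class C_AbsRing C_NormedModule)
       C_CompleteSpace_mixin) C.

Lemma ex_zseries_BH (u : Z -> BH) (c : R) :
  (forall n, norm (u n) <= c * wt n) -> exists l : BH, is_zseries u l.
Proof. apply (ex_zseries_complete (V := BH_CompleteNormedModule)). Qed.

Lemma ex_zseries_C (u : Z -> C) (c : R) :
  (forall n, Cmod (u n) <= c * wt n) ->
  exists l : C, is_zseries (V := C_NormedModule) u l.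
Proof. apply (ex_zseries_complete (V := C_CompleteNormedModule)). Qed.

(** * The operators V, V* and M_F in coordinates *)

Lemma the_op_spec (P : BH -> Prop) (a : BH) : P a -> P (the_op P).
Proof. intros h; apply (epsilon_spec (inhabits BH_zero) P); exists a; exact h. Qed.

(** Level [k] of the block of [l]. For [l] not divisible by [s] these points and 0 exhaust the
    integers without repetition ([pt_exists], [pt_inj]). *)
Definition pt (s : Z) (k : nat) (l : Z) : Z := (s ^ Z.of_nat k * l)%Z.

Lemma pt_0 (s l : Z) : pt s 0 l = l.
Proof. apply Z.mul_1_l. Qed.

Lemma pt_S (s l : Z) (k : nat) : pt s (S k) l = (s * pt s k l)%Z.
Proof. unfold pt; rewrite Nat2Z.inj_succ, Z.pow_succ_r by lia; ring. Qed.

Lemma unit_neq_0 (s l : Z) : ~ (s | l)%Z -> l <> 0%Z.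
Proof. intros h ->; apply h, Z.divide_0_r. Qed.

Section FixedBase.
Variables (s : Z) (hs : (2 <= s)%Z).

Lemma pt_neq_0 (k : nat) (l : Z) : ~ (s | l)%Z -> pt s k l <> 0%Z.
Proof.
intros h; apply unit_neq_0 in h; unfold pt.
assert (0 < s ^ Z.of_nat k)%Z by (apply Z.pow_pos_nonneg; lia); nia.
Qed.

Lemma pt_inj (i j : nat) (l l' : Z) :
  ~ (s | l)%Z -> ~ (s | l')%Z -> pt s i l = pt s j l' -> i = j /\ l = l'.
Proof.
revert j; induction i as [|i IH]; intros [|j] h h' e.
- rewrite !pt_0 in e; auto.
- rewrite pt_0, pt_S in e; elim h; rewrite e; apply Z.divide_factor_l.
- rewrite pt_0, pt_S in e; elim h'; rewrite <- e; apply Z.divide_factor_l.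
- rewrite !pt_S in e; destruct (IH j h h'); [nia|auto].
Qed.

Lemma pt_exists (l : Z) : l <> 0%Z -> exists k l', ~ (s | l')%Z /\ l = pt s k l'.
Proof.
assert (H : forall n l, (Z.abs_nat l < n)%nat -> l <> 0%Z ->
  exists k l', ~ (s | l')%Z /\ l = pt s k l').
{ clear l; induction n as [|n IH]; intros l hn h; [lia|].
  destruct (Zdivide_dec s l) as [[q hq]|h'].
  - destruct (IH q) as [k [l' [h1 h2]]]; [nia|nia|].
    exists (S k), l'; split; [exact h1|]; rewrite pt_S, <- h2; lia.
  - exists 0%nat, l; rewrite pt_0; auto. }
intros h; apply (H (S (Z.abs_nat l))); [lia|exact h].
Qed.

Lemma Z_pt_ind (P : Z -> Prop) :
  P 0%Z -> (forall k l, ~ (s | l)%Z -> P (pt s k l)) -> forall l, P l.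
Proof.
intros H0 H l; destruct (Z.eq_dec l 0) as [->|h]; [exact H0|].
destruct (pt_exists l h) as [k [l' [h1 ->]]]; auto.
Qed.

Lemma l2_ext_pt (x y : l2) :
  x 0%Z = y 0%Z -> (forall k l, ~ (s | l)%Z -> x (pt s k l) = y (pt s k l)) -> x = y.
Proof. intros H0 H; apply l2_ext, Z_pt_ind; assumption. Qed.

Definition divs (l : Z) : option Z := if Zdivide_dec s l then Some (l / s)%Z else None.

Lemma divs_mul (l : Z) : divs (s * l) = Some l.
Proof.
unfold divs; destruct (Zdivide_dec s (s * l)) as [h|h].
- f_equal; rewrite Z.mul_comm; apply Z.div_mul; lia.
- elim h; apply Z.divide_factor_l.
Qed.

Lemma divs_inv (l j : Z) : divs l = Some j -> l = (s * j)%Z.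
Proof.
unfold divs; destruct (Zdivide_dec s l) as [h|h]; intros e; [|discriminate].
injection e as <-; apply Z.divide_div_mul_exact with (c := s) in h as h'; [|lia].
destruct h as [q ->]; rewrite Z.div_mul by lia; ring.
Qed.

Lemma divs_None (l : Z) : ~ (s | l)%Z -> divs l = None.
Proof. intros h; unfold divs; destruct (Zdivide_dec s l); tauto. Qed.

Lemma V_spec : (forall y l, V s y (s * l)%Z = y l) /\
  (forall y l, ~ (s | l)%Z -> V s y l = 0) /\ norm (V s) <= 1.
Proof.
destruct (ex_wpi divs (fun _ => RtoC 1) 1) as [X [HX hn]].
- lra.
- intros; rewrite Cmod_1; lra.
- intros l l' j h h'; rewrite (divs_inv _ _ h), (divs_inv _ _ h'); reflexivity.
- assert (HE : forall l, X (E l) = E (s * l)).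
  { intros l; apply l2_ext; intros k; rewrite HX, E_coord; unfold wpi_fun.
    destruct (divs k) as [j|] eqn:e.
    + rewrite (divs_inv _ _ e), E_coord; destruct (Z.eq_dec j l), (Z.eq_dec (s * j) (s * l));
        try nia; ring.
    + destruct (Z.eq_dec k (s * l)) as [->|]; [rewrite divs_mul in e; discriminate|reflexivity]. }
  assert (HV : forall l, V s (E l) = E (s * l)).
  { exact (the_op_spec (fun a : BH => forall l, a (E l) = E (s * l)) X HE). }
  (* [V s] is a chosen operator; its values on the basis identify it with the explicit [X]. *)
  assert (hV : V s = X) by (apply BH_ext_basis; intros l; rewrite HV, HE; reflexivity).
  rewrite hV; split; [|split; [|exact hn]]; intros y l.
  + rewrite HX; unfold wpi_fun; rewrite divs_mul; ring.
  + intros h; rewrite HX; unfold wpi_fun; rewrite (divs_None _ h); reflexivity.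
Qed.

Lemma ZSeries_dilate_pos (f : Z -> R) :
  (forall l, 0 <= f l) -> (forall l, ~ (s | l)%Z -> f l = 0) -> ex_zseries f ->
  ex_zseries (fun l => f (s * l)%Z) /\ ZSeries (fun l => f (s * l)%Z) = ZSeries f.
Proof.
intros H H0 He.
destruct (ZSeries_le_lsum (fun l => f (s * l)%Z) (ZSeries f)) as [h1 h2].
- intros; apply H.
- intros L hL; rewrite <- (lsum_map f (fun l => s * l)%Z).
  apply lsum_le_ZSeries; auto; apply FinFun.Injective_map_NoDup; [|exact hL].
  intros x y e; nia.
- split; [exact h1|]; apply Rle_antisym; [exact h2|].
  apply ZSeries_le_lsum; [exact H|]; intros L hL.
  replace (lsum f L) with (lsum (fun l => f (s * l)%Z) (pmap divs L)).
  + apply (lsum_le_ZSeries (fun l => f (s * l)%Z)); [intros; apply H|exact h1|].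
    apply NoDup_pmap; [|exact hL].
    intros l l' j e e'; rewrite (divs_inv _ _ e), (divs_inv _ _ e'); reflexivity.
  + clear hL; induction L as [|l L IH]; [reflexivity|].
    rewrite lsum_cons; simpl pmap; destruct (divs l) as [j|] eqn:e.
    * rewrite lsum_cons, IH, (divs_inv _ _ e); reflexivity.
    * rewrite IH, (H0 l); [ring|]; unfold divs in e; destruct (Zdivide_dec s l); [discriminate|assumption].
Qed.

(** An absolutely summable [f] is the difference of the nonnegative functions [Rabs f] and
    [Rabs f - f], to which [ZSeries_dilate_pos] applies. *)
Lemma ZSeries_dilate (f : Z -> R) :
  (forall l, ~ (s | l)%Z -> f l = 0) -> ex_zseries (fun l => Rabs (f l)) ->
  ZSeries (fun l => f (s * l)%Z) = ZSeries f.
Proof.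
intros H0 He.
assert (P1 : forall l, 0 <= Rabs (f l)) by (intros; apply Rabs_pos).
assert (P2 : forall l, 0 <= Rabs (f l) - f l <= 2 * Rabs (f l)).
{ intros l; assert (h := Rle_abs (f l)); assert (h' := Rle_abs (- f l)); rewrite Rabs_Ropp in h'; lra. }
assert (He2 : ex_zseries (fun l => Rabs (f l) - f l)).
{ apply (ex_zseries_le _ (fun l => 2 * Rabs (f l)) P2), ex_zseries_scal, He. }
destruct (ZSeries_dilate_pos (fun l => Rabs (f l))) as [A1 A2]; auto.
{ intros l h; rewrite H0, Rabs_R0; auto. }
destruct (ZSeries_dilate_pos (fun l => Rabs (f l) - f l)) as [B1 B2]; auto.
{ intros l; apply P2. }
{ intros l h; rewrite H0, Rabs_R0; auto; ring. }
assert (D : forall g : Z -> R, ex_zseries (fun l => Rabs (g l)) -> ex_zseries (fun l => Rabs (g l) - g l) ->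
  ZSeries g = ZSeries (fun l => Rabs (g l)) - ZSeries (fun l => Rabs (g l) - g l)).
{ intros g h1 h2.
  rewrite (ZSeries_ext g (fun l => Rabs (g l) + (-1) * (Rabs (g l) - g l))) by (intros; ring).
  rewrite ZSeries_plus, ZSeries_scal; [ring|exact h1|apply ex_zseries_scal, h2]. }
rewrite (D f He He2), (D (fun l => f (s * l)%Z) A1 B1), A2, B2; reflexivity.
Qed.

Lemma inner_abs (x y : l2) (p : C -> R) : (forall z, Rabs (p z) <= Cmod z) ->
  ex_zseries (fun l => Rabs (p (x l * Cconj (y l))%C)).
Proof.
intros hp; apply (ex_zseries_le _ (fun l => Cmod (x l) ^ 2 + Cmod (y l) ^ 2)).
- intros l; split; [apply Rabs_pos|]; eapply Rle_trans; [apply hp|].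
  rewrite Cmod_mult, Cmod_conj.
  assert (h := Cmod_ge_0 (x l)); assert (h' := Cmod_ge_0 (y l)); nra.
- apply ex_zseries_plus; apply l2_sq.
Qed.

Lemma inner_E (l : Z) (y : l2) : inner (E l) y = Cconj (y l).
Proof.
unfold inner; apply injective_projections; simpl.
- destruct (ZSeries_single (fun k => Re (E l k * Cconj (y k))%C) l) as [_ h].
  + intros k hk; rewrite E_coord; destruct (Z.eq_dec k l); [tauto|]; rewrite Cmult_0_l; reflexivity.
  + etransitivity; [exact h|]; rewrite E_coord; destruct (Z.eq_dec l l); [|tauto].
    rewrite Cmult_1_l; reflexivity.
- destruct (ZSeries_single (fun k => Im (E l k * Cconj (y k))%C) l) as [_ h].
  + intros k hk; rewrite E_coord; destruct (Z.eq_dec k l); [tauto|]; rewrite Cmult_0_l; reflexivity.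
  + etransitivity; [exact h|]; rewrite E_coord; destruct (Z.eq_dec l l); [|tauto].
    rewrite Cmult_1_l; reflexivity.
Qed.

Lemma is_adjoint_unique (a b b' : BH) : is_adjoint a b -> is_adjoint a b' -> b = b'.
Proof.
intros H H'; apply BH_ext; intros y; apply l2_ext; intros l.
rewrite <- (Cconj_conj (b y l)), <- (Cconj_conj (b' y l)); f_equal.
rewrite <- !inner_E, <- H, <- H'; reflexivity.
Qed.

(** The operator that reads the coordinate at [s * l] is an adjoint of [V s]: coordinates of [V s x]
    vanish off the multiples of [s], so the inner product is a sum over those. Adjoints are unique,
    so it is the chosen one. *)
Lemma Vs_spec : (forall y l, adjoint (V s) y l = y (s * l)%Z) /\ norm (adjoint (V s)) <= 1.
Proof.
destruct V_spec as [HV1 [HV2 _]].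
destruct (ex_wpi (fun l => Some (s * l)%Z) (fun _ => RtoC 1) 1) as [X [HX hn]].
- lra.
- intros; rewrite Cmod_1; lra.
- intros l l' j h h'; injection h as <-; injection h'; nia.
- assert (hX : is_adjoint (V s) X).
  { intros x y; unfold inner; f_equal.
    - rewrite <- (ZSeries_dilate (fun l => Re (V s x l * Cconj (y l))%C)).
      + apply ZSeries_ext; intros l; rewrite HX, HV1; unfold wpi_fun; rewrite Cmult_1_l; reflexivity.
      + intros l hl; rewrite (HV2 _ _ hl), Cmult_0_l; reflexivity.
      + apply (inner_abs (V s x) y Re), Re_le_Cmod.
    - rewrite <- (ZSeries_dilate (fun l => Im (V s x l * Cconj (y l))%C)).
      + apply ZSeries_ext; intros l; rewrite HX, HV1; unfold wpi_fun; rewrite Cmult_1_l; reflexivity.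
      + intros l hl; rewrite (HV2 _ _ hl), Cmult_0_l; reflexivity.
      + apply (inner_abs (V s x) y Im), Im_le_Cmod. }
  assert (hA : is_adjoint (V s) (adjoint (V s))).
  { exact (the_op_spec (is_adjoint (V s)) X hX). }
  rewrite (is_adjoint_unique _ _ _ hA hX); split; [|exact hn].
  intros y l; rewrite HX; unfold wpi_fun; ring.
Qed.

Lemma norm_pow_le (a : BH) (n : nat) : norm a <= 1 -> norm (pow_n a n : BH) <= 1.
Proof.
intros h; induction n as [|n IH]; [apply norm_one_le|].
change (pow_n a (S n)) with (mult a (pow_n a n)).
eapply Rle_trans; [apply norm_mult_le|].
assert (h1 := BH_norm_ge_0 a); assert (h2 := BH_norm_ge_0 (pow_n a n)).
change (norm a) with (BH_norm a) in *; change (norm (pow_n a n : BH)) with (BH_norm (pow_n a n)) in *.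
nra.
Qed.

Lemma V_pow_pt (n i : nat) (l : Z) (y : l2) : ~ (s | l)%Z ->
  (pow_n (V s) n : BH) y (pt s i l) = if (n <=? i)%nat then y (pt s (i - n) l) else RtoC 0.
Proof.
destruct V_spec as [HV1 [HV2 _]].
intros hl; revert i; induction n as [|n IH]; intros i.
- simpl; rewrite Nat.sub_0_r; reflexivity.
- change ((pow_n (V s) (S n) : BH) y) with (V s ((pow_n (V s) n : BH) y)).
  destruct i as [|i]; simpl Nat.leb; simpl Nat.sub.
  + rewrite pt_0; apply HV2, hl.
  + rewrite pt_S, HV1; apply IH.
Qed.

Lemma Vs_pow_pt (n i : nat) (l : Z) (y : l2) :
  (pow_n (adjoint (V s)) n : BH) y (pt s i l) = y (pt s (i + n) l).
Proof.
destruct Vs_spec as [HV1 _].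
revert i; induction n as [|n IH]; intros i.
- rewrite Nat.add_0_r; reflexivity.
- change ((pow_n (adjoint (V s)) (S n) : BH) y) with (adjoint (V s) ((pow_n (adjoint (V s)) n : BH) y)).
  rewrite HV1, <- pt_S, IH; f_equal; f_equal; lia.
Qed.

(** The shift by [m] levels inside every block, in either direction; levels that would become
    negative are lost. *)
Definition vz (m : Z) : BH :=
  if (0 <=? m)%Z then pow_n (V s) (Z.to_nat m)
  else pow_n (adjoint (V s)) (Z.to_nat (- m)).

Lemma vz_pt (m : Z) (i : nat) (l : Z) (y : l2) : ~ (s | l)%Z ->
  vz m y (pt s i l) =
  if (m <=? Z.of_nat i)%Z then y (pt s (Z.to_nat (Z.of_nat i - m)) l) else RtoC 0.
Proof.
intros hl; unfold vz; destruct (Z.leb_spec 0 m) as [h|h].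
- rewrite V_pow_pt by exact hl.
  destruct (Nat.leb_spec (Z.to_nat m) i), (Z.leb_spec m (Z.of_nat i)); try lia; [|reflexivity].
  do 2 f_equal; lia.
- rewrite Vs_pow_pt; destruct (Z.leb_spec m (Z.of_nat i)); [|lia]; do 2 f_equal; lia.
Qed.

(** Since [s * 0 = 0], both [V] and its adjoint fix [E 0]. A Toeplitz operator therefore acts there
    by the sum of its coefficients, which is its symbol at 0. *)
Lemma vz_0 (m : Z) (y : l2) : vz m y 0%Z = y 0%Z.
Proof.
destruct V_spec as [HV1 _], Vs_spec as [HV2 _].
unfold vz; destruct (0 <=? m)%Z.
- induction (Z.to_nat m) as [|n IH]; [reflexivity|].
  change ((pow_n (V s) (S n) : BH) y) with (V s ((pow_n (V s) n : BH) y)).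
  etransitivity; [|exact IH]; etransitivity; [|apply HV1]; rewrite Z.mul_0_r; reflexivity.
- induction (Z.to_nat (- m)) as [|n IH]; [reflexivity|].
  change ((pow_n (adjoint (V s)) (S n) : BH) y) with (adjoint (V s) ((pow_n (adjoint (V s)) n : BH) y)).
  rewrite HV2, Z.mul_0_r; exact IH.
Qed.

Lemma vz_norm (m : Z) : norm (vz m) <= 1.
Proof.
unfold vz; destruct (0 <=? m)%Z; apply norm_pow_le; [apply V_spec|apply Vs_spec].
Qed.

Definition bounded_on_units (F : nat * Zs s -> C) (K : R) : Prop :=
  0 <= K /\ forall m x, Zs_unit x -> Cmod (F (m, x)) <= K.

Lemma Zs_unit_of_Z (l : Z) : ~ (s | l)%Z -> Zs_unit (Zs_of_Z s l).
Proof.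
intros h; unfold Zs_unit; change (zs_res (Zs_of_Z s l) 1) with (l mod s ^ 1)%Z; rewrite Z.pow_1_r; intros e; apply h.
apply Z.mod_divide; [lia|exact e].
Qed.

Lemma M2_spec (F : nat * Zs s -> C) (K : R) : bounded_on_units F K ->
  (forall y, M2 s F y 0%Z = 0) /\
  (forall y m l, ~ (s | l)%Z ->
    M2 s F y (pt s m l) = (F (m, Zs_of_Z s l) * y (pt s m l))%C) /\
  norm (M2 s F) <= K.
Proof.
intros [hK HF].
(* A decoding of nonzero integers into level and block, chosen once so that the weight is a function
   of the integer. *)
assert (Hd : forall l, exists p : nat * Z, l <> 0%Z -> ~ (s | snd p)%Z /\ l = pt s (fst p) (snd p)).
{ intros l; destruct (Z.eq_dec l 0) as [->|h]; [exists (0%nat, 0%Z); tauto|].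
  destruct (pt_exists l h) as [k [l' h']]; exists (k, l'); auto. }
destruct (ex_choice _ Hd) as [d Hd'].
assert (Hpt : forall k l, ~ (s | l)%Z -> d (pt s k l) = (k, l)).
{ intros k l hl; destruct (Hd' (pt s k l)) as [h1 h2]; [apply pt_neq_0, hl|].
  destruct (pt_inj _ _ _ _ hl h1 h2) as [e1 e2].
  destruct (d (pt s k l)); simpl in *; congruence. }
destruct (ex_wpi (fun l => if Z.eq_dec l 0 then None else Some l)
  (fun l => F (fst (d l), Zs_of_Z s (snd (d l)))) K) as [X [HX hn]].
- exact hK.
- intros l; destruct (Z.eq_dec l 0) as [|h]; [tauto|]; intros _.
  apply HF, Zs_unit_of_Z, Hd', h.
- intros l l' j; destruct (Z.eq_dec l 0), (Z.eq_dec l' 0); congruence.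
- assert (HX0 : forall y, X y 0%Z = 0).
  { intros y; rewrite HX; reflexivity. }
  assert (HX1 : forall y m l, ~ (s | l)%Z -> X y (pt s m l) = (F (m, Zs_of_Z s l) * y (pt s m l))%C).
  { intros y m l hl; rewrite HX; unfold wpi_fun; destruct (Z.eq_dec (pt s m l) 0) as [e|_].
    - elim (pt_neq_0 m l hl e).
    - rewrite (Hpt m l hl); reflexivity. }
  assert (HXE : X (E 0) = zero /\ forall (m : nat) (l : Z), ~ (s | l)%Z ->
    X (E (s ^ Z.of_nat m * l)) = scal (F (m, Zs_of_Z s l)) (E (s ^ Z.of_nat m * l))).
  { split.
    - apply l2_ext_pt; [apply HX0|]; intros k l hl; rewrite HX1, E_coord by exact hl.
      destruct (Z.eq_dec (pt s k l) 0) as [e|_]; [elim (pt_neq_0 k l hl e)|].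
      change ((zero : l2) (pt s k l)) with (RtoC 0); ring.
    - intros m l hl; fold (pt s m l); apply l2_ext_pt.
      + rewrite HX0; change (RtoC 0 = F (m, Zs_of_Z s l) * E (pt s m l) 0%Z)%C; rewrite E_coord.
        destruct (Z.eq_dec 0 (pt s m l)) as [e|_]; [elim (pt_neq_0 m l hl (eq_sym e))|ring].
      + intros k l' hl'; rewrite HX1 by exact hl'.
        change (F (k, Zs_of_Z s l') * E (pt s m l) (pt s k l') =
          F (m, Zs_of_Z s l) * E (pt s m l) (pt s k l'))%C; rewrite E_coord.
        destruct (Z.eq_dec (pt s k l') (pt s m l)) as [e|_]; [|ring].
        destruct (pt_inj _ _ _ _ hl' hl e) as [-> ->]; reflexivity. }
  assert (HM : M2 s F (E 0) = zero /\ forall (m : nat) (l : Z), ~ (s | l)%Z ->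
    M2 s F (E (s ^ Z.of_nat m * l)) = scal (F (m, Zs_of_Z s l)) (E (s ^ Z.of_nat m * l))).
  { exact (the_op_spec (fun a : BH => a (E 0) = zero /\ forall (m : nat) (l : Z), ~ (s | l)%Z ->
      a (E (s ^ Z.of_nat m * l)) = scal (F (m, Zs_of_Z s l)) (E (s ^ Z.of_nat m * l))) X HXE). }
  assert (hM : M2 s F = X).
  { apply BH_ext_basis, Z_pt_ind.
    - rewrite (proj1 HM), (proj1 HXE); reflexivity.
    - intros k l hl; unfold pt; rewrite (proj2 HM), (proj2 HXE) by exact hl; reflexivity. }
  rewrite hM; auto.
Qed.

Definition iterm (F : Z -> nat * Zs s -> C) (n : Z) : BH :=
  if (0 <=? n)%Z then mult (pow_n (V s) (Z.to_nat n)) (M2 s (F n))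
  else mult (M2 s (F n)) (pow_n (adjoint (V s)) (Z.to_nat (- n))).

(** The entry joins column level [i - n] to row level [i]. For [n >= 0] the coefficient is read
    before the shift, at [i - n]; for [n < 0] after it, at [i]. In both cases this is the smaller of
    the two levels. *)
Lemma iterm_spec (F : Z -> nat * Zs s -> C) (n : Z) (K : R) : bounded_on_units (F n) K ->
  (forall y, iterm F n y 0%Z = 0) /\
  (forall y i l, ~ (s | l)%Z -> iterm F n y (pt s i l) =
    if (n <=? Z.of_nat i)%Z then
      (F n (Z.to_nat (Z.min (Z.of_nat i) (Z.of_nat i - n)), Zs_of_Z s l)
         * y (pt s (Z.to_nat (Z.of_nat i - n)) l))%C
    else RtoC 0) /\
  norm (iterm F n) <= K.
Proof.
intros hF; destruct (M2_spec _ _ hF) as [H0 [H1 H2]].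
assert (hK : 0 <= K) by apply hF.
assert (hv := vz_norm n); assert (hv0 := vz_0 n); assert (hv1 := vz_pt n).
unfold vz in hv, hv0, hv1; unfold iterm; destruct (Z.leb_spec 0 n) as [h|h].
- split; [|split].
  + intros y; etransitivity; [apply hv0|apply H0].
  + intros y i l hl; etransitivity; [apply hv1, hl|].
    destruct (Z.leb_spec n (Z.of_nat i)) as [h'|h']; [|reflexivity].
    rewrite H1, Z.min_r by (try lia; exact hl); reflexivity.
  + eapply Rle_trans; [apply norm_mult_le|].
    apply Rle_trans with (1 * K); [|lra].
    apply Rmult_le_compat; [apply BH_norm_ge_0|apply BH_norm_ge_0|exact hv|exact H2].
- split; [|split].
  + intros y; apply H0.
  + intros y i l hl; etransitivity; [apply H1, hl|].
    rewrite hv1 by exact hl; destruct (Z.leb_spec n (Z.of_nat i)) as [h'|h']; [|lia].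
    rewrite Z.min_l, Nat2Z.id by lia; reflexivity.
  + eapply Rle_trans; [apply norm_mult_le|].
    apply Rle_trans with (K * 1); [|lra].
    apply Rmult_le_compat; [apply BH_norm_ge_0|apply BH_norm_ge_0|exact H2|exact hv].
Qed.

End FixedBase.

(** * Toeplitz operators and a parametrix *)

Definition rdecay (N : nat) (u : Z -> C) (c : R) : Prop :=
  forall m, br m ^ N * Cmod (u m) <= c.

Lemma rdecay_le (N N' : nat) (u : Z -> C) (c : R) :
  (N <= N')%nat -> rdecay N' u c -> rdecay N u c.
Proof.
intros h H m; eapply Rle_trans; [|apply (H m)].
apply Rmult_le_compat_r; [apply Cmod_ge_0|apply Rle_pow; [apply br_ge_1|exact h]].
Qed.

Lemma rdecay_ge_0 (N : nat) (u : Z -> C) (c : R) : rdecay N u c -> 0 <= c.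
Proof.
intros H; eapply Rle_trans; [|apply (H 0%Z)].
apply Rmult_le_pos; [left; apply br_pow_pos|apply Cmod_ge_0].
Qed.

(** Two powers of [br] are traded for summability. *)
Lemma mult_wt (n : Z) (N : nat) (x c : R) : br n ^ (N + 2) * x <= c -> br n ^ N * x <= c * wt n.
Proof.
intros H; unfold wt; apply le_div_of_mult; [apply br_pow_pos|].
rewrite <- Rmult_assoc, <- pow_add, Nat.add_comm; exact H.
Qed.

Lemma rdecay_wt (u : Z -> C) (c : R) : rdecay 2 u c -> forall m, Cmod (u m) <= c * wt m.
Proof. intros H m; assert (h := mult_wt m 0 _ _ (H m)); simpl in h; lra. Qed.

Lemma rdecay_shift (u : Z -> C) (c : R) (n : Z) :
  rdecay 2 u c -> rdecay 2 (fun m => u (m - n)%Z) (c * br n ^ 2).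
Proof.
intros H m; specialize (H (m - n)%Z).
assert (h := br_pow_add (m - n) n 2); replace (m - n + n)%Z with m in h by lia.
apply Rle_trans with ((br (m - n) ^ 2 * br n ^ 2) * Cmod (u (m - n)%Z)).
- apply Rmult_le_compat_r; [apply Cmod_ge_0|exact h].
- rewrite (Rmult_comm _ (br n ^ 2)), (Rmult_comm c), Rmult_assoc.
  apply Rmult_le_compat_l; [left; apply br_pow_pos|exact H].
Qed.

Lemma norm_scal_BH (c : C) (a : BH) : norm (scal c a : BH) <= Cmod c * norm a.
Proof. exact (norm_scal (V := BH_NormedModule) c a). Qed.

Lemma norm_scal_l2 (c : C) (x : l2) : norm (scal c x : l2) = Cmod c * norm x.
Proof. exact (l2_norm_scal c x). Qed.

Lemma norm_triangle_l2 (x y : l2) : norm (plus x y) <= norm x + norm y.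
Proof. exact (l2_norm_triangle x y). Qed.

Section Toeplitz.
Variables (s : Z) (hs : (2 <= s)%Z).

(** The series of [is_T], given by its coefficients instead of its symbol. *)
Definition isT (u : Z -> C) (X : BH) : Prop :=
  is_zseries (V := BH_NormedModule) (fun m => scal (u m) (vz s m)) X.

Lemma isT_term_le (u : Z -> C) (c : R) (m : Z) : rdecay 2 u c ->
  norm (scal (u m) (vz s m) : BH) <= c * wt m.
Proof.
intros H; eapply Rle_trans; [apply norm_scal_BH|].
assert (h := vz_norm s hs m); assert (h' := rdecay_wt u c H m); assert (h0 := Cmod_ge_0 (u m)).
assert (h1 := BH_norm_ge_0 (vz s m)); change (norm (vz s m)) with (BH_norm (vz s m)) in *; nra.
Qed.

Lemma isT_exists (u : Z -> C) (c : R) : rdecay 2 u c -> exists X, isT u X.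
Proof. intros H; apply (ex_zseries_BH _ c); intros m; apply isT_term_le, H. Qed.

Lemma isT_norm (u : Z -> C) (c : R) (X : BH) : rdecay 2 u c -> isT u X -> norm X <= c * wtot.
Proof.
intros H; apply (is_zseries_norm_le (V := BH_NormedModule)); intros m; apply isT_term_le, H.
Qed.

Lemma isT_entry_series (u : Z -> C) (X : BH) (y : l2) (j : Z) : isT u X ->
  is_zseries (V := C_NormedModule) (fun m => u m * vz s m y j)%C (X y j).
Proof. intros H; exact (is_zseries_linear (fun a : BH => a y j) _ X (entry_linear y j) H). Qed.

Lemma E_pt (k i : nat) (l l' : Z) : ~ (s | l)%Z -> ~ (s | l')%Z ->
  E (pt s k l) (pt s i l') = if Z.eq_dec l l' then if Nat.eq_dec k i then RtoC 1 else RtoC 0 else RtoC 0.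
Proof.
intros h h'; rewrite E_coord; destruct (Z.eq_dec (pt s i l') (pt s k l)) as [e|e].
- destruct (pt_inj s hs _ _ _ _ h' h e) as [-> ->].
  destruct (Z.eq_dec l l), (Nat.eq_dec k k); tauto.
- destruct (Z.eq_dec l l') as [->|], (Nat.eq_dec k i) as [->|]; tauto.
Qed.

Lemma E_pt_0 (k : nat) (l : Z) : ~ (s | l)%Z -> E (pt s k l) 0%Z = 0.
Proof.
intros h; rewrite E_coord; destruct (Z.eq_dec 0 (pt s k l)) as [e|]; [|reflexivity].
elim (pt_neq_0 s hs k l h (eq_sym e)).
Qed.

Lemma E_0_pt (k : nat) (l : Z) : ~ (s | l)%Z -> E 0 (pt s k l) = 0.
Proof.
intros h; rewrite E_coord; destruct (Z.eq_dec (pt s k l) 0) as [e|]; [|reflexivity].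
elim (pt_neq_0 s hs k l h e).
Qed.

Lemma vz_E (n : Z) (k : nat) (l : Z) : ~ (s | l)%Z ->
  vz s n (E (pt s k l)) =
  if (0 <=? Z.of_nat k + n)%Z then E (pt s (Z.to_nat (Z.of_nat k + n)) l) else zero.
Proof.
intros hl; apply (l2_ext_pt s hs).
- rewrite vz_0 by exact hs; rewrite E_pt_0 by exact hl.
  destruct (0 <=? Z.of_nat k + n)%Z; [rewrite E_pt_0 by exact hl|]; reflexivity.
- intros i l' hl'; rewrite vz_pt by assumption.
  destruct (Z.leb_spec 0 (Z.of_nat k + n)) as [h|h], (Z.leb_spec n (Z.of_nat i)) as [h'|h'];
    rewrite ?E_pt by assumption; try (change ((zero : l2) (pt s i l')) with (RtoC 0));
    try reflexivity; destruct (Z.eq_dec l l'); try reflexivity.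
  + destruct (Nat.eq_dec k (Z.to_nat (Z.of_nat i - n))), (Nat.eq_dec (Z.to_nat (Z.of_nat k + n)) i);
      try reflexivity; lia.
  + destruct (Nat.eq_dec (Z.to_nat (Z.of_nat k + n)) i); [lia|reflexivity].
  + destruct (Nat.eq_dec k (Z.to_nat (Z.of_nat i - n))); [lia|reflexivity].
Qed.

Lemma isT_entry (u : Z -> C) (X : BH) (k i : nat) (l l' : Z) :
  isT u X -> ~ (s | l)%Z -> ~ (s | l')%Z ->
  X (E (pt s k l)) (pt s i l') = if Z.eq_dec l l' then u (Z.of_nat i - Z.of_nat k)%Z else RtoC 0.
Proof.
intros HX hl hl'.
apply (is_zseries_unique (V := C_NormedModule) _ _ _ (isT_entry_series u X _ _ HX)).
assert (hv : forall m, vz s m (E (pt s k l)) (pt s i l') =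
  if Z.eq_dec l l' then if Z.eq_dec m (Z.of_nat i - Z.of_nat k) then RtoC 1 else RtoC 0 else RtoC 0).
{ intros m; rewrite vz_E by exact hl; destruct (Z.leb_spec 0 (Z.of_nat k + m)) as [h|h].
  - rewrite E_pt by assumption; destruct (Z.eq_dec l l'); [|reflexivity].
    destruct (Nat.eq_dec (Z.to_nat (Z.of_nat k + m)) i), (Z.eq_dec m (Z.of_nat i - Z.of_nat k));
      try reflexivity; lia.
  - change ((zero : l2) (pt s i l')) with (RtoC 0); destruct (Z.eq_dec l l'); [|reflexivity].
    destruct (Z.eq_dec m (Z.of_nat i - Z.of_nat k)); [lia|reflexivity]. }
set (n0 := (Z.of_nat i - Z.of_nat k)%Z) in *.
assert (h := is_zseries_single (V := C_NormedModule) (fun m => u m * vz s m (E (pt s k l)) (pt s i l'))%C n0).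
cbv beta in h; rewrite (hv n0) in h.
destruct (Z.eq_dec l l') as [e|e].
- destruct (Z.eq_dec n0 n0) as [_|]; [|tauto]; rewrite Cmult_1_r in h; apply h.
  intros n hn; rewrite hv; destruct (Z.eq_dec n n0); [tauto|apply Cmult_0_r].
- rewrite Cmult_0_r in h; apply h; intros n _; rewrite hv; apply Cmult_0_r.
Qed.

Lemma is_zseries_C_zero (u : Z -> C) (l : C) :
  (forall n, u n = 0) -> is_zseries (V := C_NormedModule) u l -> l = 0.
Proof.
intros H Hl; apply (is_zseries_unique (V := C_NormedModule) _ _ _ Hl).
rewrite <- (H 0%Z); apply (is_zseries_single (V := C_NormedModule)); intros n _; apply H.
Qed.

Lemma isT_pt_0 (u : Z -> C) (X : BH) (k : nat) (l : Z) :
  isT u X -> ~ (s | l)%Z -> X (E (pt s k l)) 0%Z = 0.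
Proof.
intros HX hl; apply (is_zseries_C_zero _ _) with (2 := isT_entry_series u X _ _ HX).
intros n; rewrite vz_0, E_pt_0 by assumption; apply Cmult_0_r.
Qed.

Lemma isT_E_0 (u : Z -> C) (X : BH) (lam : C) : isT u X ->
  is_zseries (V := C_NormedModule) u lam -> X (E 0) = scal lam (E 0).
Proof.
intros HX Hl; apply (l2_ext_pt s hs).
- assert (h := isT_entry_series u X (E 0) 0%Z HX).
  apply (is_zseries_unique (V := C_NormedModule) _ _ _ h).
  change (scal lam (E 0) 0%Z) with (lam * 1)%C; rewrite Cmult_1_r.
  revert Hl; apply is_zseries_ext; intros n; rewrite vz_0 by exact hs.
  change (E 0 0%Z) with (RtoC 1); rewrite Cmult_1_r; reflexivity.
- intros k l hl; change (scal lam (E 0) (pt s k l)) with (lam * E 0 (pt s k l))%C.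
  rewrite E_0_pt, Cmult_0_r by exact hl.
  apply (is_zseries_C_zero _ _) with (2 := isT_entry_series u X _ _ HX).
  intros n; rewrite vz_pt by assumption; destruct (n <=? Z.of_nat k)%Z;
    [rewrite E_0_pt by exact hl|]; apply Cmult_0_r.
Qed.

Section Parametrix.
Variables (u v : Z -> C) (A D : R) (N : nat) (X Y : BH).
Hypotheses (hu : rdecay 2 u A) (hv : rdecay (N + 4) v D) (hX : isT u X) (hY : isT v Y).
Hypothesis hconv : forall m, is_zseries (V := C_NormedModule) (fun n => v n * u (m - n)%Z)%C
  (if Z.eq_dec m 0 then RtoC 1 else RtoC 0).

(* [T n] is the Toeplitz operator with the coefficients [u] shifted by [n]; it agrees with
   [X * vz n] on [E (s^k l)] as long as [0 <= k + n]. Since [u] and [v] are convolution inverses,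
   the sum of the [v n * T n] is the identity away from [E 0], whence [1 - X Y] and [1 - Y X] are
   sums of terms that vanish on all but a few basis vectors. *)
Lemma shifted_toeplitz : exists T : Z -> BH, exists W : BH,
  (forall n, isT (fun m => u (m - n)%Z) (T n)) /\
  (forall n, norm (scal (v n) (T n) : BH) <= A * D * wtot * wt n / br n ^ N) /\
  is_zseries (V := BH_NormedModule) (fun n => scal (v n) (T n)) W /\
  (forall k l, ~ (s | l)%Z -> W (E (pt s k l)) = E (pt s k l)) /\
  (forall y i l, ~ (s | l)%Z -> W y (pt s i l) = y (pt s i l)).
Proof.
assert (hA := rdecay_ge_0 _ _ _ hu). assert (hD := rdecay_ge_0 _ _ _ hv).
assert (hw := wtot_ge_1).
assert (HT : forall n, exists T, isT (fun m => u (m - n)%Z) T).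
{ intros n; apply (isT_exists _ _ (rdecay_shift u A n hu)). }
destruct (ex_choice _ HT) as [T hT]; exists T.
(* Of the four extra powers in [hv], two absorb the growth [br n ^ 2] of the shifted coefficients
   and two supply [wt n]. *)
assert (hn : forall n, norm (scal (v n) (T n) : BH) <= A * D * wtot * wt n / br n ^ N).
{ intros n; eapply Rle_trans; [apply norm_scal_BH|].
  assert (h1 := isT_norm _ _ _ (rdecay_shift u A n hu) (hT n)).
  assert (h2 := hv n).
  apply le_div_of_mult; [apply br_pow_pos|].
  apply Rle_trans with ((A * wtot) * (br n ^ (N + 2) * Cmod (v n))).
  - rewrite pow_add.
    assert (h3 : Cmod (v n) * norm (T n) <= Cmod (v n) * (A * br n ^ 2 * wtot))
      by (apply Rmult_le_compat_l; [apply Cmod_ge_0|exact h1]).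
    apply (Rmult_le_compat_l (br n ^ N)) in h3; [|left; apply br_pow_pos].
    eapply Rle_trans; [exact h3|right; ring].
  - replace (A * D * wtot * wt n) with (A * wtot * (D * wt n)) by ring.
    apply Rmult_le_compat_l; [apply Rmult_le_pos; lra|].
    apply mult_wt; replace (N + 2 + 2)%nat with (N + 4)%nat by lia; exact h2. }
assert (hn' : forall n, norm (scal (v n) (T n) : BH) <= A * D * wtot * wt n).
{ intros n; eapply Rle_trans; [apply hn|].
  assert (h := br_pow_ge_1 n N); assert (h' := wt_pos n).
  assert (0 <= A * D * wtot * wt n) by (repeat apply Rmult_le_pos; lra).
  apply (Rmult_le_reg_r (br n ^ N)); [lra|].
  replace (A * D * wtot * wt n / br n ^ N * br n ^ N) with (A * D * wtot * wt n) by (field; lra).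
  nra. }
destruct (ex_zseries_BH _ _ hn') as [W hW]; exists W.
assert (HW : forall y j, is_zseries (V := C_NormedModule) (fun n => v n * T n y j)%C (W y j)).
{ intros y j; exact (is_zseries_linear (fun a : BH => a y j) _ W (entry_linear y j) hW). }
(* Inside a block the entry is the sum of [v n * u (i - k - n)], which [hconv] evaluates. *)
assert (HE : forall k i l l', ~ (s | l)%Z -> ~ (s | l')%Z ->
  W (E (pt s k l)) (pt s i l') = E (pt s k l) (pt s i l')).
{ intros k i l l' hl hl'; apply (is_zseries_unique (V := C_NormedModule) _ _ _ (HW _ _)).
  rewrite E_pt by assumption; destruct (Z.eq_dec l l') as [e|e].
  - replace (if Nat.eq_dec k i then RtoC 1 else RtoC 0)
      with (if Z.eq_dec (Z.of_nat i - Z.of_nat k) 0 then RtoC 1 else RtoC 0)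
      by (destruct (Nat.eq_dec k i), (Z.eq_dec (Z.of_nat i - Z.of_nat k) 0); try reflexivity; lia).
    apply (is_zseries_ext (V := C_NormedModule)) with (2 := hconv _); intros n.
    rewrite (isT_entry _ _ k i l l' (hT n)) by assumption.
    destruct (Z.eq_dec l l'); [|tauto]; do 2 f_equal; lia.
  - assert (h := is_zseries_single (V := C_NormedModule) (fun n => v n * T n (E (pt s k l)) (pt s i l'))%C 0).
    cbv beta in h.
    assert (h0 : forall n, T n (E (pt s k l)) (pt s i l') = 0).
    { intros n; rewrite (isT_entry _ _ k i l l' (hT n)) by assumption.
      destruct (Z.eq_dec l l'); tauto. }
    rewrite h0, Cmult_0_r in h; apply h; intros n _; rewrite h0; apply Cmult_0_r. }
split; [exact hT|split; [exact hn|split; [exact hW|split]]].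
- intros k l hl; apply (l2_ext_pt s hs).
  + rewrite E_pt_0 by exact hl.
    apply (is_zseries_C_zero _ _) with (2 := HW _ _); intros n.
    rewrite (isT_pt_0 _ _ k l (hT n) hl); apply Cmult_0_r.
  + intros i l' hl'; apply HE; assumption.
- intros y i l hl.
  revert y; apply (linear_ext_basis (W := C_NormedModule) (fun y : l2 => W y (pt s i l)) (fun y : l2 => y (pt s i l)));
    [apply coord_comp_linear|apply l2_coord_linear|].
  apply (Z_pt_ind s hs).
  + rewrite E_0_pt by exact hl.
    apply (is_zseries_C_zero _ _) with (2 := HW _ _); intros n.
    destruct (ex_zseries_C _ _ (rdecay_wt _ _ (rdecay_shift u A n hu))) as [lam hlam].
    rewrite (isT_E_0 _ _ lam (hT n) hlam).
    change (v n * (lam * E 0 (pt s i l)) = 0)%C; rewrite E_0_pt by exact hl; ring.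
  + intros k l' hl'; apply HE; assumption.
Qed.

(** [W] fixes the basis vector, so the remainder is the sum of the terms [v n] times [T n - X vz n]
    applied to it. Such a term vanishes when [0 <= k + n]. Otherwise [n] exceeds [k] in absolute
    value, and the factor [1 / br n ^ N] in the bound for [v n] times [T n] is at most
    [1 / br k ^ N]. *)
Lemma parametrix_col (k : nat) (l : Z) : ~ (s | l)%Z ->
  norm (minus (E (pt s k l)) (X (Y (E (pt s k l))))) <= A * D * wtot * wtot / br (Z.of_nat k) ^ N.
Proof.
intros hl; destruct shifted_toeplitz as [T [W [hT [hn [hW [HW1 _]]]]]].
assert (hA := rdecay_ge_0 _ _ _ hu). assert (hD := rdecay_ge_0 _ _ _ hv).
assert (hw := wtot_ge_1).
set (y := E (pt s k l)).
assert (S1 : is_zseries (V := l2_NormedModule) (fun n => scal (v n) (T n y)) y).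
{ assert (h := is_zseries_linear (fun a : BH => a y) _ W (apply_linear y) hW).
  cbv beta in h; rewrite (HW1 k l hl : W y = y) in h; exact h. }
assert (S2 : is_zseries (V := l2_NormedModule) (fun n => scal (v n) (X (vz s n y))) (X (Y y))).
{ assert (h := is_zseries_linear (fun a : BH => X (a y)) _ Y
    (is_linear_comp _ _ (apply_linear y) (op_linear X)) hY).
  revert h; apply is_zseries_ext; intros n; apply (linear_scal X (op_linear X)). }
assert (S3 := is_zseries_minus _ _ _ _ S1 S2).
replace (A * D * wtot * wtot / br (Z.of_nat k) ^ N) with (A * D * wtot / br (Z.of_nat k) ^ N * wtot)
  by (field; assert (h := br_pow_pos (Z.of_nat k) N); lra).
apply (is_zseries_norm_le (V := l2_NormedModule)) with (2 := S3); intros n.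
assert (P0 : 0 <= A * D * wtot / br (Z.of_nat k) ^ N * wt n).
{ apply Rmult_le_pos; [|left; apply wt_pos]; apply Rdiv_le_0_compat; [|apply br_pow_pos].
  repeat apply Rmult_le_pos; lra. }
unfold y; rewrite (vz_E n k l hl); destruct (Z.leb_spec 0 (Z.of_nat k + n)) as [h|h].
- replace (T n (E (pt s k l))) with (X (E (pt s (Z.to_nat (Z.of_nat k + n)) l))).
  + eapply Rle_trans; [right; etransitivity; [|exact norm_zero_l2]; f_equal|exact P0].
    apply (plus_opp_r (G := l2_AbelianGroup)).
  + apply (l2_ext_pt s hs); [rewrite (isT_pt_0 u X), (isT_pt_0 _ _ _ _ (hT n)) by assumption; reflexivity|].
    intros i l' hl'; rewrite (isT_entry u X), (isT_entry _ _ _ _ _ _ (hT n)) by assumption.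
    destruct (Z.eq_dec l l'); [|reflexivity]; f_equal; lia.
- change (norm (plus (scal (v n) (T n y)) (opp (scal (v n) (X (zero : l2))))) <=
    A * D * wtot / br (Z.of_nat k) ^ N * wt n).
  replace (X (zero : l2)) with (zero : l2) by (symmetry; exact (linear_zero X (op_linear X))).
  replace (plus (scal (v n) (T n y)) (opp (scal (v n) (zero : l2)))) with ((scal (v n) (T n) : BH) y)
    by (apply l2_ext; intros j; change (v n * T n y j = v n * T n y j + - (1) * (v n * 0))%C; ring).
  eapply Rle_trans; [apply norm_apply_E_le|]; eapply Rle_trans; [apply hn|].
  unfold Rdiv; rewrite (Rmult_assoc _ (wt n)), (Rmult_comm (wt n)), <- Rmult_assoc.
  apply Rmult_le_compat_r; [left; apply wt_pos|].
  apply Rmult_le_compat_l; [repeat apply Rmult_le_pos; lra|].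
  apply Rinv_le_contravar; [apply br_pow_pos|apply br_pow_mono; lia].
Qed.

(** The transposed argument: at level [i] the vectors [T n y] and [vz n (X y)] agree unless [n > i],
    where the latter has no coordinate. *)
Lemma parametrix_row (y : l2) (i : nat) (l : Z) : ~ (s | l)%Z ->
  Cmod (y (pt s i l) - Y (X y) (pt s i l)) <= A * D * wtot * wtot / br (Z.of_nat i) ^ N * norm y.
Proof.
intros hl; destruct shifted_toeplitz as [T [W [hT [hn [hW [_ HW2]]]]]].
assert (hA := rdecay_ge_0 _ _ _ hu). assert (hD := rdecay_ge_0 _ _ _ hv).
assert (hw := wtot_ge_1).
set (j := pt s i l).
assert (S1 : is_zseries (V := C_NormedModule) (fun n => v n * T n y j)%C (y j)).
{ assert (h := is_zseries_linear (fun a : BH => a y j) _ W (entry_linear y j) hW).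
  cbv beta in h; rewrite (HW2 y i l hl : W y j = y j) in h; exact h. }
assert (S2 : is_zseries (V := C_NormedModule) (fun n => v n * vz s n (X y) j)%C (Y (X y) j)).
{ apply isT_entry_series, hY. }
assert (S3 := is_zseries_minus _ _ _ _ S1 S2).
replace (A * D * wtot * wtot / br (Z.of_nat i) ^ N * norm y)
  with (A * D * wtot / br (Z.of_nat i) ^ N * norm y * wtot)
  by (field; assert (h := br_pow_pos (Z.of_nat i) N); lra).
apply (is_zseries_norm_le (V := C_NormedModule)) with (2 := S3); intros n.
assert (hy := norm_l2_ge_0 y).
assert (P0 : 0 <= A * D * wtot / br (Z.of_nat i) ^ N * norm y * wt n).
{ apply Rmult_le_pos; [|left; apply wt_pos]; apply Rmult_le_pos; [|exact hy].
  apply Rdiv_le_0_compat; [|apply br_pow_pos]; repeat apply Rmult_le_pos; lra. }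
change (Cmod (v n * T n y j + - (v n * vz s n (X y) j)) <= A * D * wtot / br (Z.of_nat i) ^ N * norm y * wt n).
unfold j; rewrite (vz_pt s hs n i l _ hl); destruct (Z.leb_spec n (Z.of_nat i)) as [h|h].
- replace (T n y (pt s i l)) with (X y (pt s (Z.to_nat (Z.of_nat i - n)) l)).
  + rewrite Cplus_opp_r, Cmod_0; exact P0.
  + revert y j S1 S2 S3 hy P0; intros y _ _ _ _ _ _; revert y.
    apply (linear_ext_basis (W := C_NormedModule)); [apply coord_comp_linear|apply coord_comp_linear|].
    apply (Z_pt_ind s hs).
    * destruct (ex_zseries_C _ _ (rdecay_wt _ _ (rdecay_shift u A n hu))) as [lam hlam].
      destruct (ex_zseries_C _ _ (rdecay_wt _ _ hu)) as [mu hmu].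
      rewrite (isT_E_0 _ _ lam (hT n) hlam), (isT_E_0 _ _ mu hX hmu).
      change (mu * E 0 (pt s (Z.to_nat (Z.of_nat i - n)) l) = lam * E 0 (pt s i l))%C.
      rewrite !E_0_pt by exact hl; ring.
    * intros k l' hl'; rewrite (isT_entry u X), (isT_entry _ _ _ _ _ _ (hT n)) by assumption.
      destruct (Z.eq_dec l' l); [|reflexivity]; f_equal; lia.
- replace (v n * T n y (pt s i l) + - (v n * 0))%C with ((scal (v n) (T n) : BH) y (pt s i l))
    by (change (v n * T n y (pt s i l) = v n * T n y (pt s i l) + - (v n * 0))%C; ring).
  eapply Rle_trans; [apply l2_coord_le|]; eapply Rle_trans; [apply norm_apply_le|].
  rewrite Rmult_assoc, (Rmult_comm (norm y)), <- Rmult_assoc.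
  apply Rmult_le_compat_r; [exact hy|]; eapply Rle_trans; [apply hn|].
  unfold Rdiv; rewrite (Rmult_assoc _ (wt n)), (Rmult_comm (wt n)), <- Rmult_assoc.
  apply Rmult_le_compat_r; [left; apply wt_pos|].
  apply Rmult_le_compat_l; [repeat apply Rmult_le_pos; lra|].
  apply Rinv_le_contravar; [apply br_pow_pos|apply br_pow_mono; lia].
Qed.

(** * Rapidly decreasing perturbations of Toeplitz operators *)

Section Perturbation.
Variables (c B : BH) (P : R).
Hypothesis (hP : 0 <= P).
Hypothesis (hcol : forall k l, ~ (s | l)%Z -> br (Z.of_nat k) ^ N * norm (c (E (pt s k l))) <= P).
Hypothesis (hrow : forall y i l, ~ (s | l)%Z -> br (Z.of_nat i) ^ N * Cmod (c y (pt s i l)) <= P * norm y).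
Hypothesis (hB : inverse_of (minus X c) B).

Lemma coef_mult_wt (n : Z) : br n ^ N * Cmod (v n) <= D * wt n.
Proof.
apply mult_wt; apply (rdecay_le (N + 2) (N + 4)); [lia|exact hv].
Qed.

(** In each term the column of [c] is taken at level [k + n], and [br k] is at most
    [br (k + n) * br n]: the decay of [c] pays for the first factor, that of [v] for the second. *)
Lemma perturbation_col (k : nat) (l : Z) : ~ (s | l)%Z ->
  norm (c (Y (E (pt s k l)))) <= P * D * wtot / br (Z.of_nat k) ^ N.
Proof.
intros hl; assert (hD := rdecay_ge_0 _ _ _ hv); assert (hw := wtot_ge_1).
set (y := E (pt s k l)).
assert (S2 : is_zseries (V := l2_NormedModule) (fun n => scal (v n) (c (vz s n y))) (c (Y y))).
{ assert (h := is_zseries_linear (fun a : BH => c (a y)) _ Y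
    (is_linear_comp _ _ (apply_linear y) (op_linear c)) hY).
  revert h; apply is_zseries_ext; intros n; apply (linear_scal c (op_linear c)). }
replace (P * D * wtot / br (Z.of_nat k) ^ N) with (P * D / br (Z.of_nat k) ^ N * wtot)
  by (field; assert (h := br_pow_pos (Z.of_nat k) N); lra).
apply (is_zseries_norm_le (V := l2_NormedModule)) with (2 := S2); intros n.
eapply Rle_trans; [right; apply norm_scal_l2|].
unfold y; rewrite (vz_E n k l hl); destruct (Z.leb_spec 0 (Z.of_nat k + n)) as [h|h].
- set (k' := Z.to_nat (Z.of_nat k + n)).
  assert (h1 := hcol k' l hl); assert (h2 := coef_mult_wt n).
  assert (h3 := br_pow_add (Z.of_nat k') (- n) N); rewrite br_opp in h3.
  replace (Z.of_nat k' + - n)%Z with (Z.of_nat k) in h3 by lia.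
  replace (P * D / br (Z.of_nat k) ^ N * wt n) with ((P * (D * wt n)) / br (Z.of_nat k) ^ N)
    by (field; assert (h' := br_pow_pos (Z.of_nat k) N); lra).
  apply le_div_of_mult; [apply br_pow_pos|].
  set (q := norm (c (E (pt s k' l)))) in *; assert (hq : 0 <= q) by apply norm_l2_ge_0.
  assert (h4 := Cmod_ge_0 (v n)); assert (h5 := br_pow_pos n N); assert (h6 := br_pow_pos (Z.of_nat k') N).
  apply Rle_trans with ((br (Z.of_nat k') ^ N * q) * (br n ^ N * Cmod (v n))).
  + rewrite (Rmult_assoc _ q), (Rmult_comm q), !Rmult_assoc, <- (Rmult_assoc (br (Z.of_nat k') ^ N)).
    apply Rmult_le_compat_r; [apply Rmult_le_pos; assumption|exact h3].
  + apply Rmult_le_compat; [apply Rmult_le_pos; lra|apply Rmult_le_pos; lra|exact h1|exact h2].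
- replace (norm (c (zero : l2))) with 0
    by (rewrite (linear_zero c (op_linear c) : c (zero : l2) = zero); symmetry; exact norm_zero_l2).
  rewrite Rmult_0_r; apply Rmult_le_pos; [|left; apply wt_pos].
  apply Rdiv_le_0_compat; [apply Rmult_le_pos; assumption|apply br_pow_pos].
Qed.

(** As for columns, with [i = (i - n) + n] as the splitting of the level. *)
Lemma perturbation_row (y : l2) (i : nat) (l : Z) : ~ (s | l)%Z ->
  Cmod (Y (c y) (pt s i l)) <= P * D * wtot / br (Z.of_nat i) ^ N * norm y.
Proof.
intros hl; assert (hD := rdecay_ge_0 _ _ _ hv); assert (hw := wtot_ge_1).
assert (hy := norm_l2_ge_0 y).
replace (P * D * wtot / br (Z.of_nat i) ^ N * norm y) with (P * D / br (Z.of_nat i) ^ N * norm y * wtot)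
  by (field; assert (h := br_pow_pos (Z.of_nat i) N); lra).
apply (is_zseries_norm_le (V := C_NormedModule)) with (2 := isT_entry_series _ _ _ _ hY); intros n.
change (Cmod (v n * vz s n (c y) (pt s i l)) <= P * D / br (Z.of_nat i) ^ N * norm y * wt n).
rewrite Cmod_mult, (vz_pt s hs n i l _ hl); destruct (Z.leb_spec n (Z.of_nat i)) as [h|h].
- set (k' := Z.to_nat (Z.of_nat i - n)).
  assert (h1 := hrow y k' l hl); assert (h2 := coef_mult_wt n).
  assert (h3 := br_pow_add (Z.of_nat k') n N).
  replace (Z.of_nat k' + n)%Z with (Z.of_nat i) in h3 by lia.
  replace (P * D / br (Z.of_nat i) ^ N * norm y * wt n) with ((P * norm y * (D * wt n)) / br (Z.of_nat i) ^ N)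
    by (field; assert (h' := br_pow_pos (Z.of_nat i) N); lra).
  apply le_div_of_mult; [apply br_pow_pos|].
  set (q := Cmod (c y (pt s k' l))) in *; assert (hq : 0 <= q) by apply Cmod_ge_0.
  assert (h4 := Cmod_ge_0 (v n)); assert (h5 := br_pow_pos n N); assert (h6 := br_pow_pos (Z.of_nat k') N).
  apply Rle_trans with ((br (Z.of_nat k') ^ N * q) * (br n ^ N * Cmod (v n))).
  + rewrite (Rmult_assoc _ q), (Rmult_comm q), !Rmult_assoc, <- (Rmult_assoc (br (Z.of_nat k') ^ N)).
    apply Rmult_le_compat_r; [apply Rmult_le_pos; assumption|exact h3].
  + apply Rmult_le_compat; [apply Rmult_le_pos; lra|apply Rmult_le_pos; lra|exact h1|exact h2].
- rewrite Cmod_0, Rmult_0_r; apply Rmult_le_pos; [|left; apply wt_pos].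
  apply Rmult_le_pos; [|exact hy].
  apply Rdiv_le_0_compat; [apply Rmult_le_pos; assumption|apply br_pow_pos].
Qed.

(* With [H = X - c] one has [B - Y = B (1 - H Y) = (1 - Y H) B]: the first form decays along
   columns, the second along rows. *)
Lemma resolvent_entry_decay (k i : nat) (l l' : Z) : ~ (s | l)%Z -> ~ (s | l')%Z ->
  br (Z.of_nat (max i k)) ^ N * Cmod (B (E (pt s k l)) (pt s i l') - Y (E (pt s k l)) (pt s i l'))
  <= norm B * (A * D * wtot * wtot + P * D * wtot).
Proof.
intros hl hl'; destruct hB as [hB1 hB2].
assert (hnB : 0 <= norm B) by apply BH_norm_ge_0.
set (y := E (pt s k l)); set (j := pt s i l').
(* The two inverse identities solved for the Toeplitz part; each feeds one of the two expressions
   for [B - Y]. *)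
assert (HBl : forall x, B (X x) = plus x (B (c x))).
{ intros x; assert (h : B (minus (X x) (c x)) = x).
  { change ((mult B (minus X c) : BH) x = x); rewrite hB2; reflexivity. }
  rewrite (linear_minus B _ _ (op_linear B)) in h; rewrite <- h at 2.
  apply l2_ext; intros n; change (B (X x) n = B (X x) n + - (1) * B (c x) n + B (c x) n)%C; ring. }
assert (HBr : forall x, X (B x) = plus x (c (B x))).
{ intros x; assert (h : minus (X (B x)) (c (B x)) = x).
  { change ((mult (minus X c) B : BH) x = x); rewrite hB1; reflexivity. }
  rewrite <- h at 2.
  apply l2_ext; intros n; change (X (B x) n = X (B x) n + - (1) * c (B x) n + c (B x) n)%C; ring. }
destruct (Nat.max_spec i k) as [[_ e]|[_ e]]; rewrite e.
- assert (hc := parametrix_col k l hl); assert (hp := perturbation_col k l hl).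
  fold y in hc, hp.
  apply Rle_trans with (br (Z.of_nat k) ^ N * (norm B * (norm (minus y (X (Y y))) + norm (c (Y y))))).
  + apply Rmult_le_compat_l; [left; apply br_pow_pos|].
    replace (B y j - Y y j)%C with (B (plus (minus y (X (Y y))) (c (Y y))) j).
    * eapply Rle_trans; [apply l2_coord_le|]; eapply Rle_trans; [apply norm_apply_le|].
      apply Rmult_le_compat_l; [exact hnB|apply norm_triangle_l2].
    * rewrite (linear_plus B (op_linear B)), (linear_minus B _ _ (op_linear B)), HBl.
      change (B y j + - (1) * (Y y j + B (c (Y y)) j) + B (c (Y y)) j = B y j - Y y j)%C; ring.
  + assert (h := br_pow_pos (Z.of_nat k) N).
    replace (br (Z.of_nat k) ^ N * (norm B * (norm (minus y (X (Y y))) + norm (c (Y y)))))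
      with (norm B * (br (Z.of_nat k) ^ N * (norm (minus y (X (Y y))) + norm (c (Y y))))) by ring.
    apply Rmult_le_compat_l; [exact hnB|].
    replace (A * D * wtot * wtot + P * D * wtot) with
      (br (Z.of_nat k) ^ N * (A * D * wtot * wtot / br (Z.of_nat k) ^ N + P * D * wtot / br (Z.of_nat k) ^ N))
      by (field; lra).
    apply Rmult_le_compat_l; [lra|apply Rplus_le_compat; assumption].
- assert (hc := parametrix_row (B y) i l' hl'); assert (hp := perturbation_row (B y) i l' hl').
  fold j in hc, hp.
  assert (hBy : norm (B y) <= norm B) by apply norm_apply_E_le.
  assert (hBy0 := norm_l2_ge_0 (B y)).
  apply Rle_trans with (br (Z.of_nat i) ^ N * (Cmod (B y j - Y (X (B y)) j) + Cmod (Y (c (B y)) j))).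
  + apply Rmult_le_compat_l; [left; apply br_pow_pos|].
    replace (B y j - Y y j)%C with ((B y j - Y (X (B y)) j) + Y (c (B y)) j)%C; [apply Cmod_triangle|].
    rewrite HBr, (linear_plus Y (op_linear Y)).
    change (B y j - (Y y j + Y (c (B y)) j) + Y (c (B y)) j = B y j - Y y j)%C; ring.
  + assert (h := br_pow_pos (Z.of_nat i) N).
    apply Rle_trans with (br (Z.of_nat i) ^ N * ((A * D * wtot * wtot / br (Z.of_nat i) ^ N
      + P * D * wtot / br (Z.of_nat i) ^ N) * norm (B y))).
    * apply Rmult_le_compat_l; [lra|]; rewrite Rmult_plus_distr_r; apply Rplus_le_compat; assumption.
    * apply Rle_trans with ((A * D * wtot * wtot + P * D * wtot) * norm (B y)); [right; field; lra|].
      rewrite Rmult_comm; apply Rmult_le_compat_r; [|exact hBy].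
      assert (hA := rdecay_ge_0 _ _ _ hu); assert (hD := rdecay_ge_0 _ _ _ hv); assert (hw := wtot_ge_1).
      apply Rplus_le_le_0_compat; repeat apply Rmult_le_pos; lra.
Qed.

End Perturbation.
End Parametrix.
End Toeplitz.

(** * Approximate eigenvectors *)

Definition ez (m : Z) (t : R) : C := (cos (2 * PI * IZR m * t), sin (2 * PI * IZR m * t)).

Lemma ez_add (m n : Z) (t : R) : ez (m + n) t = (ez m t * ez n t)%C.
Proof.
unfold ez, Cmult; simpl; rewrite plus_IZR.
replace (2 * PI * (IZR m + IZR n) * t) with (2 * PI * IZR m * t + 2 * PI * IZR n * t) by ring.
rewrite cos_plus, sin_plus; f_equal; ring.
Qed.

Lemma ez_0 (t : R) : ez 0 t = 1.
Proof.
unfold ez; replace (2 * PI * 0 * t) with 0 by ring; rewrite cos_0, sin_0; reflexivity.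
Qed.

Lemma ez_mod (m : Z) (t : R) : Cmod (ez m t) = 1.
Proof.
unfold ez, Cmod; simpl; rewrite !Rmult_1_r.
assert (h := sin2_cos2 (2 * PI * IZR m * t)); unfold Rsqr in h.
rewrite Rplus_comm, h; apply sqrt_1.
Qed.

Section ApproximateEigenvectors.
Variables (s : Z) (hs : (2 <= s)%Z) (t : R).

Lemma one_unit : ~ (s | 1)%Z.
Proof. intros h; apply Z.divide_1_r_nonneg in h; lia. Qed.

(* [V (xi n) - ez 1 t * xi n] is supported on two basis vectors, so its norm stays bounded while that
   of [xi n] is [sqrt n]: up to bounded errors the [xi n] are eigenvectors for the symbol at [t]. *)
Fixpoint xi (n : nat) : l2 :=
  match n with
  | O => zero
  | S n => plus (xi n) (scal (ez (- Z.of_nat n) t) (E (pt s n 1)))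
  end.

Lemma xi_coord (n k : nat) :
  xi n (pt s k 1) = if (k <? n)%nat then ez (- Z.of_nat k) t else RtoC 0.
Proof.
induction n as [|n IH]; [reflexivity|].
change (xi (S n) (pt s k 1)) with (xi n (pt s k 1) + ez (- Z.of_nat n) t * E (pt s n 1) (pt s k 1))%C.
rewrite IH, (E_pt s hs) by apply one_unit.
destruct (Z.eq_dec 1 1); [|tauto].
destruct (Nat.eq_dec n k) as [en|h], (Nat.ltb_spec k n) as [h1|h1]; try lia;
  destruct (Nat.ltb_spec k (S n)) as [h2|h2]; try lia; rewrite ?en; ring.
Qed.

Lemma xi_norm (n : nat) : sqrt (INR n) <= norm (xi n).
Proof.

rewrite <- (sqrt_pow2 (norm (xi n))) by apply norm_l2_ge_0.
apply sqrt_le_1_alt.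
eapply Rle_trans; [|apply (lsum_le_norm (xi n) (map (fun k => pt s k 1) (seq 0 n)))].
- rewrite lsum_map.
  rewrite (lsum_ext _ (fun _ => 1)).
  + assert (h : forall L : list nat, lsum (fun _ => 1) L = INR (length L)).
    { induction L as [|a L IH]; [reflexivity|].
      rewrite lsum_cons, IH; simpl length; rewrite S_INR; ring. }
    rewrite h, length_seq; lra.
  + intros k hk; apply in_seq in hk; rewrite xi_coord.
    destruct (Nat.ltb_spec k n); [|lia]; rewrite ez_mod; ring.
- apply NoDup_map_seq; intros i j h; apply (pt_inj s hs _ _ _ _ one_unit one_unit h).
Qed.

Lemma V_E (l : Z) : V s (E l) = E (s * l).
Proof.
destruct (V_spec s hs) as [H1 [H2 _]].
apply l2_ext; intros j; destruct (Zdivide_dec s j) as [[q ->]|h].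
- rewrite (Z.mul_comm q), H1, !E_coord.
  destruct (Z.eq_dec q l), (Z.eq_dec (s * q) (s * l)); try reflexivity; nia.
- rewrite (H2 _ _ h), E_coord; destruct (Z.eq_dec j (s * l)) as [->|]; [|reflexivity].
  elim h; apply Z.divide_factor_l.
Qed.

Lemma V_xi (n : nat) : V s (xi n) =
  plus (scal (ez 1 t) (xi n))
    (plus (scal (ez (1 - Z.of_nat n) t) (E (pt s n 1))) (scal (- ez 1 t)%C (E (pt s 0 1)))).
Proof.
induction n as [|n IH].
- simpl xi; rewrite (linear_zero _ (op_linear (V s)) : V s (zero : l2) = zero).
  apply l2_ext; intros j.
  change (RtoC 0 = ez 1 t * 0 + (ez 1 t * E (pt s 0 1) j + - ez 1 t * E (pt s 0 1) j))%C; ring.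
- change (xi (S n)) with (plus (xi n) (scal (ez (- Z.of_nat n) t) (E (pt s n 1)))).
  rewrite (linear_plus _ (op_linear (V s))), (linear_scal _ (op_linear (V s))), IH, V_E, <- pt_S.
  apply l2_ext; intros j.
  change (ez 1 t * xi n j + (ez (1 - Z.of_nat n) t * E (pt s n 1) j + - ez 1 t * E (pt s 0 1) j)
    + ez (- Z.of_nat n) t * E (pt s (S n) 1) j =
    ez 1 t * (xi n j + ez (- Z.of_nat n) t * E (pt s n 1) j) +
    (ez (1 - Z.of_nat (S n)) t * E (pt s (S n) 1) j + - ez 1 t * E (pt s 0 1) j))%C.
  replace (1 - Z.of_nat (S n))%Z with (- Z.of_nat n)%Z by lia.
  replace (1 - Z.of_nat n)%Z with (1 + - Z.of_nat n)%Z by lia; rewrite ez_add; ring.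
Qed.

Lemma V_xi_norm (n : nat) : norm (minus (V s (xi n)) (scal (ez 1 t) (xi n))) <= 2.
Proof.
replace (minus (V s (xi n)) (scal (ez 1 t) (xi n)))
  with (plus (scal (ez (1 - Z.of_nat n) t) (E (pt s n 1))) (scal (- ez 1 t)%C (E (pt s 0 1)))).
- eapply Rle_trans; [apply norm_triangle_l2|]; rewrite !norm_scal_l2, Cmod_opp, !ez_mod.
  assert (h1 := E_norm_le (pt s n 1)); assert (h2 := E_norm_le (pt s 0 1)); lra.
- rewrite V_xi; apply l2_ext; intros j.
  change (ez (1 - Z.of_nat n) t * E (pt s n 1) j + - ez 1 t * E (pt s 0 1) j =
    ez 1 t * xi n j + (ez (1 - Z.of_nat n) t * E (pt s n 1) j + - ez 1 t * E (pt s 0 1) j)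
    + - (1) * (ez 1 t * xi n j))%C; ring.
Qed.

(** The adjoint of [V] is a left inverse of it with norm at most 1. Applied to the error of
    [V_xi_norm] and multiplied by [- ez (-1) t], it gives this error. *)
Lemma Vs_xi_norm (n : nat) :
  norm (minus (adjoint (V s) (xi n)) (scal (ez (-1) t) (xi n))) <= 2.
Proof.
destruct (V_spec s hs) as [HV _], (Vs_spec s hs) as [HVs hn].
replace (minus (adjoint (V s) (xi n)) (scal (ez (-1) t) (xi n)))
  with (scal (- ez (-1) t)%C (adjoint (V s) (minus (V s (xi n)) (scal (ez 1 t) (xi n))))).
- rewrite norm_scal_l2, Cmod_opp, ez_mod, Rmult_1_l.
  eapply Rle_trans; [apply norm_apply_le|].
  assert (h := V_xi_norm n); assert (h' := BH_norm_ge_0 (adjoint (V s))).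
  change (norm (adjoint (V s))) with (BH_norm (adjoint (V s))) in *.
  assert (h0 := norm_l2_ge_0 (minus (V s (xi n)) (scal (ez 1 t) (xi n)))); nra.
- apply l2_ext; intros j.
  rewrite (linear_minus _ _ _ (op_linear (adjoint (V s)))), (linear_scal _ (op_linear (adjoint (V s)))).
  change (- ez (-1) t * (adjoint (V s) (V s (xi n)) j + - (1) * (ez 1 t * adjoint (V s) (xi n) j)) =
    adjoint (V s) (xi n) j + - (1) * (ez (-1) t * xi n j))%C.
  rewrite (HVs (V s (xi n))), HV.
  assert (e : (ez (-1) t * ez 1 t)%C = 1) by (rewrite <- ez_add; apply ez_0).
  transitivity (- (1) * (ez (-1) t * xi n j) + (ez (-1) t * ez 1 t) * adjoint (V s) (xi n) j)%C; [ring|].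
  rewrite e; ring.
Qed.

(** Each further factor of the contraction [a] adds one error of size 2. The sign [d] serves [V] and
    its adjoint alike. *)
Lemma pow_xi_norm (a : BH) (d : Z) (n : nat) : norm a <= 1 ->
  norm (minus (a (xi n)) (scal (ez d t) (xi n))) <= 2 ->
  forall m, norm (minus ((pow_n a m : BH) (xi n)) (scal (ez (d * Z.of_nat m) t) (xi n))) <= 2 * INR m.
Proof.
intros ha hd; induction m as [|m IH].
- replace (d * Z.of_nat 0)%Z with 0%Z by lia; rewrite ez_0.
  replace (minus ((pow_n a 0 : BH) (xi n)) (scal (RtoC 1) (xi n))) with (zero : l2).
  + simpl INR; rewrite norm_zero_l2; lra.
  + apply l2_ext; intros j; change (RtoC 0 = xi n j + - (1) * (1 * xi n j))%C; ring.
- change ((pow_n a (S m) : BH) (xi n)) with (a ((pow_n a m : BH) (xi n))).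
  set (p := (pow_n a m : BH) (xi n)) in *.
  replace (minus (a p) (scal (ez (d * Z.of_nat (S m)) t) (xi n))) with
    (plus (a (minus p (scal (ez (d * Z.of_nat m) t) (xi n))))
      (scal (ez (d * Z.of_nat m) t) (minus (a (xi n)) (scal (ez d t) (xi n))))).
  + eapply Rle_trans; [apply norm_triangle_l2|]; rewrite norm_scal_l2, ez_mod, S_INR.
    assert (h := norm_apply_le a (minus p (scal (ez (d * Z.of_nat m) t) (xi n)))).
    assert (h' := BH_norm_ge_0 a); change (norm a) with (BH_norm a) in *.
    assert (h0 := norm_l2_ge_0 (minus p (scal (ez (d * Z.of_nat m) t) (xi n)))); nra.
  + rewrite (linear_minus _ _ _ (op_linear a)), (linear_scal _ (op_linear a)).
    replace (d * Z.of_nat (S m))%Z with (d * Z.of_nat m + d)%Z by lia; rewrite ez_add.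
    apply l2_ext; intros j.
    change (a p j + - (1) * (ez (d * Z.of_nat m) t * a (xi n) j) +
      ez (d * Z.of_nat m) t * (a (xi n) j + - (1) * (ez d t * xi n j)) =
      a p j + - (1) * (ez (d * Z.of_nat m) t * ez d t * xi n j))%C; ring.
Qed.

Lemma vz_xi_norm (m : Z) (n : nat) :
  norm (minus (vz s m (xi n)) (scal (ez m t) (xi n))) <= 2 * br m.
Proof.
unfold br, vz; destruct (Z.leb_spec 0 m) as [h|h].
- destruct (V_spec s hs) as [_ [_ hn]].
  assert (H := pow_xi_norm (V s) 1 n hn (V_xi_norm n) (Z.to_nat m)).
  rewrite INR_IZR_INZ, Z2Nat.id, Z.mul_1_l in H by lia; rewrite Z.abs_eq by lia; lra.
- destruct (Vs_spec s hs) as [_ hn].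
  assert (H := pow_xi_norm (adjoint (V s)) (-1) n hn (Vs_xi_norm n) (Z.to_nat (- m))).
  rewrite INR_IZR_INZ, Z2Nat.id in H by lia.
  replace (-1 * - m)%Z with m in H by lia; rewrite Z.abs_neq by lia; lra.
Qed.

Lemma scal_l_linear (x : l2) :
  is_linear (U := C_NormedModule) (V := l2_NormedModule) (fun z : C => scal z x).
Proof.
apply Build_is_linear.
- intros a b; apply l2_ext; intros j; change ((a + b) * x j = a * x j + b * x j)%C; ring.
- intros a b; apply l2_ext; intros j; change (a * b * x j = a * (b * x j))%C; ring.
- exists (norm x + 1); split; [assert (h := norm_l2_ge_0 x); lra|]; intros a.
  rewrite norm_scal_l2; change (norm a) with (Cmod a); assert (h := Cmod_ge_0 a); nra.
Qed.

(** [lam] is the value of the symbol of [X] at [t]. A bounded error suffices because the norms of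
    the [xi n] are unbounded. *)
Definition eig (X : BH) (lam : C) : Prop :=
  exists K, forall n, norm (minus (X (xi n)) (scal lam (xi n))) <= K.

(** The error of [vz m] grows like [br m], which costs one power of decay beyond the two for
    summability. *)
Lemma eig_T (u : Z -> C) (c : R) (X : BH) (lam : C) : rdecay 3 u c -> isT s u X ->
  is_zseries (V := C_NormedModule) (fun m => u m * ez m t)%C lam -> eig X lam.
Proof.
intros hu hX hl; exists (2 * c * wtot); intros n.
assert (S1 : is_zseries (V := l2_NormedModule) (fun m => scal (u m) (vz s m (xi n))) (X (xi n))).
{ exact (is_zseries_linear (fun a : BH => a (xi n)) _ X (apply_linear (xi n)) hX). }
assert (S2 : is_zseries (V := l2_NormedModule) (fun m => scal (u m * ez m t)%C (xi n)) (scal lam (xi n))).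
{ exact (is_zseries_linear (fun z : C => scal z (xi n)) _ lam
    (scal_l_linear (xi n)) hl). }
assert (S3 := is_zseries_minus _ _ _ _ S1 S2).
apply (is_zseries_norm_le (V := l2_NormedModule)) with (2 := S3); intros m.
change (norm (plus (scal (u m) (vz s m (xi n))) (opp (scal (u m * ez m t)%C (xi n)))) <= 2 * c * wt m).
replace (plus (scal (u m) (vz s m (xi n))) (opp (scal (u m * ez m t)%C (xi n))))
  with (scal (u m) (minus (vz s m (xi n)) (scal (ez m t) (xi n)))).
2: { apply l2_ext; intros j; change (u m * (vz s m (xi n) j + - (1) * (ez m t * xi n j)) =
    u m * vz s m (xi n) j + - (1) * (u m * ez m t * xi n j))%C; ring. }
rewrite norm_scal_l2.
assert (h := vz_xi_norm m n); assert (h0 := Cmod_ge_0 (u m)).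
assert (h1 := mult_wt m 1 _ _ (hu m)); rewrite pow_1 in h1.
apply Rle_trans with (Cmod (u m) * (2 * br m)); [apply Rmult_le_compat_l; assumption|lra].
Qed.

(** Summable columns keep the images of all the [xi n] bounded, so rapidly decreasing operators have
    symbol 0. *)
Lemma eig_col (X : BH) (c : R) :
  (forall k, norm (X (E (pt s k 1))) <= c * wt (Z.of_nat k)) -> eig X 0.
Proof.
intros H; exists (c * wtot); intros n.
assert (hc : 0 <= c).
{ assert (h := H 0%nat); assert (h' := norm_l2_ge_0 (X (E (pt s 0 1)))).
  assert (h'' := wt_pos (Z.of_nat 0)); nra. }
replace (minus (X (xi n)) (scal (RtoC 0) (xi n))) with (X (xi n))
  by (apply l2_ext; intros j; change (X (xi n) j = X (xi n) j + - (1) * (0 * xi n j))%C; ring).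
assert (h : norm (X (xi n)) <= c * lsum wt (map Z.of_nat (seq 0 n))).
{ induction n as [|n IH].
  - simpl; rewrite (linear_zero _ (op_linear X) : X (zero : l2) = zero), norm_zero_l2; lra.
  - rewrite seq_S, map_app, lsum_app; simpl (map Z.of_nat (0 + n :: nil)%nat); rewrite lsum_cons.
    change (xi (S n)) with (plus (xi n) (scal (ez (- Z.of_nat n) t) (E (pt s n 1)))).
    rewrite (linear_plus _ (op_linear X)), (linear_scal _ (op_linear X)).
    eapply Rle_trans; [apply norm_triangle_l2|]; rewrite norm_scal_l2, ez_mod.
    specialize (H n); simpl (lsum wt nil); simpl Nat.add in *; lra. }
eapply Rle_trans; [exact h|]; apply Rmult_le_compat_l; [exact hc|].
apply lsum_le_ZSeries; [intros l; left; apply wt_pos|apply ex_zseries_wt|].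
apply NoDup_map_seq; intros; lia.
Qed.

Lemma eig_minus (X Y : BH) (a b : C) : eig X a -> eig Y b -> eig (minus X Y) (a - b)%C.
Proof.
intros [K HK] [K' HK']; exists (K + K'); intros n; specialize (HK n); specialize (HK' n).
replace (minus ((minus X Y : BH) (xi n)) (scal (a - b)%C (xi n)))
  with (minus (minus (X (xi n)) (scal a (xi n))) (minus (Y (xi n)) (scal b (xi n)))).
- eapply Rle_trans; [apply norm_triangle_l2|].
  rewrite (norm_opp (V := l2_NormedModule) : forall x : l2, norm (opp x) = norm x); lra.
- apply l2_ext; intros j.
  change (X (xi n) j + - (1) * (a * xi n j) + - (1) * (Y (xi n) j + - (1) * (b * xi n j)) =
    X (xi n) j + - (1) * Y (xi n) j + - (1) * ((a - b) * xi n j))%C; ring.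
Qed.

(** Together with [eig_minus] and [eig_one]: taking the symbol at [t] is compatible with the algebra
    operations. *)
Lemma eig_mult (X Y : BH) (a b : C) : eig X a -> eig Y b -> eig (mult X Y) (a * b)%C.
Proof.
intros [K HK] [K' HK']; exists (norm X * K' + Cmod b * K); intros n; specialize (HK n); specialize (HK' n).
replace (minus ((mult X Y : BH) (xi n)) (scal (a * b)%C (xi n)))
  with (plus (X (minus (Y (xi n)) (scal b (xi n)))) (scal b (minus (X (xi n)) (scal a (xi n))))).
- eapply Rle_trans; [apply norm_triangle_l2|]; rewrite norm_scal_l2.
  apply Rplus_le_compat.
  + eapply Rle_trans; [apply norm_apply_le|]; apply Rmult_le_compat_l; [apply BH_norm_ge_0|exact HK'].
  + apply Rmult_le_compat_l; [apply Cmod_ge_0|exact HK].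
- rewrite (linear_minus _ _ _ (op_linear X)), (linear_scal _ (op_linear X)); apply l2_ext; intros j.
  change (X (Y (xi n)) j + - (1) * (b * X (xi n) j) + b * (X (xi n) j + - (1) * (a * xi n j)) =
    X (Y (xi n)) j + - (1) * (a * b * xi n j))%C; ring.
Qed.

Lemma eig_one : eig one 1.
Proof.
exists 0; intros n; replace (minus ((one : BH) (xi n)) (scal (RtoC 1) (xi n))) with (zero : l2).
- rewrite norm_zero_l2; lra.
- apply l2_ext; intros j; change (RtoC 0 = xi n j + - (1) * (1 * xi n j))%C; ring.
Qed.

(** Applying [B] to [X (xi n)] gives [norm (xi n) <= norm B * (K + Cmod a * norm (xi n))]. If
    [norm B * Cmod a < 1], this bounds the norms of the [xi n], which are at least [sqrt n]. *)
Lemma eig_zero_bound (B : BH) (X : BH) (a : C) :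
  mult B X = one -> eig X a -> 1 <= norm B * Cmod a.
Proof.
intros hB [K HK]; assert (hn : 0 <= norm B) by apply BH_norm_ge_0.
destruct (Rle_lt_dec 1 (norm B * Cmod a)) as [h|h]; [exact h|exfalso].
set (d := 1 - norm B * Cmod a) in *; assert (hd : 0 < d) by (unfold d; lra).
assert (H : forall n, d * sqrt (INR n) <= norm B * K).
{ intros n; specialize (HK n).
  assert (e : xi n = B (X (xi n))).
  { change (xi n = (mult B X : BH) (xi n)); rewrite hB; reflexivity. }
  assert (h1 : norm (xi n) <= norm B * (K + Cmod a * norm (xi n))).
  { rewrite e at 1; eapply Rle_trans; [apply norm_apply_le|]; apply Rmult_le_compat_l; [exact hn|].
    replace (X (xi n)) with (plus (minus (X (xi n)) (scal a (xi n))) (scal a (xi n)))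
      by (apply l2_ext; intros j; change (X (xi n) j + - (1) * (a * xi n j) + a * xi n j = X (xi n) j)%C; ring).
    eapply Rle_trans; [apply norm_triangle_l2|]; rewrite norm_scal_l2; lra. }
  assert (h2 := xi_norm n).
  apply Rle_trans with (d * norm (xi n)); [apply Rmult_le_compat_l; lra|unfold d; lra]. }
destruct (INR_unbounded ((norm B * K / d) ^ 2)) as [n hN].
specialize (H n).
assert (h3 : sqrt (INR n) <= norm B * K / d) by (apply le_div_of_mult; assumption).
assert (h4 := sqrt_pos (INR n)).
assert (h5 : INR n <= (norm B * K / d) ^ 2).
{ rewrite <- (pow2_sqrt (INR n)) by apply pos_INR; apply pow_incr; lra. }
lra.
Qed.

(** Two distinct values would make 0 a symbol of the identity, against [eig_zero_bound] for the
    identity as its own inverse. *)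
Lemma eig_unique (X : BH) (a b : C) : eig X a -> eig X b -> a = b.
Proof.
intros h1 h2; assert (h := eig_minus _ _ _ _ h1 h2).
destruct (Req_dec (Cmod (a - b)) 0) as [e|e].
- apply Cmod_eq_0 in e; transitivity (a - b + b)%C; [ring|rewrite e; ring].
- exfalso; destruct h as [K HK].
  assert (e2 : minus X X = zero) by (apply (minus_eq_zero (G := BH_AbelianGroup))).
  rewrite e2 in HK.
  assert (H : eig one 0).
  { exists (K / Cmod (a - b)); intros n; specialize (HK n).
    assert (hp : 0 < Cmod (a - b)) by (assert (h := Cmod_ge_0 (a - b)); lra).
    apply le_div_of_mult; [exact hp|].
    assert (h3 : norm (scal (- (a - b))%C (xi n)) <= K).
    { eapply Rle_trans; [|exact HK]; right; f_equal; apply l2_ext; intros j.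
      change (- (a - b) * xi n j = 0 + - (1) * ((a - b) * xi n j))%C; ring. }
    rewrite norm_scal_l2, Cmod_opp in h3.
    replace (minus ((one : BH) (xi n)) (scal (RtoC 0) (xi n))) with (xi n); [exact h3|].
    apply l2_ext; intros j; change (xi n j = xi n j + - (1) * (0 * xi n j))%C; ring. }
  assert (H1 := eig_zero_bound one one 0 (mult_one_l (K := BH_Ring) one) H).
  rewrite Cmod_0 in H1; lra.
Qed.

End ApproximateEigenvectors.

(** * Fourier coefficients *)

Lemma C_R_norm (z : C) : norm (V := C_R_NormedModule) z = Cmod z.
Proof.
change (sqrt (norm (fst z) ^ 2 + norm (snd z) ^ 2) = sqrt (fst z ^ 2 + snd z ^ 2)).
f_equal; change (Rabs (fst z) ^ 2 + Rabs (snd z) ^ 2 = fst z ^ 2 + snd z ^ 2).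
rewrite !pow2_abs; reflexivity.
Qed.

(** A bounded linear map commutes with Riemann sums and with their limit. *)
Lemma is_RInt_linear {U V : NormedModule R_AbsRing} (ell : U -> V) (f : R -> U) (a b : R) (v : U) :
  is_linear ell -> is_RInt f a b v -> is_RInt (fun t => ell (f t)) a b (ell v).
Proof.
intros hl H; unfold is_RInt.
apply (filterlim_ext (fun ptd => ell (scal (sign (b - a)) (Riemann_sum f ptd)))).
- intros ptd; rewrite (linear_scal ell hl); f_equal.
  apply (SF_cons_ind (fun ptd => ell (Riemann_sum f ptd) = Riemann_sum (fun t => ell (f t)) ptd)).
  + intros x; apply (linear_zero ell hl).
  + intros h s IH; rewrite !Riemann_sum_cons, (linear_plus ell hl), (linear_scal ell hl), IH; reflexivity.
- eapply filterlim_comp; [exact H|apply (linear_cont ell v hl)].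
Qed.

Lemma Cmul_R_linear (c : C) :
  is_linear (U := C_R_NormedModule) (V := C_R_NormedModule) (fun z : C => (c * z)%C).
Proof.
apply Build_is_linear.
- intros x y; change (c * (x + y) = c * x + c * y)%C; ring.
- intros k x; apply injective_projections; simpl; unfold scal; simpl; unfold mult; simpl; ring.
- exists (Cmod c + 1); assert (h := Cmod_ge_0 c); split; [lra|].
  intros x; rewrite !C_R_norm, Cmod_mult; assert (h' := Cmod_ge_0 x); nra.
Qed.

Lemma is_RInt_Cmul (c : C) (f : R -> C) (a b : R) (v : C) :
  is_RInt (V := C_R_NormedModule) f a b v ->
  is_RInt (V := C_R_NormedModule) (fun t => c * f t)%C a b (c * v)%C.
Proof. exact (is_RInt_linear (fun z : C => (c * z)%C) f a b v (Cmul_R_linear c)). Qed.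

Lemma is_RInt_C_le (f : R -> C) (K : R) (v : C) :
  (forall t, 0 <= t <= 1 -> Cmod (f t) <= K) -> is_RInt (V := C_R_NormedModule) f 0 1 v -> Cmod v <= K.
Proof.
intros H hv; rewrite <- C_R_norm, <- (Rmult_1_l K); replace 1 with (1 - 0) at 1 by ring.
apply (norm_RInt_le_const f 0 1 v K Rle_0_1); [|exact hv].
intros t ht; rewrite C_R_norm; apply H, ht.
Qed.

(** * Continuity and derivatives of complex functions of a real variable *)

Definition C_cont (f : R -> C) : Prop := forall t, continuous (U := C_UniformSpace) f t.

Lemma C_cont_Re (f : R -> C) (t : R) : C_cont f -> continuous (fun t => Re (f t)) t.
Proof.
intros h; apply (continuous_comp f (fun z : C_UniformSpace => fst z)); [apply h|].
destruct (f t) as [x y]; apply continuous_fst.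
Qed.

Lemma C_cont_Im (f : R -> C) (t : R) : C_cont f -> continuous (fun t => Im (f t)) t.
Proof.
intros h; apply (continuous_comp f (fun z : C_UniformSpace => snd z)); [apply h|].
destruct (f t) as [x y]; apply continuous_snd.
Qed.

Lemma C_cont_ReIm (f : R -> C) :
  (forall t, continuous (fun t => Re (f t)) t) -> (forall t, continuous (fun t => Im (f t)) t) -> C_cont f.
Proof.
intros h1 h2 t.
apply (continuous_ext (fun t => (Re (f t), Im (f t)))); [intros x; symmetry; apply surjective_pairing|].
apply (filterlim_comp_2 (G := locally (Re (f t))) (H := locally (Im (f t)))
  (fun t => Re (f t)) (fun t => Im (f t)) (fun x y => (x, y)) (h1 t) (h2 t)).
intros P [eps HP]; exists (ball (Re (f t)) eps) (ball (Im (f t)) eps); try apply locally_ball.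
intros x y hx hy; apply HP; split; assumption.
Qed.

Lemma C_cont_mult (f g : R -> C) : C_cont f -> C_cont g -> C_cont (fun t => f t * g t)%C.
Proof.
intros hf hg.
assert (hm : forall p q : R -> R, forall t, continuous p t -> continuous q t ->
  continuous (fun t => p t * q t) t) by exact (continuous_mult (K := R_AbsRing)).
apply C_cont_ReIm; intros t.
- exact (continuous_minus (V := R_NormedModule) _ _ t
    (hm _ _ t (C_cont_Re f t hf) (C_cont_Re g t hg)) (hm _ _ t (C_cont_Im f t hf) (C_cont_Im g t hg))).
- exact (continuous_plus (V := R_NormedModule) _ _ t
    (hm _ _ t (C_cont_Re f t hf) (C_cont_Im g t hg)) (hm _ _ t (C_cont_Im f t hf) (C_cont_Re g t hg))).
Qed.

(** Componentwise, to match [smooth_periodic]. *)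
Definition is_Cder (f : R -> C) (t : R) (l : C) : Prop :=
  is_derive (fun u => Re (f u)) t (Re l) /\ is_derive (fun u => Im (f u)) t (Im l).

Lemma is_Cder_cont (f f' : R -> C) : (forall t, is_Cder f t (f' t)) -> C_cont f.
Proof.
intros H; apply C_cont_ReIm; intros t; apply (ex_derive_continuous (V := R_NormedModule)).
- exists (Re (f' t)); exact (proj1 (H t)).
- exists (Im (f' t)); exact (proj2 (H t)).
Qed.

Lemma is_derive_Rmult (f g : R -> R) (t a b : R) : is_derive f t a -> is_derive g t b ->
  is_derive (fun u => f u * g u) t (a * g t + f t * b).
Proof. intros hf hg; apply (is_derive_mult f g t a b hf hg); intros; apply Rmult_comm. Qed.

Lemma is_Cder_mult (f g : R -> C) (t : R) (a b : C) : is_Cder f t a -> is_Cder g t b ->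
  is_Cder (fun u => f u * g u)%C t (a * g t + f t * b)%C.
Proof.
intros [h1 h2] [h3 h4]; split.
- evar_last.
  + apply (is_derive_minus (V := R_NormedModule)); apply is_derive_Rmult; eassumption.
  + unfold minus, plus, opp; simpl; unfold Re, Im; ring.
- evar_last.
  + apply (is_derive_plus (V := R_NormedModule)); apply is_derive_Rmult; eassumption.
  + unfold plus; simpl; unfold Re, Im; ring.
Qed.

Lemma is_Cder_plus (f g : R -> C) (t : R) (a b : C) : is_Cder f t a -> is_Cder g t b ->
  is_Cder (fun u => f u + g u)%C t (a + b)%C.
Proof.
intros [h1 h2] [h3 h4]; split; apply (is_derive_plus (V := R_NormedModule)); assumption.
Qed.

Lemma is_Cder_const (c : C) (t : R) : is_Cder (fun _ => c) t 0.
Proof. split; apply (is_derive_const (V := R_NormedModule)). Qed.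

Lemma sum_sq_neq_0 (z : C) : z <> 0 -> Re z * Re z + Im z * Im z <> 0.
Proof.
intros hz e; apply hz; assert (h := Rle_0_sqr (Re z)); assert (h' := Rle_0_sqr (Im z)).
unfold Rsqr in h, h'; apply injective_projections; apply Rsqr_0_uniq; unfold Rsqr, Re, Im in *; lra.
Qed.

Lemma C_cont_inv (f : R -> C) : (forall t, f t <> 0) -> C_cont f -> C_cont (fun t => / f t)%C.
Proof.
intros hn hf.
assert (hd : forall t, continuous (fun t => / (Re (f t) * Re (f t) + Im (f t) * Im (f t))) t).
{ intros t; apply (continuous_comp (fun t => Re (f t) * Re (f t) + Im (f t) * Im (f t)) Rinv).
  - exact (continuous_plus (V := R_NormedModule) _ _ t
      (continuous_mult (K := R_AbsRing) _ _ t (C_cont_Re f t hf) (C_cont_Re f t hf))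
      (continuous_mult (K := R_AbsRing) _ _ t (C_cont_Im f t hf) (C_cont_Im f t hf))).
  - apply continuous_Rinv, sum_sq_neq_0, hn. }
assert (hs : forall t, fst (f t) ^ 2 + snd (f t) ^ 2 = Re (f t) * Re (f t) + Im (f t) * Im (f t))
  by (intros t; unfold Re, Im; ring).
apply C_cont_ReIm; intros t.
- apply (continuous_ext (fun t => Re (f t) * / (Re (f t) * Re (f t) + Im (f t) * Im (f t)))).
  + intros x; unfold Cinv; rewrite hs; reflexivity.
  + apply (continuous_mult (K := R_AbsRing)); [apply C_cont_Re, hf|apply hd].
- apply (continuous_ext (fun t => - Im (f t) * / (Re (f t) * Re (f t) + Im (f t) * Im (f t)))).
  + intros x; unfold Cinv; rewrite hs; reflexivity.
  + apply (continuous_mult (K := R_AbsRing)); [|apply hd].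
    apply (continuous_opp (V := R_NormedModule)), C_cont_Im, hf.
Qed.

Lemma is_Cder_inv (f : R -> C) (t : R) (a : C) : is_Cder f t a -> f t <> 0 ->
  is_Cder (fun u => / f u)%C t (- a * (/ f t * / f t))%C.
Proof.
intros [h1 h2] hn.
assert (hden : is_derive (fun u => Re (f u) * Re (f u) + Im (f u) * Im (f u)) t
  ((Re a * Re (f t) + Re (f t) * Re a) + (Im a * Im (f t) + Im (f t) * Im a))).
{ apply (is_derive_plus (V := R_NormedModule)); apply is_derive_Rmult; assumption. }
assert (hd' := sum_sq_neq_0 (f t) hn).
split.
- apply (is_derive_ext (fun u => Re (f u) / (Re (f u) * Re (f u) + Im (f u) * Im (f u)))).
  { intros u; unfold Cinv, Re, Im; simpl; rewrite !Rmult_1_r; reflexivity. }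
  evar_last; [apply is_derive_div; [exact h1|exact hden|exact hd']|].
  unfold Cinv, Copp, Cmult, Re, Im in *; simpl in *; field; rewrite ?Rmult_1_r; auto.
- apply (is_derive_ext (fun u => (- Im (f u)) / (Re (f u) * Re (f u) + Im (f u) * Im (f u)))).
  { intros u; unfold Cinv, Re, Im; simpl; rewrite !Rmult_1_r; reflexivity. }
  evar_last; [apply is_derive_div; [apply (is_derive_opp (V := R_NormedModule)); exact h2|exact hden|exact hd']|].
  unfold Cinv, Copp, Cmult, Re, Im, opp in *; simpl in *; field; rewrite ?Rmult_1_r; auto.
Qed.

Definition freq (m : Z) : C := (0, 2 * PI * IZR m).

Lemma ez_der (m : Z) (t : R) : is_Cder (ez m) t (freq m * ez m t)%C.
Proof.
split; unfold Re, Im, ez, freq, Cmult; simpl; auto_derive; trivial; ring.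
Qed.

Lemma ez_cont (m : Z) : C_cont (ez m).
Proof. apply (is_Cder_cont _ (fun t => freq m * ez m t)%C), ez_der. Qed.

Lemma ez_1 (m : Z) : ez m 1 = 1.
Proof.
assert (h1 : ez 1 1 = 1).
{ unfold ez; replace (2 * PI * 1 * 1) with (2 * PI) by ring; rewrite cos_2PI, sin_2PI; reflexivity. }
assert (h : forall n : nat, ez (Z.of_nat n) 1 = 1).
{ induction n as [|n IH]; [apply ez_0|].
  rewrite Nat2Z.inj_succ; unfold Z.succ; rewrite ez_add, IH, h1; ring. }
destruct (Z_le_gt_dec 0 m) as [hm|hm].
- rewrite <- (Z2Nat.id m hm); apply h.
- assert (e := ez_add m (- m) 1); rewrite Z.add_opp_diag_r, ez_0 in e.
  rewrite <- (Z2Nat.id (- m)), h in e by lia; rewrite e; ring.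
Qed.

Lemma ez_at_0 (m : Z) : ez m 0 = 1.
Proof. unfold ez; rewrite Rmult_0_r, cos_0, sin_0; reflexivity. Qed.

Lemma ez_add_t (m : Z) (t h : R) : ez m (t + h) = (ez m t * ez m h)%C.
Proof.
unfold ez, Cmult; simpl.
replace (2 * PI * IZR m * (t + h)) with (2 * PI * IZR m * t + 2 * PI * IZR m * h) by ring.
rewrite cos_plus, sin_plus; f_equal; ring.
Qed.

Lemma is_fourier_coef (f : R -> C) (m : Z) : C_cont f ->
  is_RInt (V := C_R_NormedModule) (fun t => f t * ez (- m) t)%C 0 1 (fourier_coef f m).
Proof.
intros hf.
replace (fourier_coef f m) with (RInt (V := C_R_CompleteNormedModule) (fun t => f t * ez (- m) t)%C 0 1).
- apply (RInt_correct (V := C_R_CompleteNormedModule)).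
  apply (ex_RInt_continuous (V := C_R_CompleteNormedModule)); intros t _.
  apply (C_cont_mult f (ez (- m)) hf (ez_cont (- m))).
- unfold fourier_coef; f_equal; apply functional_extensionality; intros t.
  unfold ez; rewrite opp_IZR.
  replace (2 * PI * - IZR m * t) with (- (2 * PI * IZR m * t)) by ring.
  rewrite cos_neg, sin_neg; reflexivity.
Qed.

Lemma fourier_coef_unique (f : R -> C) (m : Z) (c : C) : C_cont f ->
  is_RInt (V := C_R_NormedModule) (fun t => f t * ez (- m) t)%C 0 1 c -> fourier_coef f m = c.
Proof.
intros hf hc; assert (h := is_fourier_coef f m hf).
apply (filterlim_locally_unique (V := C_R_NormedModule) _ _ _ h hc).
Qed.

Lemma fourier_coef_le (f : R -> C) (m : Z) (K : R) : C_cont f ->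
  (forall t, 0 <= t <= 1 -> Cmod (f t) <= K) -> Cmod (fourier_coef f m) <= K.
Proof.
intros hf H; apply (is_RInt_C_le (fun t => f t * ez (- m) t)%C); [|apply is_fourier_coef, hf].
intros t ht; rewrite Cmod_mult, ez_mod, Rmult_1_r; apply H, ht.
Qed.

Lemma is_RInt_Cder (f f' : R -> C) : (forall t, is_Cder f t (f' t)) -> C_cont f' ->
  is_RInt (V := C_R_NormedModule) f' 0 1 (f 1 - f 0)%C.
Proof.
intros H hc.
apply (is_RInt_fct_extend_pair (U := R_NormedModule) (V := R_NormedModule) f' 0 1).
- apply (is_RInt_derive (V := R_CompleteNormedModule) (fun t => Re (f t)) (fun t => Re (f' t)));
    intros t _; [apply H|apply C_cont_Re, hc].
- apply (is_RInt_derive (V := R_CompleteNormedModule) (fun t => Im (f t)) (fun t => Im (f' t)));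
    intros t _; [apply H|apply C_cont_Im, hc].
Qed.

(** Integrate the derivative of [f * ez (- m)] over a period; the boundary terms cancel. *)
Lemma fourier_coef_der (f f' : R -> C) (m : Z) :
  (forall t, is_Cder f t (f' t)) -> C_cont f' -> f 0 = f 1 ->
  fourier_coef f' m = (freq m * fourier_coef f m)%C.
Proof.
intros H hc hp.
assert (hf := is_Cder_cont _ _ H).
apply fourier_coef_unique; [exact hc|].
assert (h1 : is_RInt (V := C_R_NormedModule)
  (fun t => f' t * ez (- m) t + f t * (freq (- m) * ez (- m) t))%C 0 1 (RtoC 0)).
{ replace (RtoC 0) with (f 1 * ez (- m) 1 - f 0 * ez (- m) 0)%C
    by (rewrite hp, ez_1, ez_at_0; ring).
  apply (is_RInt_Cder (fun t => f t * ez (- m) t)%C).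
  - intros t; apply is_Cder_mult; [apply H|apply ez_der].
  - intros t; apply (continuous_plus (V := C_R_NormedModule)
      (fun t => f' t * ez (- m) t)%C (fun t => f t * (freq (- m) * ez (- m) t))%C).
    + apply (C_cont_mult f' (ez (- m)) hc (ez_cont _)).
    + apply (C_cont_mult f (fun t => freq (- m) * ez (- m) t)%C hf).
      apply (C_cont_mult (fun _ => freq (- m)) (ez (- m))); [intros x; apply continuous_const|apply ez_cont]. }
assert (h2 := is_RInt_Cmul (freq m) _ _ _ _ (is_fourier_coef f m hf)).
assert (h3 := is_RInt_plus (V := C_R_NormedModule) _ _ _ _ _ _ h1 h2).
replace (freq m * fourier_coef f m)%C with (plus (RtoC 0 : C_R_NormedModule) (freq m * fourier_coef f m)%C)
  by (change (0 + freq m * fourier_coef f m = freq m * fourier_coef f m)%C; ring).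
revert h3; apply is_RInt_ext; intros t _.
change (f' t * ez (- m) t + f t * (freq (- m) * ez (- m) t) + freq m * (f t * ez (- m) t) = f' t * ez (- m) t)%C.
replace (freq (- m)) with (- freq m)%C; [ring|].
unfold freq; rewrite opp_IZR; unfold Copp; simpl; f_equal; ring.
Qed.

Lemma freq_mod (m : Z) : Cmod (freq m) = 2 * PI * IZR (Z.abs m).
Proof.
unfold freq, Cmod; simpl; rewrite Rmult_0_l, Rplus_0_l, Rmult_1_r.
fold (Rsqr (2 * PI * IZR m)); rewrite sqrt_Rsqr_abs, Rabs_mult, abs_IZR.
rewrite Rabs_pos_eq; [reflexivity|assert (h := PI_RGT_0); lra].
Qed.

(** For [m <> 0] the derivative rule for a constant says that [freq m] times the coefficient is
    0. *)
Lemma fourier_coef_one (m : Z) : fourier_coef (fun _ => RtoC 1) m = if Z.eq_dec m 0 then RtoC 1 else RtoC 0.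
Proof.
assert (hc : forall c : C, C_cont (fun _ => c)) by (intros c t; apply continuous_const).
destruct (Z.eq_dec m 0) as [->|h].
- apply fourier_coef_unique; [apply hc|].
  apply (is_RInt_ext (fun _ => RtoC 1)).
  + intros t _; change (- 0)%Z with 0%Z; rewrite ez_0; symmetry; apply Cmult_1_l.
  + assert (h := is_RInt_const (V := C_R_NormedModule) 0 1 (RtoC 1 : C_R_NormedModule)).
    assert (e : scal (1 - 0) (RtoC 1 : C_R_NormedModule) = RtoC 1)
      by (rewrite Rminus_0_r; apply (scal_one (V := C_R_NormedModule))).
    rewrite e in h; exact h.
- assert (e := fourier_coef_der (fun _ => RtoC 1) (fun _ => RtoC 0) m (is_Cder_const 1) (hc _) eq_refl).
  assert (e0 : fourier_coef (fun _ => RtoC 0) m = 0).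
  { apply Cmod_eq_0, Rle_antisym; [|apply Cmod_ge_0].
    apply fourier_coef_le; [apply hc|]; intros; rewrite Cmod_0; lra. }
  rewrite e0 in e; symmetry in e.
  apply (f_equal Cmod) in e; rewrite Cmod_mult, Cmod_0, freq_mod in e.
  apply Rmult_integral in e; destruct e as [e|e]; [|apply Cmod_eq_0, e].
  apply Rmult_integral in e; destruct e as [e|e]; [assert (hpi := PI_RGT_0); lra|].
  apply eq_IZR in e; lia.
Qed.

Lemma minus_plus_r {G : AbelianGroup} (x y z : G) : minus x (plus y z) = minus (minus x y) z.
Proof.
change (plus x (opp (plus y z)) = plus (plus x (opp y)) (opp z)).
rewrite opp_plus; apply plus_assoc.
Qed.

Lemma is_series_tail_le {K : AbsRing} {V : NormedModule K} (u : nat -> V) (l : V) (w : nat -> R) (N : nat) :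
  (forall k, norm (u k) <= w k) -> ex_series w -> is_series u l ->
  norm (minus (sum_n u N) l) <= Series w - sum_n w N.
Proof.
intros H He Hl.
assert (h1 : forall M, norm (minus (sum_n u N) (sum_n u (N + M))) <= sum_n w (N + M) - sum_n w N).
{ induction M as [|M IH].
  - rewrite Nat.add_0_r, minus_eq_zero; eapply Rle_trans; [right; apply (norm_zero (V := V))|lra].
  - rewrite Nat.add_succ_r, !sum_Sn.
    replace (minus (sum_n u N) (plus (sum_n u (N + M)) (u (S (N + M)))))
      with (minus (minus (sum_n u N) (sum_n u (N + M))) (u (S (N + M)))).
    + eapply Rle_trans; [apply norm_triangle|]; rewrite norm_opp; specialize (H (S (N + M))).
      change (plus (sum_n w (N + M)) (w (S (N + M)))) with (sum_n w (N + M) + w (S (N + M))); lra.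
    + symmetry; apply (minus_plus_r (G := NormedModule.AbelianGroup K V)). }
assert (hw : forall k, 0 <= w k) by (intros k; apply Rle_trans with (norm (u k)); [apply norm_ge_0|apply H]).
apply (norm_lim_le (fun M => minus (sum_n u N) (sum_n u (N + M)))).
- intros M; eapply Rle_trans; [apply h1|]; assert (h := sum_n_le_Series w (N + M) hw He); lra.
- apply (filterlim_comp_2 (G := locally (sum_n u N)) (H := locally (opp l))
    (fun _ => sum_n u N) (fun M => opp (sum_n u (N + M))) plus).
  + apply filterlim_const.
  + eapply filterlim_comp; [|apply filterlim_opp].
    intros P HP; destruct (Hl P HP) as [M0 HM]; exists M0; intros M hM; apply HM; lia.
  + apply filterlim_plus.
Qed.

(** The majorant [w] makes the partial sums converge uniformly in [t], so sum and integral may be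
    exchanged. *)
Lemma is_RInt_series_nat (f : nat -> R -> C) (J : nat -> C) (g : R -> C) (w : nat -> R) :
  (forall n, is_RInt (V := C_R_NormedModule) (f n) 0 1 (J n)) ->
  (forall n t, Cmod (f n t) <= w n) -> ex_series w ->
  (forall t, is_series (V := C_NormedModule) (fun n => f n t) (g t)) ->
  exists I, is_RInt (V := C_R_NormedModule) g 0 1 I /\ is_series (V := C_NormedModule) J I.
Proof.
intros hJ hw He hg.
destruct (filterlim_RInt (V := C_R_CompleteNormedModule)
  (fun N t => sum_n (G := C_AbelianMonoid) (fun n => f n t) N) 0 1 eventually _ g
  (sum_n (G := C_AbelianMonoid) J)) as [I [h1 h2]].
- induction x as [|N IH].
  + apply (is_RInt_ext (f 0%nat)); [intros t _; rewrite sum_O; reflexivity|].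
    rewrite sum_O; apply hJ.
  + rewrite sum_Sn.
    apply (is_RInt_ext (V := C_R_NormedModule)
      (fun t => plus (sum_n (G := C_AbelianMonoid) (fun n => f n t) N : C_R_NormedModule) (f (S N) t))).
    * intros t _; rewrite sum_Sn; reflexivity.
    * apply (is_RInt_plus (V := C_R_NormedModule) _ _ _ _ _ _ IH (hJ (S N))).
- apply filterlim_locally; intros eps.
  assert (Hs := Series_correct w He).
  destruct (proj1 (filterlim_locally (sum_n w) (Series w)) Hs eps) as [N HN].
  exists N; intros n hn t; specialize (HN n hn).
  assert (h := is_series_tail_le (V := C_NormedModule) (fun k => f k t) (g t) w n
    (fun k => hw k t) He (hg t)).
  change (Rabs (sum_n w n - Series w) < eps) in HN.
  assert (h' : Cmod (minus (sum_n (G := C_AbelianMonoid) (fun k => f k t) n) (g t)) < eps).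
  { eapply Rle_lt_trans; [exact h|]; eapply Rle_lt_trans; [|exact HN].
    rewrite Rabs_minus_sym; apply Rle_abs. }
  exact (C_ball_Cmod _ _ _ h').
- exists I; split; [exact h2|exact h1].
Qed.

Lemma is_RInt_zseries (f : Z -> R -> C) (J : Z -> C) (g : R -> C) (K : R) :
  (forall n, is_RInt (V := C_R_NormedModule) (f n) 0 1 (J n)) ->
  (forall n t, Cmod (f n t) <= K * wt n) ->
  (forall t, is_zseries (V := C_NormedModule) (fun n => f n t) (g t)) ->
  exists I, is_RInt (V := C_R_NormedModule) g 0 1 I /\ is_zseries (V := C_NormedModule) J I.
Proof.
intros hJ hw hg; destruct ex_zseries_wt as [e1 e2].
destruct (ex_choice _ hg) as [p hp]; destruct (ex_choice _ hp) as [q hq].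
destruct (is_RInt_series_nat (fun n => f (Z.of_nat n)) (fun n => J (Z.of_nat n)) p
  (fun n => K * wt (Z.of_nat n))) as [I1 [a1 b1]].
{ intros n; apply hJ. } { intros n t; apply hw. } { exact (ex_series_scal K _ e1). } { apply hq. }
destruct (is_RInt_series_nat (fun n => f (- Z.of_nat n - 1)%Z) (fun n => J (- Z.of_nat n - 1)%Z) q
  (fun n => K * wt (- Z.of_nat n - 1)%Z)) as [I2 [a2 b2]].
{ intros n; apply hJ. } { intros n t; apply hw. } { exact (ex_series_scal K _ e2). } { apply hq. }
exists (I1 + I2)%C; split.
- assert (h := is_RInt_plus (V := C_R_NormedModule) _ _ _ _ _ _ a1 a2).
  revert h; apply is_RInt_ext; intros t _; symmetry; apply hq.
- exists I1, I2; split; [exact b1|split; [exact b2|reflexivity]].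
Qed.

(** * Functions with prescribed Fourier coefficients *)

Definition Phi (u : Z -> C) (t : R) : C :=
  epsilon (inhabits (RtoC 0)) (is_zseries (V := C_NormedModule) (fun m => u m * ez m t)%C).

Lemma Phi_spec (u : Z -> C) (c : R) (t : R) : rdecay 2 u c ->
  is_zseries (V := C_NormedModule) (fun m => u m * ez m t)%C (Phi u t).
Proof.
intros H; unfold Phi; apply epsilon_spec.
apply (ex_zseries_C _ c); intros m; rewrite Cmod_mult, ez_mod, Rmult_1_r; apply rdecay_wt, H.
Qed.

Lemma Phi_le (u : Z -> C) (c : R) (t : R) : rdecay 2 u c -> Cmod (Phi u t) <= c * wtot.
Proof.
intros H; apply (is_zseries_norm_le (V := C_NormedModule) (fun m => u m * ez m t)%C (Phi u t) c);
  [|apply (Phi_spec u c t H)].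
intros m; change (Cmod (u m * ez m t) <= c * wt m); rewrite Cmod_mult, ez_mod, Rmult_1_r.
apply rdecay_wt, H.
Qed.

Lemma Phi_periodic (u : Z -> C) (t : R) : Phi u (t + 1) = Phi u t.
Proof.
unfold Phi; f_equal; f_equal; apply functional_extensionality; intros m.
rewrite ez_add_t, ez_1; ring.
Qed.

Lemma MVT_abs (f f' : R -> R) (x : R) (K : R) : 0 <= K ->
  (forall t, is_derive f t (f' t)) -> (forall t, Rabs t <= Rabs x -> Rabs (f' t) <= K) ->
  f 0 = 0 -> Rabs (f x) <= K * Rabs x.
Proof.
intros hK hd hb h0.
destruct (MVT_gen f 0 x f') as [c [hc e]].
- intros t _; apply hd.
- intros t _; apply derivable_continuous_pt; exists (f' t); apply is_derive_Reals, hd.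
- rewrite h0, !Rminus_0_r in e; rewrite e, Rabs_mult.
  apply Rmult_le_compat_r; [apply Rabs_pos|]; apply hb.
  unfold Rmin, Rmax in hc; destruct (Rle_dec 0 x); unfold Rabs; repeat destruct Rcase_abs; lra.
Qed.

Lemma sin_abs_le (x : R) : Rabs (sin x) <= Rabs x.
Proof.
rewrite <- (Rmult_1_l (Rabs x)); apply (MVT_abs sin cos); [lra| | |apply sin_0].
- intros t; apply is_derive_sin.
- intros t _; apply Rabs_le; apply COS_bound.
Qed.

Lemma cos_m1_abs_le (x : R) : Rabs (cos x - 1) <= Rabs x * Rabs x.
Proof.
apply (MVT_abs (fun x => cos x - 1) (fun x => - sin x)); [apply Rabs_pos| | |rewrite cos_0; ring].
- intros t; auto_derive; trivial; ring.
- intros t ht; rewrite Rabs_Ropp; eapply Rle_trans; [apply sin_abs_le|exact ht].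
Qed.

Lemma cos_m1_abs_le1 (x : R) : Rabs (cos x - 1) <= Rabs x.
Proof.
rewrite <- (Rmult_1_l (Rabs x)).
apply (MVT_abs (fun x => cos x - 1) (fun x => - sin x)); [lra| | |rewrite cos_0; ring].
- intros t; auto_derive; trivial; ring.
- intros t ht; rewrite Rabs_Ropp; apply Rabs_le, SIN_bound.
Qed.

Lemma sin_mx_abs_le (x : R) : Rabs (sin x - x) <= Rabs x * Rabs x.
Proof.
apply (MVT_abs (fun x => sin x - x) (fun x => cos x - 1)); [apply Rabs_pos| | |rewrite sin_0; ring].
- intros t; auto_derive; trivial; ring.
- intros t ht; eapply Rle_trans; [apply cos_m1_abs_le1|exact ht].
Qed.

(** With [x = 2 * PI * m * h], real and imaginary parts of the error at 0 are each at most [x ^ 2],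
    hence at most [4 * PI ^ 2 * br m ^ 2 * h ^ 2]. *)
Lemma ez_taylor (m : Z) (t h : R) :
  Cmod (ez m (t + h) - ez m t - h * (freq m * ez m t)) <= 8 * PI ^ 2 * br m ^ 2 * h ^ 2.
Proof.
rewrite ez_add_t.
replace (ez m t * ez m h - ez m t - h * (freq m * ez m t))%C
  with (ez m t * (ez m h - 1 - h * freq m))%C by ring.
rewrite Cmod_mult, ez_mod, Rmult_1_l.
eapply Rle_trans; [apply Cmod_le_add|].
set (x := 2 * PI * IZR m * h).
replace (Re (ez m h - 1 - h * freq m)%C) with (cos x - 1) by (unfold ez, freq, x, Re; simpl; ring).
replace (Im (ez m h - 1 - h * freq m)%C) with (sin x - x) by (unfold ez, freq, x, Im; simpl; ring).
assert (h1 := cos_m1_abs_le x); assert (h2 := sin_mx_abs_le x).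
assert (h3 : Rabs x * Rabs x <= 4 * PI ^ 2 * br m ^ 2 * h ^ 2); [|lra].
rewrite <- Rabs_mult, Rabs_pos_eq by apply Rle_0_sqr.
replace (x * x) with (4 * PI ^ 2 * h ^ 2 * IZR m ^ 2) by (unfold x; ring).
replace (4 * PI ^ 2 * br m ^ 2 * h ^ 2) with (4 * PI ^ 2 * h ^ 2 * br m ^ 2) by ring.
apply Rmult_le_compat_l.
- apply Rmult_le_pos; [|apply pow2_ge_0]; apply Rmult_le_pos; [lra|apply pow2_ge_0].
- rewrite <- pow2_abs, <- abs_IZR; apply pow_incr; split; [apply IZR_le, Z.abs_nonneg|unfold br; lra].
Qed.

Lemma is_derive_quadratic (f : R -> R) (t l K : R) :
  (forall h, Rabs (f (t + h) - f t - h * l) <= K * h ^ 2) -> is_derive f t l.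
Proof.
intros H; apply is_derive_Reals; intros eps he.
assert (hK : 0 <= K).
{ specialize (H 1); assert (h := Rabs_pos (f (t + 1) - f t - 1 * l)); lra. }
assert (hd : 0 < eps / (K + 1)) by (apply Rdiv_lt_0_compat; lra).
exists (mkposreal _ hd); intros h hn hh; simpl in hh.
replace ((f (t + h) - f t) / h - l) with ((f (t + h) - f t - h * l) / h) by (field; exact hn).
unfold Rdiv; rewrite Rabs_mult, Rabs_inv.
assert (hp : 0 < Rabs h) by (apply Rabs_pos_lt, hn).
specialize (H h); rewrite <- (pow2_abs h) in H.
apply Rle_lt_trans with (K * Rabs h).
- apply (Rmult_le_reg_r (Rabs h)); [exact hp|].
  rewrite Rmult_assoc, Rinv_l by lra; simpl in H; lra.
- apply Rle_lt_trans with (K * (eps / (K + 1))); [apply Rmult_le_compat_l; lra|].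
  apply (Rmult_lt_reg_r (K + 1)); [lra|].
  replace (K * (eps / (K + 1)) * (K + 1)) with (K * eps) by (field; lra); nra.
Qed.

Definition dcoef (u : Z -> C) (m : Z) : C := (freq m * u m)%C.

Lemma rdecay_dcoef (N : nat) (u : Z -> C) (c : R) : rdecay (S N) u c -> rdecay N (dcoef u) (2 * PI * c).
Proof.
intros H m; specialize (H m); unfold dcoef; rewrite Cmod_mult, freq_mod.
assert (h1 : IZR (Z.abs m) <= br m) by (unfold br; lra).
assert (hpi := PI_RGT_0); assert (h0 := Cmod_ge_0 (u m)); assert (h2 := br_pow_pos m N).
apply Rle_trans with (br m ^ N * (2 * PI * br m * Cmod (u m))).
- apply Rmult_le_compat_l; [lra|]; apply Rmult_le_compat_r; [exact h0|].
  apply Rmult_le_compat_l; lra.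
- replace (br m ^ N * (2 * PI * br m * Cmod (u m))) with (2 * PI * (br m ^ S N * Cmod (u m))) by (simpl; ring).
  apply Rmult_le_compat_l; lra.
Qed.

(** The quadratic Taylor errors of the single terms are summed. Two of the four powers of decay
    absorb the factor [br m ^ 2] of [ez_taylor], the other two make the sum converge. *)
Lemma Phi_der (u : Z -> C) (c : R) (t : R) : rdecay 4 u c -> is_Cder (Phi u) t (Phi (dcoef u) t).
Proof.
intros hu.
assert (hu2 : rdecay 2 u c) by (apply (rdecay_le 2 4); [lia|exact hu]).
assert (hd : rdecay 2 (dcoef u) (2 * PI * c)) by (apply (rdecay_le 2 3); [lia|apply rdecay_dcoef, hu]).
assert (Q : forall h, Cmod (Phi u (t + h) - Phi u t - h * Phi (dcoef u) t) <= 8 * PI ^ 2 * c * wtot * h ^ 2).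
{ intros h.
  assert (S1 := Phi_spec u c (t + h) hu2).
  assert (S2 := is_zseries_minus _ _ _ _ S1 (Phi_spec u c t hu2)).
  assert (S4 := is_zseries_plus _ _ _ _ S2 (is_zseries_Cmul (- RtoC h)%C _ _ (Phi_spec _ _ t hd))).
  replace (8 * PI ^ 2 * c * wtot * h ^ 2) with (8 * PI ^ 2 * c * h ^ 2 * wtot) by ring.
  replace (Phi u (t + h) - Phi u t - h * Phi (dcoef u) t)%C
    with (Phi u (t + h) + - Phi u t + - h * Phi (dcoef u) t)%C by ring.
  apply (is_zseries_norm_le (V := C_NormedModule)) with (2 := S4); intros m.
  change (Cmod (u m * ez m (t + h) + - (u m * ez m t) + - h * (freq m * u m * ez m t))
    <= 8 * PI ^ 2 * c * h ^ 2 * wt m).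
  replace (u m * ez m (t + h) + - (u m * ez m t) + - h * (freq m * u m * ez m t))%C
    with (u m * (ez m (t + h) - ez m t - h * (freq m * ez m t)))%C by ring.
  rewrite Cmod_mult; assert (h1 := ez_taylor m t h); assert (h0 := Cmod_ge_0 (u m)).
  eapply Rle_trans; [apply Rmult_le_compat_l; [exact h0|exact h1]|].
  assert (h2 := mult_wt m 2 _ _ (hu m)).
  replace (Cmod (u m) * (8 * PI ^ 2 * br m ^ 2 * h ^ 2))
    with (8 * PI ^ 2 * h ^ 2 * (br m ^ 2 * Cmod (u m))) by ring.
  replace (8 * PI ^ 2 * c * h ^ 2 * wt m) with (8 * PI ^ 2 * h ^ 2 * (c * wt m)) by ring.
  apply Rmult_le_compat_l; [|exact h2].
  apply Rmult_le_pos; [|apply pow2_ge_0]; apply Rmult_le_pos; [lra|apply pow2_ge_0]. }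
split; apply is_derive_quadratic with (8 * PI ^ 2 * c * wtot); intros h.
- eapply Rle_trans; [|apply Q]; eapply Rle_trans; [|apply Re_le_Cmod]; right; f_equal; unfold Re; simpl; ring.
- eapply Rle_trans; [|apply Q]; eapply Rle_trans; [|apply Im_le_Cmod]; right; f_equal; unfold Im; simpl; ring.
Qed.

Definition rapid (u : Z -> C) : Prop := forall N, exists c, rdecay N u c.

Lemma rapid_dcoef (u : Z -> C) : rapid u -> rapid (dcoef u).
Proof. intros H N; destruct (H (S N)) as [c hc]; eexists; apply rdecay_dcoef, hc. Qed.

Lemma Phi_cont (u : Z -> C) : rapid u -> C_cont (Phi u).
Proof.
intros H; destruct (H 4%nat) as [c hc].
apply (is_Cder_cont _ (Phi (dcoef u))); intros t; apply (Phi_der u c t hc).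
Qed.

(** Every derivative is again a [Phi], for the coefficients multiplied once more by the
    frequencies. *)
Lemma Phi_smooth (u : Z -> C) : rapid u -> smooth_periodic (Phi u).
Proof.
intros hu; split; [apply Phi_periodic|].
assert (hit : forall n, rapid (Nat.iter n dcoef u)).
{ induction n as [|n IH]; [exact hu|apply rapid_dcoef, IH]. }
assert (hder : forall n t, is_Cder (Phi (Nat.iter n dcoef u)) t (Phi (Nat.iter (S n) dcoef u) t)).
{ intros n t; destruct (hit n 4%nat) as [c hc]; apply (Phi_der _ c t hc). }
assert (hD : forall n t, Derive_n (fun x => Re (Phi u x)) n t = Re (Phi (Nat.iter n dcoef u) t) /\
  Derive_n (fun x => Im (Phi u x)) n t = Im (Phi (Nat.iter n dcoef u) t)).
{ induction n as [|n IH]; intros t; [split; reflexivity|]; simpl Derive_n; split.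
  - rewrite (Derive_ext _ (fun x => Re (Phi (Nat.iter n dcoef u) x))) by (intros; apply IH).
    apply is_derive_unique, hder.
  - rewrite (Derive_ext _ (fun x => Im (Phi (Nat.iter n dcoef u) x))) by (intros; apply IH).
    apply is_derive_unique, hder. }
intros [|n] t; [split; exact I|]; split.
- apply (ex_derive_ext (fun x => Re (Phi (Nat.iter n dcoef u) x))); [intros x; symmetry; apply hD|].
  exists (Re (Phi (Nat.iter (S n) dcoef u) t)); exact (proj1 (hder n t)).
- apply (ex_derive_ext (fun x => Im (Phi (Nat.iter n dcoef u) x))); [intros x; symmetry; apply hD|].
  exists (Im (Phi (Nat.iter (S n) dcoef u) t)); exact (proj2 (hder n t)).
Qed.

(** The convolution formula, by termwise integration of the series for [Phi u] alone; nothing is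
    asked of the Fourier series of [h]. *)
Lemma fourier_coef_mult_Phi (u : Z -> C) (h : R -> C) (K : R) (m : Z) : rapid u -> C_cont h ->
  (forall t, Cmod (h t) <= K) ->
  is_zseries (V := C_NormedModule) (fun n => u n * fourier_coef h (m - n))%C
    (fourier_coef (fun t => Phi u t * h t)%C m).
Proof.
intros hu hc hK; destruct (hu 2%nat) as [c hc2].
destruct (is_RInt_zseries (fun n t => u n * (h t * ez (- (m - n)) t))%C
  (fun n => u n * fourier_coef h (m - n))%C (fun t => Phi u t * h t * ez (- m) t)%C (c * K)) as [I [h1 h2]].
- intros n; apply is_RInt_Cmul, is_fourier_coef, hc.
- intros n t; rewrite !Cmod_mult, ez_mod, Rmult_1_r.
  replace (c * K * wt n) with (c * wt n * K) by ring.
  apply Rmult_le_compat; try apply Cmod_ge_0; [apply rdecay_wt, hc2|apply hK].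
- intros t.
  assert (S := is_zseries_Cmul (h t * ez (- m) t)%C _ _ (Phi_spec _ _ t hc2)).
  replace (Phi u t * h t * ez (- m) t)%C with (h t * ez (- m) t * Phi u t)%C by ring.
  revert S; apply is_zseries_ext; intros n.
  change (h t * ez (- m) t * (u n * ez n t) = u n * (h t * ez (- (m - n)) t))%C.
  replace (- (m - n))%Z with (- m + n)%Z by lia; rewrite ez_add; ring.
- rewrite (fourier_coef_unique (fun t => Phi u t * h t)%C m I); [exact h2| |exact h1].
  apply C_cont_mult; [apply Phi_cont, hu|exact hc].
Qed.

(** The convolution formula for [h = 1]. *)
Lemma fourier_coef_Phi (u : Z -> C) (m : Z) : rapid u -> fourier_coef (Phi u) m = u m.
Proof.
intros hu.
assert (h := fourier_coef_mult_Phi u (fun _ => RtoC 1) 1 m hu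
  (fun t => continuous_const _ _) (fun t => Req_le _ _ Cmod_1)).
cbv beta in h; replace (fun t => Phi u t * 1)%C with (Phi u) in h
  by (apply functional_extensionality; intros t; symmetry; apply Cmult_1_r).
apply (is_zseries_unique (V := C_NormedModule) _ _ _ h).
assert (h' := is_zseries_single (V := C_NormedModule) (fun n => u n * fourier_coef (fun _ => RtoC 1) (m - n))%C m).
cbv beta in h'; rewrite Z.sub_diag in h'.
replace (u m) with (u m * fourier_coef (fun _ => RtoC 1) 0)%C; [apply h'|].
- intros n hn; rewrite fourier_coef_one; destruct (Z.eq_dec (m - n) 0); [lia|apply Cmult_0_r].
- rewrite fourier_coef_one; apply Cmult_1_r.
Qed.

(** The two halves of a series are summed separately, so the substitution needs an argument: [n + 1]
    for [n] carries one term across, [-1 - n] for [n] exchanges the halves, and these two generate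
    all reflections. *)
Lemma is_zseries_reflect (u : Z -> C) (l : C) (m : Z) :
  is_zseries (V := C_NormedModule) u l -> is_zseries (V := C_NormedModule) (fun n => u (m - n)%Z) l.
Proof.
assert (R1 : forall x y : C, x = (x - y + y)%C) by (intros; ring).
assert (R2 : forall x y : C, x = (x + y + - y)%C) by (intros; ring).
assert (R3 : forall x y z : C, (x + y)%C = (x - z + (y + z))%C) by (intros; ring).
assert (H1 : forall u : Z -> C, is_zseries (V := C_NormedModule) u l ->
  is_zseries (V := C_NormedModule) (fun n => u (n + 1)%Z) l).
{ clear u; intros u [p [q [hp [hq e]]]]; exists (p - u 0%Z)%C, (q + u 0%Z)%C; split; [|split].
  - apply (is_series_ext (fun n => u (Z.of_nat (S n)))); [intros n; f_equal; lia|].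
    exact (is_series_incr_1 (V := C_NormedModule) (fun n => u (Z.of_nat n)) (p - u 0%Z)%C
      (eq_ind p (fun x : C => is_series (V := C_NormedModule) (fun n => u (Z.of_nat n)) x)
        hp _ (R1 p (u 0%Z)))).
  - apply (is_series_decr_1 (V := C_NormedModule)).
    apply (is_series_ext (fun n => u (- Z.of_nat n - 1)%Z)); [intros n; f_equal; lia|].
    exact (eq_ind q (fun x : C => is_series (V := C_NormedModule) (fun n => u (- Z.of_nat n - 1)%Z) x)
        hq _ (R2 q (u 0%Z))).
  - rewrite e; exact (R3 p q (u 0%Z)). }
assert (H2 : forall u : Z -> C, is_zseries (V := C_NormedModule) u l ->
  is_zseries (V := C_NormedModule) (fun n => u (-1 - n)%Z) l).
{ clear u; intros u [p [q [hp [hq e]]]]; exists q, p; split; [|split].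
  - revert hq; apply is_series_ext; intros n; f_equal; lia.
  - revert hp; apply is_series_ext; intros n; f_equal; lia.
  - rewrite e; apply plus_comm. }
assert (H3 : forall k : nat, forall u : Z -> C, is_zseries (V := C_NormedModule) u l ->
  is_zseries (V := C_NormedModule) (fun n => u (n + Z.of_nat k)%Z) l).
{ induction k as [|k IH]; intros u0 h.
  - revert h; apply is_zseries_ext; intros n; f_equal; lia.
  - apply H1 in h; apply IH in h; revert h; apply is_zseries_ext; intros n; f_equal; lia. }
intros h; destruct (Z_le_gt_dec (m + 1) 0) as [hm|hm].
- apply H2 in h; apply (H3 (Z.to_nat (- (m + 1)))) in h.
  revert h; apply is_zseries_ext; intros n; f_equal; lia.
- apply (H3 (Z.to_nat (m + 1))) in h; apply H2 in h.
  revert h; apply is_zseries_ext; intros n; f_equal; lia.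
Qed.

(** * Uniformly bounded families of smooth functions *)

(** A family of functions with [n] continuous derivatives, all agreeing at 0 and 1 and bounded
    uniformly in the index. Uniformity yields Fourier decay with one constant for the whole
    family. *)
Fixpoint UC {I : Type} (n : nat) (f : I -> R -> C) : Prop :=
  (forall i, f i 0 = f i 1) /\ (forall i, C_cont (f i)) /\
  (exists K, forall i t, 0 <= t <= 1 -> Cmod (f i t) <= K) /\
  match n with
  | O => True
  | S n => exists f', (forall i t, is_Cder (f i) t (f' i t)) /\ UC n f'
  end.

Lemma UC_pred {I : Type} (n : nat) (f : I -> R -> C) : UC (S n) f -> UC n f.
Proof.
revert f; induction n as [|n IH]; intros f [h1 [h2 [h3 h4]]]; split; auto; split; auto; split; auto.
destruct h4 as [f' [ha hb]]; exists f'; auto.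
Qed.

Lemma UC_plus {I : Type} (n : nat) (f g : I -> R -> C) :
  UC n f -> UC n g -> UC n (fun i t => f i t + g i t)%C.
Proof.
revert f g; induction n as [|n IH]; intros f g [h1 [h2 [[K h3] h4]]] [k1 [k2 [[K' k3] k4]]];
  (split; [|split; [|split]]).
1, 5: intros i; rewrite h1, k1; reflexivity.
1, 4: intros i t; apply (continuous_plus (V := C_R_NormedModule) (f i) (g i)); [apply h2|apply k2].
1, 3: exists (K + K'); intros i t ht; eapply Rle_trans; [apply Cmod_triangle|];
  specialize (h3 i t ht); specialize (k3 i t ht); lra.
- exact Logic.I.
- destruct h4 as [f' [ha hb]], k4 as [g' [ka kb]].
  exists (fun i t => f' i t + g' i t)%C; split; [|apply IH; assumption].
  intros i t; apply is_Cder_plus; auto.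
Qed.

Lemma UC_mult {I : Type} (n : nat) (f g : I -> R -> C) :
  UC n f -> UC n g -> UC n (fun i t => f i t * g i t)%C.
Proof.
revert f g; induction n as [|n IH]; intros f g hf hg;
  assert (hf' := hf); assert (hg' := hg);
  destruct hf as [h1 [h2 [[K h3] h4]]], hg as [k1 [k2 [[K' k3] k4]]];
  (split; [|split; [|split]]).
1, 5: intros i; rewrite h1, k1; reflexivity.
1, 4: intros i; apply C_cont_mult; [apply h2|apply k2].
1, 3: exists (K * K'); intros i t ht; rewrite Cmod_mult;
  apply Rmult_le_compat; try apply Cmod_ge_0; auto.
- exact Logic.I.
- destruct h4 as [f' [ha hb]], k4 as [g' [ka kb]].
  exists (fun i t => f' i t * g i t + f i t * g' i t)%C; split.
  + intros i t; apply is_Cder_mult; auto.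
  + apply UC_plus; apply IH; auto; apply UC_pred; assumption.
Qed.

Lemma UC_const {I : Type} (n : nat) (c : I -> C) (K : R) :
  (forall i, Cmod (c i) <= K) -> UC n (fun i _ => c i).
Proof.
revert c K; induction n as [|n IH]; intros c K H; (split; [|split; [|split]]).
1, 5: reflexivity.
1, 4: intros i t; apply continuous_const.
1, 3: exists K; auto.
- exact Logic.I.
- exists (fun _ _ => RtoC 0); split; [intros; apply is_Cder_const|].
  apply (IH (fun _ => RtoC 0) 0); intros; rewrite Cmod_0; lra.
Qed.

(** Induction through [(1 / f)' = - f' / f ^ 2]: the right side involves [1 / f] only to the lower
    order. The bound [d] controls all reciprocals at once. *)
Lemma UC_inv {I : Type} (n : nat) (f : I -> R -> C) (d : R) : 0 < d ->
  (forall i t, d <= Cmod (f i t)) -> UC n f -> UC n (fun i t => / f i t)%C.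
Proof.
intros hd hf.
assert (hn : forall i t, f i t <> 0).
{ intros i t e; specialize (hf i t); rewrite e, Cmod_0 in hf; lra. }
assert (hb : forall i t, Cmod (/ f i t)%C <= / d).
{ intros i t; rewrite Cmod_inv by apply hn; apply Rinv_le_contravar; auto. }
assert (hc := fun i => C_cont_inv (f i) (hn i)).
revert hc; induction n as [|n IH]; intros hc hU; assert (hU' := hU); destruct hU as [h1 [h2 [h3 h4]]];
  (split; [|split; [|split]]).
1, 5: intros i; rewrite h1; reflexivity.
1, 4: intros i; apply hc, h2.
1, 3: exists (/ d); auto.
- exact Logic.I.
- destruct h4 as [f' [ha hb']].
  (* The sign is written as a constant factor so that closure under products applies. *)
  exists (fun i t => - (1) * f' i t * (/ f i t * / f i t))%C; split.
  + intros i t; replace (- (1) * f' i t * (/ f i t * / f i t))%C with (- f' i t * (/ f i t * / f i t))%C by ring.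
    apply is_Cder_inv; auto.
  + apply UC_mult; [apply UC_mult; [|exact hb']|apply UC_mult; apply IH; auto; apply UC_pred, hU'].
    apply (UC_const n (fun _ : I => (- (1))%C) 1); intros; rewrite Cmod_opp, Cmod_1; lra.
Qed.

(** As [2 * PI >= 1], a derivative gains a factor [|m|]. The remaining 1 in [br m = 1 + |m|] is paid
    for by the function itself. *)
Lemma UC_rdecay {I : Type} (n : nat) (f : I -> R -> C) : UC n f ->
  exists K, forall i, rdecay n (fourier_coef (f i)) K.
Proof.
revert f; induction n as [|n IH]; intros f hU; assert (hU' := hU); destruct hU as [h1 [h2 [[K h3] h4]]].
- exists K; intros i m; simpl; rewrite Rmult_1_l; apply fourier_coef_le; auto.
- destruct h4 as [f' [ha hb]].
  destruct (IH f (UC_pred n f hU')) as [A hA], (IH f' hb) as [B hB].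
  exists (A + B); intros i m; specialize (hA i m); specialize (hB i m).
  assert (hc : C_cont (f' i)) by (destruct n; apply hb).
  rewrite (fourier_coef_der (f i) (f' i) m (ha i) hc (h1 i)), Cmod_mult, freq_mod in hB.
  assert (h0 := Cmod_ge_0 (fourier_coef (f i) m)); assert (hn := br_pow_pos m n).
  apply Rle_trans with (br m ^ n * Cmod (fourier_coef (f i) m) +
    br m ^ n * (2 * PI * IZR (Z.abs m) * Cmod (fourier_coef (f i) m))); [|lra].
  rewrite <- Rmult_plus_distr_l; simpl; rewrite (Rmult_comm (br m)), Rmult_assoc.
  apply Rmult_le_compat_l; [lra|]; unfold br.
  assert (h5 := IZR_le 0 _ (Z.abs_nonneg m)); assert (hpi := PI2_1).
  assert (1 * (IZR (Z.abs m) * Cmod (fourier_coef (f i) m)) <=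
    2 * PI * (IZR (Z.abs m) * Cmod (fourier_coef (f i) m))); [|lra].
  apply Rmult_le_compat_r; [apply Rmult_le_pos; lra|lra].
Qed.

Lemma UC_Phi {I : Type} (n : nat) (u : Z -> C) : rapid u -> UC n (fun (_ : I) => Phi u).
Proof.
revert u; induction n as [|n IH]; intros u hu; destruct (hu 2%nat) as [c hc], (hu 4%nat) as [c4 hc4];
  (split; [|split; [|split]]).
1, 5: intros _; rewrite <- (Phi_periodic u 0), Rplus_0_l; reflexivity.
1, 4: intros _; apply Phi_cont, hu.
1, 3: exists (c * wtot); intros _ t _; apply Phi_le, hc.
- exact Logic.I.
- exists (fun _ => Phi (dcoef u)); split; [|apply IH, rapid_dcoef, hu].
  intros _ t; apply (Phi_der u c4 t hc4).
Qed.

Lemma smooth_UC (phi : R -> C) (n : nat) : smooth_periodic phi -> UC n (fun _ : unit => phi).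
Proof.
intros [hper hsm].
set (D := fun k t => (Derive_n (fun x => Re (phi x)) k t, Derive_n (fun x => Im (phi x)) k t) : C).
assert (hD : forall k t, is_Cder (D k) t (D (S k) t)).
{ intros k t; destruct (hsm (S k) t) as [h1 h2]; split; apply Derive_correct; assumption. }
assert (hp : forall k, D k 0 = D k 1).
{ intros k; unfold D; f_equal.
  - rewrite <- (Rplus_0_l 1), <- (Derive_n_comp_trans _ k 0 1); apply Derive_n_ext; intros t.
    rewrite hper; reflexivity.
  - rewrite <- (Rplus_0_l 1), <- (Derive_n_comp_trans _ k 0 1); apply Derive_n_ext; intros t.
    rewrite hper; reflexivity. }
replace phi with (D 0%nat) by (apply functional_extensionality; intros t; symmetry; apply surjective_pairing).
generalize 0%nat; induction n as [|n IH]; intros k; (split; [|split; [|split]]).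
1, 5: intros _; apply hp.
1, 4: intros _; apply (is_Cder_cont _ (D (S k))), hD.
1, 3: destruct (bounded_continuity (V := C_R_NormedModule) (D k) 0 1) as [K hK];
  [intros t _; apply (is_Cder_cont _ (D (S k)) (hD k))|];
  exists K; intros _ t ht; rewrite <- C_R_norm; left; apply hK, ht.
- exact Logic.I.
- exists (fun _ => D (S k)); split; [intros _; apply hD|apply IH].
Qed.

Lemma smooth_rapid (phi : R -> C) : smooth_periodic phi -> rapid (fourier_coef phi).
Proof.
intros h N; destruct (UC_rdecay N _ (smooth_UC phi N h)) as [K hK]; exists K; exact (hK tt).
Qed.

Lemma l2_scal_coord (a : C) (y : l2) (j : Z) : (scal a y : l2) j = (a * y j)%C.
Proof. reflexivity. Qed.

Lemma minus_eq_0_eq {G : AbelianGroup} (x y : G) : minus x y = zero -> x = y.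
Proof.
intros e; rewrite <- (minus_minus_r x y), e; symmetry; apply minus_zero_r.
Qed.

(** * The resolvent block by block *)

(* [Q] moves the block at [l2] onto the block at [l1] and kills all other blocks. It commutes with
   Toeplitz operators, so that [B Q - Q B = B (c Q - Q c) B] for a resolvent [B] of [b + c]: for
   [l1 = l2] the resolvent preserves the blocks, in general its entries inherit their continuity
   in [l] from those of [c]. *)
Lemma ex_intertwiner (s : Z) (hs : (2 <= s)%Z) (l1 l2 : Z) : ~ (s | l1)%Z -> ~ (s | l2)%Z ->
  exists Q : BH, (forall y i, Q y (pt s i l1) = y (pt s i l2)) /\
    (forall y i l, ~ (s | l)%Z -> l <> l1 -> Q y (pt s i l) = 0) /\
    (forall y, Q y 0%Z = 0) /\ norm Q <= 1.
Proof.
intros h1 h2.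
set (P := fun j => exists i, j = pt s i l1).
set (sg := fun j => match excluded_middle_informative (P j) with
  | left h => Some (pt s (proj1_sig (constructive_indefinite_description _ h)) l2)
  | right _ => None end).
assert (hsg : forall i, sg (pt s i l1) = Some (pt s i l2)).
{ intros i; unfold sg; destruct (excluded_middle_informative (P (pt s i l1))) as [h|h].
  - destruct (constructive_indefinite_description _ h) as [i' e]; simpl.
    destruct (pt_inj s hs _ _ _ _ h1 h1 e) as [<- _]; reflexivity.
  - elim h; exists i; reflexivity. }
assert (hsg0 : forall j, ~ P j -> sg j = None).
{ intros j h; unfold sg; destruct (excluded_middle_informative (P j)); [tauto|reflexivity]. }
assert (hP : forall j, sg j <> None -> P j).
{ intros j h; apply NNPP; intros h'; apply h, hsg0, h'. }
destruct (ex_wpi sg (fun _ => RtoC 1) 1) as [Q [HQ hn]].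
- lra.
- intros; rewrite Cmod_1; lra.
- intros j j' k e e'.
  destruct (hP j) as [i ->]; [congruence|]; destruct (hP j') as [i' ->]; [congruence|].
  rewrite hsg in e, e'; rewrite <- e' in e; injection e as e.
  destruct (pt_inj s hs _ _ _ _ h2 h2 e) as [-> _]; reflexivity.
- exists Q; split; [|split; [|split; [|exact hn]]].
  + intros y i; rewrite HQ; unfold wpi_fun; rewrite hsg; ring.
  + intros y i l hl hne; rewrite HQ; unfold wpi_fun; rewrite hsg0; [reflexivity|].
    intros [i' e]; apply hne; apply (pt_inj s hs _ _ _ _ hl h1 e).
  + intros y; rewrite HQ; unfold wpi_fun; rewrite hsg0; [reflexivity|].
    intros [i' e]; apply (pt_neq_0 s hs i' l1 h1); auto.
Qed.

Section Resolvent.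
Variables (s : Z) (hs : (2 <= s)%Z) (u : Z -> C) (b c : BH) (F : Z -> nat * Zs s -> C).
Hypotheses (hu : rapid u) (hb : isT s u b) (hF : rapid_decay F).
Hypothesis hF0 : forall n, C0_on (fun p : nat * Zs s => Zs_unit (snd p)) (F n).
Hypothesis hc : is_zseries (V := BH_NormedModule) (iterm s F) c.

(** The term [n] joins the levels [m] and [m + |n|], so [k] may be either of them. Joint decay in
    [(m, n)] gives [N] powers of the level and two more for [wt n]. *)
Lemma F_bound (N : nat) : exists P, 0 <= P /\ forall n m x k, Zs_unit x ->
  (Z.of_nat k <= Z.of_nat m + Z.abs n)%Z -> br (Z.of_nat k) ^ N * Cmod (F n (m, x)) <= P * wt n.
Proof.
destruct (hF (N + 2)%nat) as [P HP].
(* There is a unit, so the constant from rapid decay is nonnegative. *)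
assert (hx : Zs_unit (Zs_of_Z s 1)) by apply (Zs_unit_of_Z s hs), one_unit, hs.
exists P; split.
{ eapply Rle_trans; [|apply (HP 0%Z 0%nat _ hx)]; apply Rmult_le_pos; [|apply Cmod_ge_0].
  apply pow_le; simpl; lra. }
intros n m x k h hk; unfold wt; apply le_div_of_mult; [apply br_pow_pos|].
eapply Rle_trans; [|apply (HP n m x h)]; rewrite <- Rmult_assoc.
apply Rmult_le_compat_r; [apply Cmod_ge_0|].
assert (hm := pos_INR m); assert (hn := IZR_le 0 _ (Z.abs_nonneg n)).
assert (hk' := IZR_le _ _ hk); rewrite plus_IZR, <- !INR_IZR_INZ in hk'; assert (hk0 := pos_INR k).
rewrite pow_add, Rmult_comm; apply Rmult_le_compat; try (left; apply br_pow_pos);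
  apply pow_incr; unfold br; rewrite ?Z.abs_eq, <- ?INR_IZR_INZ by lia; lra.
Qed.

Lemma F_bounded : exists P, 0 <= P /\ forall n, bounded_on_units s (F n) (P * wt n).
Proof.
destruct (F_bound 0) as [P [hP HP]]; exists P; split; [exact hP|].
intros n; split; [apply Rmult_le_pos; [exact hP|left; apply wt_pos]|].
intros m x hx; specialize (HP n m x 0%nat hx ltac:(lia)); simpl in HP; lra.
Qed.

Lemma iterm_coord (n : Z) : (forall y, iterm s F n y 0%Z = 0) /\
  (forall y i l, ~ (s | l)%Z -> iterm s F n y (pt s i l) =
    if (n <=? Z.of_nat i)%Z then
      (F n (Z.to_nat (Z.min (Z.of_nat i) (Z.of_nat i - n)), Zs_of_Z s l)
         * y (pt s (Z.to_nat (Z.of_nat i - n)) l))%C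
    else RtoC 0).
Proof.
destruct F_bounded as [P [_ HP]]; destruct (iterm_spec s hs F n _ (HP n)) as [h1 [h2 _]]; auto.
Qed.

Lemma c_apply (y : l2) : is_zseries (V := l2_NormedModule) (fun n => iterm s F n y) (c y).
Proof. exact (is_zseries_linear (fun a : BH => a y) _ c (apply_linear y) hc). Qed.

Lemma c_coord (y : l2) (j : Z) : is_zseries (V := C_NormedModule) (fun n => iterm s F n y j) (c y j).
Proof. exact (is_zseries_linear (fun a : BH => a y j) _ c (entry_linear y j) hc). Qed.

Lemma c_0 (y : l2) : c y 0%Z = 0.
Proof. apply (is_zseries_C_zero _ _) with (2 := c_coord y 0%Z); intros n; apply iterm_coord. Qed.

Lemma c_E_0 : c (E 0) = zero.
Proof.
apply (l2_ext_pt s hs); [apply c_0|]; intros k l hl.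
apply (is_zseries_C_zero _ _) with (2 := c_coord (E 0) (pt s k l)); intros n.
rewrite (proj2 (iterm_coord n)) by exact hl; destruct (n <=? Z.of_nat k)%Z; [|reflexivity].
rewrite (E_0_pt s hs) by exact hl; apply Cmult_0_r.
Qed.

Lemma iterm_E (n : Z) (k : nat) (l : Z) : ~ (s | l)%Z ->
  iterm s F n (E (pt s k l)) =
  if (0 <=? Z.of_nat k + n)%Z then
    scal (F n (Z.to_nat (Z.min (Z.of_nat k + n) (Z.of_nat k)), Zs_of_Z s l))
      (E (pt s (Z.to_nat (Z.of_nat k + n)) l))
  else zero.
Proof.
intros hl; destruct (iterm_coord n) as [h0 h1]; apply (l2_ext_pt s hs).
- rewrite h0; destruct (0 <=? Z.of_nat k + n)%Z; [|reflexivity].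
  rewrite l2_scal_coord, (E_pt_0 s hs) by exact hl; symmetry; apply Cmult_0_r.
- intros i l' hl'; rewrite h1 by exact hl'.
  destruct (Z.leb_spec 0 (Z.of_nat k + n)) as [h|h].
  + rewrite l2_scal_coord, (E_pt s hs (Z.to_nat (Z.of_nat k + n)) i l l' hl hl').
    destruct (Z.eq_dec l l') as [<-|e].
    * destruct (Nat.eq_dec (Z.to_nat (Z.of_nat k + n)) i) as [e|e].
      -- destruct (Z.leb_spec n (Z.of_nat i)); [|lia].
         rewrite (E_pt s hs) by assumption; destruct (Z.eq_dec l l); [|tauto].
         destruct (Nat.eq_dec k (Z.to_nat (Z.of_nat i - n))); [|lia].
         replace (Z.to_nat (Z.min (Z.of_nat i) (Z.of_nat i - n)))
           with (Z.to_nat (Z.min (Z.of_nat k + n) (Z.of_nat k))) by lia; reflexivity.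
      -- rewrite Cmult_0_r; destruct (Z.leb_spec n (Z.of_nat i)); [|reflexivity].
         rewrite (E_pt s hs) by assumption; destruct (Z.eq_dec l l); [|tauto].
         destruct (Nat.eq_dec k (Z.to_nat (Z.of_nat i - n))); [lia|apply Cmult_0_r].
    * rewrite Cmult_0_r; destruct (n <=? Z.of_nat i)%Z; [|reflexivity].
      rewrite (E_pt s hs) by assumption; destruct (Z.eq_dec l l'); [tauto|apply Cmult_0_r].
  + change ((zero : l2) (pt s i l')) with (RtoC 0).
    destruct (Z.leb_spec n (Z.of_nat i)); [|reflexivity].
    rewrite (E_pt s hs) by assumption; destruct (Z.eq_dec l l'); [|apply Cmult_0_r].
    destruct (Nat.eq_dec k (Z.to_nat (Z.of_nat i - n))); [lia|apply Cmult_0_r].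
Qed.

Lemma c_decay (N : nat) : exists P, 0 <= P /\
  (forall k l, ~ (s | l)%Z -> br (Z.of_nat k) ^ N * norm (c (E (pt s k l))) <= P) /\
  (forall y i l, ~ (s | l)%Z -> br (Z.of_nat i) ^ N * Cmod (c y (pt s i l)) <= P * norm y).
Proof.
destruct (F_bound N) as [P [hP HP]]; exists (P * wtot).
assert (hw := wtot_ge_1).
split; [apply Rmult_le_pos; lra|split].
- intros k l hl; assert (hp := br_pow_pos (Z.of_nat k) N).
  assert (h : norm (c (E (pt s k l))) <= P / br (Z.of_nat k) ^ N * wtot).
  { apply (is_zseries_norm_le (V := l2_NormedModule)) with (2 := c_apply _); intros n.
    assert (hz := wt_pos n).
    rewrite iterm_E by exact hl; destruct (Z.leb_spec 0 (Z.of_nat k + n)) as [h|h].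
    - eapply Rle_trans; [right; apply norm_scal_l2|].
      match goal with |- Cmod (F n (?m, ?x)) * _ <= _ =>
        assert (h1 := HP n m x k (Zs_unit_of_Z s hs l hl) ltac:(lia));
        assert (h3 := Cmod_ge_0 (F n (m, x)));
        apply Rle_trans with (Cmod (F n (m, x)) * 1);
        [apply Rmult_le_compat_l; [exact h3|apply E_norm_le]|] end.
      rewrite Rmult_1_r; replace (P / br (Z.of_nat k) ^ N * wt n) with ((P * wt n) / br (Z.of_nat k) ^ N)
        by (field; lra).
      apply le_div_of_mult; assumption.
    - eapply Rle_trans; [right; exact norm_zero_l2|]; apply Rmult_le_pos; [|lra].
      apply Rdiv_le_0_compat; lra. }
  apply (Rmult_le_compat_l (br (Z.of_nat k) ^ N)) in h; [|lra].
  eapply Rle_trans; [exact h|right; field; lra].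
- intros y i l hl; assert (hp := br_pow_pos (Z.of_nat i) N); assert (hy := norm_l2_ge_0 y).
  assert (h : Cmod (c y (pt s i l)) <= P / br (Z.of_nat i) ^ N * norm y * wtot).
  { apply (is_zseries_norm_le (V := C_NormedModule)) with (2 := c_coord _ _); intros n.
    assert (hz := wt_pos n).
    change (Cmod (iterm s F n y (pt s i l)) <= P / br (Z.of_nat i) ^ N * norm y * wt n).
    rewrite (proj2 (iterm_coord n)) by exact hl; destruct (Z.leb_spec n (Z.of_nat i)) as [h|h].
    - rewrite Cmod_mult.
      set (m := Z.to_nat (Z.min (Z.of_nat i) (Z.of_nat i - n))).
      assert (h1 := HP n m _ i (Zs_unit_of_Z s hs l hl) ltac:(lia)).
      apply Rle_trans with (Cmod (F n (m, Zs_of_Z s l)) * norm y);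
        [apply Rmult_le_compat_l; [apply Cmod_ge_0|apply l2_coord_le]|].
      replace (P / br (Z.of_nat i) ^ N * norm y * wt n) with ((P * wt n) / br (Z.of_nat i) ^ N * norm y)
        by (field; lra).
      apply Rmult_le_compat_r; [exact hy|apply le_div_of_mult; assumption].
    - rewrite Cmod_0; apply Rmult_le_pos; [|lra]; apply Rmult_le_pos; [|exact hy].
      apply Rdiv_le_0_compat; lra. }
  apply (Rmult_le_compat_l (br (Z.of_nat i) ^ N)) in h; [|lra].
  eapply Rle_trans; [exact h|right; field; lra].
Qed.

Lemma is_zseries_BH_comm (X : Z -> BH) (W Q : BH) : is_zseries (V := BH_NormedModule) X W ->
  is_zseries (V := BH_NormedModule) (fun n => minus (mult (X n) Q) (mult Q (X n)) : BH)
    (minus (mult W Q) (mult Q W)).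
Proof.
intros h.
assert (h1 := is_zseries_linear _ _ _ (mult_r_linear Q) h).
assert (h2 := is_zseries_linear _ _ _ (mult_l_linear Q) h).
exact (is_zseries_minus _ _ _ _ h1 h2).
Qed.

Section Intertwined.
Variables (l1 l2 : Z) (Q : BH) (eps : R).
Hypotheses (h1 : ~ (s | l1)%Z) (h2 : ~ (s | l2)%Z).
Hypothesis HQ1 : forall y i, Q y (pt s i l1) = y (pt s i l2).
Hypothesis HQ2 : forall y i l, ~ (s | l)%Z -> l <> l1 -> Q y (pt s i l) = 0.
Hypothesis HQ0 : forall y, Q y 0%Z = 0.
Hypothesis HQn : norm Q <= 1.
Hypothesis heps : forall n m, Cmod (F n (m, Zs_of_Z s l1) - F n (m, Zs_of_Z s l2)) <= eps * wt n.

Lemma Q_vz (m : Z) : mult (vz s m) Q = mult Q (vz s m).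
Proof.
apply BH_ext; intros y; apply (l2_ext_pt s hs).
- change (vz s m (Q y) 0%Z = Q (vz s m y) 0%Z); rewrite vz_0, !HQ0 by exact hs; reflexivity.
- intros i l hl; change (vz s m (Q y) (pt s i l) = Q (vz s m y) (pt s i l)).
  rewrite vz_pt by assumption; destruct (Z.eq_dec l l1) as [->|e].
  + rewrite !HQ1, vz_pt by assumption; reflexivity.
  + rewrite !HQ2 by assumption; destruct (m <=? Z.of_nat i)%Z; reflexivity.
Qed.

Lemma Q_b : mult b Q = mult Q b.
Proof.
assert (h := is_zseries_BH_comm _ _ Q hb).
assert (hz : minus (mult b Q) (mult Q b) = (zero : BH)).
{ apply (is_zseries_unique (V := BH_NormedModule) _ _ _ h).
  assert (hv : forall n, minus (mult (scal (u n) (vz s n) : BH) Q) (mult Q (scal (u n) (vz s n))) = (zero : BH)).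
  { intros n; apply BH_ext; intros y; apply l2_ext; intros j.
    change ((u n * vz s n (Q y) j) + - (1) * Q (scal (u n) (vz s n y)) j = 0)%C.
    rewrite (linear_scal Q (op_linear Q)).
    change ((u n * (mult (vz s n) Q : BH) y j) + - (1) * (u n * (mult Q (vz s n) : BH) y j) = 0)%C.
    rewrite Q_vz; ring. }
  rewrite <- (hv 0%Z); apply (is_zseries_single (V := BH_NormedModule)
    (fun n => minus (mult (scal (u n) (vz s n) : BH) Q) (mult Q (scal (u n) (vz s n))) : BH)).
  intros n _; apply hv. }
exact (minus_eq_0_eq (G := BH_AbelianGroup) _ _ hz).
Qed.

(** At the block of [l1], [c Q] uses the coefficients at [l1] and [Q c] those at [l2]. Hence the
    commutator of a term with [Q] is the term with their difference as coefficient, constant over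
    the units, followed on the right by [Q]. *)
Lemma Q_c : norm (minus (mult c Q) (mult Q c) : BH) <= eps * wtot.
Proof.
apply (is_zseries_norm_le (V := BH_NormedModule)) with (2 := is_zseries_BH_comm _ _ Q hc); intros n.
set (F' := fun (n : Z) (p : nat * Zs s) => (F n (fst p, Zs_of_Z s l1) - F n (fst p, Zs_of_Z s l2))%C).
assert (hF' : bounded_on_units s (F' n) (eps * wt n)).
{ split; [|intros m x _; apply heps].
  eapply Rle_trans; [apply Cmod_ge_0|apply (heps n 0%nat)]. }
destruct (iterm_spec s hs F' n _ hF') as [k0 [k1 k2]], (iterm_coord n) as [e0 e1].
assert (e : minus (mult (iterm s F n) Q) (mult Q (iterm s F n)) = mult (iterm s F' n) Q).
{ apply BH_ext; intros y; apply (l2_ext_pt s hs).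
  - change (iterm s F n (Q y) 0%Z + - (1) * Q (iterm s F n y) 0%Z = iterm s F' n (Q y) 0%Z)%C.
    rewrite e0, HQ0, k0; ring.
  - intros i l hl.
    change (iterm s F n (Q y) (pt s i l) + - (1) * Q (iterm s F n y) (pt s i l) =
      iterm s F' n (Q y) (pt s i l))%C.
    rewrite e1, k1 by exact hl; destruct (Z.eq_dec l l1) as [->|el].
    + rewrite !HQ1, e1 by exact h2; destruct (n <=? Z.of_nat i)%Z; [unfold F'; simpl|]; ring.
    + rewrite !HQ2 by assumption; destruct (n <=? Z.of_nat i)%Z; ring. }
eapply Rle_trans; [right; exact (f_equal (fun a : BH => norm a) e)|].
eapply Rle_trans; [apply norm_mult_le|].
assert (hq : 0 <= norm Q) by apply BH_norm_ge_0.
apply Rle_trans with (eps * wt n * 1); [|lra].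
apply Rmult_le_compat; [apply BH_norm_ge_0|exact hq|exact k2|exact HQn].
Qed.

Lemma Q_inverse (z : C) (B : BH) : inverse_of (minus (scal z (one : BH)) (plus b c)) B ->
  norm (minus (mult B Q) (mult Q B) : BH) <= norm B * norm B * (eps * wtot).
Proof.
intros [hB1 hB2].
assert (e : minus (mult B Q) (mult Q B) = mult B (mult (minus (mult c Q) (mult Q c)) B) :> BH).
{ apply BH_ext; intros y.
  set (H := minus (scal z (one : BH)) (plus b c)) in *.
  assert (e1 : forall x, B (H x) = x) by (intros x; change ((mult B H : BH) x = x); rewrite hB2; reflexivity).
  assert (e2 : forall x, H (B x) = x) by (intros x; change ((mult H B : BH) x = x); rewrite hB1; reflexivity).
  change (minus (B (Q y)) (Q (B y)) = B (minus (c (Q (B y))) (Q (c (B y))))).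
  rewrite <- (e1 (Q (B y))), <- (e2 y) at 1.
  etransitivity; [symmetry; apply (linear_minus B _ _ (op_linear B))|]; f_equal.
  set (x := B y).
  assert (eQ : forall j, Q (H x) j = (z * Q x j - (Q (b x) j + Q (c x) j))%C).
  { intros j; change (H x) with (minus (scal z x) (plus (b x) (c x))).
    rewrite (linear_minus Q _ _ (op_linear Q)), (linear_scal Q (op_linear Q)), (linear_plus Q (op_linear Q)).
    change (z * Q x j + - (1) * (Q (b x) j + Q (c x) j) = z * Q x j - (Q (b x) j + Q (c x) j))%C; ring. }
  apply l2_ext; intros j.
  change (Q (H x) j + - (1) * (z * Q x j + - (1) * (b (Q x) j + c (Q x) j)) =
    c (Q x) j + - (1) * Q (c x) j)%C.
  rewrite eQ; change (b (Q x)) with ((mult b Q : BH) x); rewrite Q_b.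
  change ((mult Q b : BH) x) with (Q (b x)); ring. }
eapply Rle_trans; [right; exact (f_equal (fun a : BH => norm a) e)|].
eapply Rle_trans; [apply norm_mult_le|].
assert (hn : 0 <= norm B) by apply BH_norm_ge_0.
rewrite Rmult_assoc; apply Rmult_le_compat_l; [exact hn|].
eapply Rle_trans; [apply norm_mult_le|]; rewrite Rmult_comm; apply Rmult_le_compat_l; [exact hn|].
apply Q_c.
Qed.

Lemma Q_E (k : nat) : Q (E (pt s k l2)) = E (pt s k l1).
Proof.
apply (l2_ext_pt s hs).
- rewrite HQ0, (E_pt_0 s hs) by exact h1; reflexivity.
- intros i l hl; destruct (Z.eq_dec l l1) as [->|e].
  + rewrite HQ1, !(E_pt s hs) by assumption.
    destruct (Z.eq_dec l2 l2), (Z.eq_dec l1 l1); tauto.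
  + rewrite HQ2, (E_pt s hs) by assumption; destruct (Z.eq_dec l1 l); [congruence|reflexivity].
Qed.

End Intertwined.

Lemma resolvent_block (z : C) (B : BH) (k : nat) (l : Z) :
  inverse_of (minus (scal z (one : BH)) (plus b c)) B -> ~ (s | l)%Z ->
  B (E (pt s k l)) 0%Z = 0 /\
  forall i l', ~ (s | l')%Z -> l' <> l -> B (E (pt s k l)) (pt s i l') = 0.
Proof.
intros hB hl; destruct (ex_intertwiner s hs l l hl hl) as [Q [q1 [q2 [q0 qn]]]].
assert (h := Q_inverse l l Q 0 hl q1 q2 q0 qn).
(* For [l1 = l2] the differences of coefficients are 0, so [eps = 0] and [Q] commutes exactly with
   [B]. *)
assert (e : B (E (pt s k l)) = Q (B (E (pt s k l)))).
{ rewrite <- (Q_E l l Q hl hl q1 q2 q0 k) at 1.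
  assert (h' : norm (minus (mult B Q) (mult Q B) : BH) <= 0).
  { eapply Rle_trans; [apply (fun hh => h hh z B hB)|right; ring].
    intros n m; unfold Cminus; rewrite Rmult_0_l, Cplus_opp_r, Cmod_0; lra. }
  assert (h0 := BH_norm_ge_0 (minus (mult B Q) (mult Q B))).
  assert (hz := BH_norm_eq_0 (minus (mult B Q) (mult Q B)) (Rle_antisym _ _ h' h0)).
  change ((mult B Q : BH) (E (pt s k l)) = (mult Q B : BH) (E (pt s k l))); f_equal.
  exact (minus_eq_0_eq (G := BH_AbelianGroup) _ _ hz). }
rewrite e; split; [apply q0|intros i l' hl' hne; apply q2; assumption].
Qed.

Lemma resolvent_entry_diff (z : C) (B : BH) (l1 l2 : Z) (eps : R) (i k : nat) :
  inverse_of (minus (scal z (one : BH)) (plus b c)) B -> ~ (s | l1)%Z -> ~ (s | l2)%Z ->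
  (forall n m, Cmod (F n (m, Zs_of_Z s l1) - F n (m, Zs_of_Z s l2)) <= eps * wt n) ->
  Cmod (B (E (pt s k l1)) (pt s i l1) - B (E (pt s k l2)) (pt s i l2)) <= norm B * norm B * (eps * wtot).
Proof.
intros hB h1 h2 he; destruct (ex_intertwiner s hs l1 l2 h1 h2) as [Q [q1 [q2 [q0 qn]]]].
assert (h := Q_inverse l1 l2 Q eps h2 q1 q2 q0 qn he z B hB).
replace (B (E (pt s k l1)) (pt s i l1) - B (E (pt s k l2)) (pt s i l2))%C
  with ((minus (mult B Q) (mult Q B) : BH) (E (pt s k l2)) (pt s i l1)).
- eapply Rle_trans; [apply l2_coord_le|]; eapply Rle_trans; [apply norm_apply_E_le|exact h].
- change (B (Q (E (pt s k l2))) (pt s i l1) + - (1) * Q (B (E (pt s k l2))) (pt s i l1) =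
    B (E (pt s k l1)) (pt s i l1) - B (E (pt s k l2)) (pt s i l2))%C.
  rewrite q1, (Q_E l1 l2 Q h1 h2 q1 q2 q0); ring.
Qed.

(** * Continuity in the s-adic variable *)

Definition agree (K : nat) (x : Zs s) (l : Z) : Prop := zs_res (Zs_of_Z s l) K = zs_res x K.

Lemma agree_le (K K' : nat) (x : Zs s) (l : Z) : (K <= K')%nat -> agree K' x l -> agree K x l.
Proof.
unfold agree; intros h e.
rewrite <- (zs_compat s (Zs_of_Z s l) K K' h), <- (zs_compat s x K K' h), e; reflexivity.
Qed.

Lemma F_local (x : Zs s) (n : Z) (m : nat) (eps : R) : Zs_unit x -> 0 < eps ->
  exists K, forall l, ~ (s | l)%Z -> agree K x l ->
    Cmod (F n (m, Zs_of_Z s l) - F n (m, x)) <= eps.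
Proof.
intros hx he; destruct (hF0 n) as [hcont _].
specialize (hcont (m, x) hx).
assert (hl : locally (T := C_UniformSpace) (F n (m, x)) (fun z => Cmod (z - F n (m, x)) <= eps)).
{ apply (filter_imp (fun z => Cmod (z - F n (m, x)) < eps)); [intros; lra|apply locally_Cmod, he]. }
destruct (hcont _ hl) as [d Hd].
(* The ball of radius [d] constrains the residues of index below [1 / d]; agreement at any
   [K > 1 / d] implies all of these. *)
destruct (INR_unbounded (/ d)) as [K hK].
exists K; intros l hl1 ha; apply Hd; [|apply (Zs_unit_of_Z s hs), hl1].
split; [reflexivity|]; split; [apply cond_pos|].
intros n0 hn0; symmetry; apply (agree_le n0 K); [|exact ha].
assert (hd := cond_pos d); apply INR_le.
assert (INR n0 < / d); [|lra].
apply (Rmult_lt_reg_r d); [exact hd|]; rewrite Rinv_l by lra; exact hn0.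
Qed.

Lemma finite_family_bound (P : Z -> nat -> nat -> Prop) (M : nat) :
  (forall n m K K', (K <= K')%nat -> P n m K -> P n m K') -> (forall n m, exists K, P n m K) ->
  exists K, forall n m, (Z.abs n <= Z.of_nat M)%Z -> (m <= M)%nat -> P n m K.
Proof.
intros hmono hex.
assert (A : forall n M', exists K, forall m, (m <= M')%nat -> P n m K).
{ intros n; induction M' as [|M' [K IH]].
  - destruct (hex n 0%nat) as [K hK]; exists K; intros m hm; replace m with 0%nat by lia; exact hK.
  - destruct (hex n (S M')) as [K' hK']; exists (max K K'); intros m hm.
    destruct (Nat.eq_dec m (S M')) as [->|]; [apply (hmono _ _ K'); [lia|exact hK']|].
    apply (hmono _ _ K); [lia|apply IH; lia]. }
assert (B' : forall M', exists K, forall n m, (Z.abs n <= Z.of_nat M')%Z -> (m <= M)%nat -> P n m K).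
{ induction M' as [|M' [K IH]].
  - destruct (A 0%Z M) as [K hK]; exists K; intros n m hn hm; replace n with 0%Z by lia; auto.
  - destruct (A (Z.of_nat (S M')) M) as [K1 hK1], (A (- Z.of_nat (S M'))%Z M) as [K2 hK2].
    exists (max K (max K1 K2)); intros n m hn hm.
    destruct (Z.eq_dec n (Z.of_nat (S M'))) as [->|]; [apply (hmono _ _ K1); [lia|auto]|].
    destruct (Z.eq_dec n (- Z.of_nat (S M'))) as [->|]; [apply (hmono _ _ K2); [lia|auto]|].
    apply (hmono _ _ K); [lia|apply IH; [lia|exact hm]]. }
apply B'.
Qed.

(** Finitely many pairs [(n, m)] are handled by continuity with a common modulus. For the others
    [m + |n| >= M], and decay bounds the difference by [2 * P * wt n / br M]; hence the choice of
    [M] above [2 * P / eps]. *)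
Lemma F_uniform (x : Zs s) (eps : R) : Zs_unit x -> 0 < eps ->
  exists K, forall l1 l2, ~ (s | l1)%Z -> ~ (s | l2)%Z -> agree K x l1 -> agree K x l2 ->
    forall n m, Cmod (F n (m, Zs_of_Z s l1) - F n (m, Zs_of_Z s l2)) <= eps * wt n.
Proof.
intros hx he; destruct (F_bound 1) as [P [hP HP]].
destruct (INR_unbounded (2 * P / eps)) as [M hM].
destruct (finite_family_bound (fun n m K => forall l1 l2, ~ (s | l1)%Z -> ~ (s | l2)%Z ->
  agree K x l1 -> agree K x l2 ->
  Cmod (F n (m, Zs_of_Z s l1) - F n (m, Zs_of_Z s l2)) <= eps * wt n) M) as [K HK].
- intros n m K K' hK H l1 l2 h1 h2 a1 a2; apply H; auto; apply (agree_le K K'); auto.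
- intros n m; destruct (F_local x n m (eps * wt n / 2) hx) as [K HK].
  { assert (h := wt_pos n); apply Rdiv_lt_0_compat; [apply Rmult_lt_0_compat|]; lra. }
  exists K; intros l1 l2 h1 h2 a1 a2.
  replace (F n (m, Zs_of_Z s l1) - F n (m, Zs_of_Z s l2))%C
    with ((F n (m, Zs_of_Z s l1) - F n (m, x)) + - (F n (m, Zs_of_Z s l2) - F n (m, x)))%C by ring.
  eapply Rle_trans; [apply Cmod_triangle|]; rewrite Cmod_opp.
  assert (e1 := HK l1 h1 a1); assert (e2 := HK l2 h2 a2); lra.
- exists K; intros l1 l2 h1 h2 a1 a2 n m.
  destruct (Z_le_gt_dec (Z.abs n) (Z.of_nat M)) as [hn|hn];
    [destruct (le_gt_dec m M) as [hm|hm]; [apply HK; assumption|]|].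
  all: assert (hk : (Z.of_nat M <= Z.of_nat m + Z.abs n)%Z) by lia.
  all: assert (e1 := HP n m _ M (Zs_unit_of_Z s hs l1 h1) hk).
  all: assert (e2 := HP n m _ M (Zs_unit_of_Z s hs l2 h2) hk).
  all: assert (hb' : INR M <= br (Z.of_nat M)) by (unfold br; rewrite Z.abs_eq, <- INR_IZR_INZ by lia; lra).
  all: apply (Rmult_le_reg_l (br (Z.of_nat M) ^ 1)); [apply br_pow_pos|].
  all: apply Rle_trans with (2 * (P * wt n)).
  1, 3: unfold Cminus; eapply Rle_trans; [apply Rmult_le_compat_l; [left; apply br_pow_pos|apply Cmod_triangle]|];
    rewrite Cmod_opp; lra.
  all: rewrite pow_1; assert (hw := wt_pos n).
  all: apply (Rmult_lt_compat_r eps) in hM; [|exact he].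
  all: replace (2 * P / eps * eps) with (2 * P) in hM by (field; lra).
  all: assert (h5 : 2 * P <= br (Z.of_nat M) * eps) by nra.
  all: apply (Rmult_le_compat_r (wt n)) in h5; lra.
Qed.

(** * The symbol of z - a and its reciprocal *)

Definition chi (z : C) (m : Z) : C := ((if Z.eq_dec m 0 then z else 0) - u m)%C.

Lemma chi_rdecay (z : C) (N : nat) (A : R) : rdecay N u A -> rdecay N (chi z) (Cmod z + A).
Proof.
intros h m; specialize (h m); unfold chi, Cminus.
eapply Rle_trans; [apply Rmult_le_compat_l; [left; apply br_pow_pos|apply Cmod_triangle]|].
rewrite Cmod_opp, Rmult_plus_distr_l; apply Rplus_le_compat; [|exact h].
destruct (Z.eq_dec m 0) as [->|e].
- replace (br 0) with 1 by (unfold br; simpl; ring); rewrite pow1; lra.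
- rewrite Cmod_0, Rmult_0_r; apply Cmod_ge_0.
Qed.

Lemma chi_rapid (z : C) : rapid (chi z).
Proof. intros N; destruct (hu N) as [A hA]; eexists; apply chi_rdecay, hA. Qed.

Lemma is_zseries_dirac {V : NormedModule C_AbsRing} (v : Z -> V) (z : C) :
  is_zseries (fun m => scal (if Z.eq_dec m 0 then z else RtoC 0) (v m)) (scal z (v 0%Z)).
Proof.
assert (h := is_zseries_single (fun m => scal (if Z.eq_dec m 0 then z else RtoC 0) (v m)) 0%Z).
cbv beta in h; destruct (Z.eq_dec 0 0); [|tauto]; apply h; intros n hn.
destruct (Z.eq_dec n 0); [tauto|apply (scal_zero_l (v n))].
Qed.

Lemma isT_chi (z : C) : isT s (chi z) (minus (scal z (one : BH)) b).
Proof.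
assert (h1 := is_zseries_dirac (V := BH_NormedModule) (vz s) z).
assert (h2 := is_zseries_minus _ _ _ _ h1 hb).
revert h2; apply is_zseries_ext; intros m.
apply BH_ext; intros y; apply l2_ext; intros j.
change ((if Z.eq_dec m 0 then z else RtoC 0) * vz s m y j + - (1) * (u m * vz s m y j) = chi z m * vz s m y j)%C.
unfold chi; ring.
Qed.

Lemma Phi_chi (z : C) (t : R) : Phi (chi z) t = (z - Phi u t)%C.
Proof.
destruct (hu 2%nat) as [A hA].
apply (is_zseries_unique (V := C_NormedModule) _ _ _ (Phi_spec _ _ t (chi_rdecay z 2 A hA))).
assert (h1 := is_zseries_dirac (V := C_NormedModule) (fun m => ez m t) z).
assert (h2 := is_zseries_minus _ _ _ _ h1 (Phi_spec u A t hA)).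
replace (z - Phi u t)%C with (plus (scal z (ez 0 t : C_NormedModule)) (opp (Phi u t : C_NormedModule)))
  by (rewrite ez_0; change (z * 1 + - Phi u t = z - Phi u t)%C; ring).
revert h2; apply is_zseries_ext; intros m.
change ((if Z.eq_dec m 0 then z else RtoC 0) * ez m t + - (u m * ez m t) = chi z m * ez m t)%C.
unfold chi; ring.
Qed.

Lemma c_eig (t : R) : eig s t c 0.
Proof.
destruct (c_decay 2) as [P [hP [h _]]]; apply (eig_col s t c P); intros k.
unfold wt; apply le_div_of_mult; [apply br_pow_pos|apply h, (one_unit s hs)].
Qed.

Lemma minus_plus_BH (x : BH) : minus x (plus b c) = minus (minus x b) c.
Proof. apply (minus_plus_r (G := BH_AbelianGroup)). Qed.

(** The perturbation [c] has symbol 0, so [z - a] has the symbol [z - phi], and the existence of a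
    left inverse bounds it away from 0. *)
Lemma symbol_bound (z : C) (B : BH) (t : R) :
  inverse_of (minus (scal z (one : BH)) (plus b c)) B -> 1 <= norm B * Cmod (z - Phi u t).
Proof.
intros [_ hB]; destruct (hu 3%nat) as [A hA].
apply (eig_zero_bound s hs t B _ _ hB).
rewrite minus_plus_BH, <- Phi_chi.
replace (Phi (chi z) t) with (Phi (chi z) t - 0)%C by ring.
apply eig_minus; [|apply c_eig].
apply (eig_T s hs t (chi z) _ _ _ (chi_rdecay z 3 A hA) (isT_chi z)).
apply (Phi_spec _ (Cmod z + A)); apply (rdecay_le 2 3); [lia|apply chi_rdecay, hA].
Qed.

Definition psi (z : C) : Z -> C := fourier_coef (fun t => / (z - Phi u t))%C.

(** Estimates proved under this hypothesis depend on [z] and [B] only through [K], and one [K]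
    serves a whole path. *)
Definition controlled (K : R) (z : C) (B : BH) : Prop :=
  inverse_of (minus (scal z (one : BH)) (plus b c)) B /\ norm B <= K /\ Cmod z <= K.

Lemma controlled_lower (K : R) (z : C) (B : BH) (t : R) : controlled K z B ->
  0 < K /\ / K <= Cmod (z - Phi u t).
Proof.
intros [hB [hK _]]; assert (h := symbol_bound z B t hB).
assert (h0 := BH_norm_ge_0 B); change (norm B) with (BH_norm B) in *.
assert (h1 := Cmod_ge_0 (z - Phi u t)).
assert (hp : 0 < K) by (destruct (Rle_lt_dec K 0); nra).
split; [exact hp|]; apply (Rmult_le_reg_l K); [exact hp|]; rewrite Rinv_r by lra; nra.
Qed.

(** The family is indexed by the controlled pairs themselves, so the constants that [UC_rdecay]
    extracts hold for all of them. *)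
Lemma symbol_UC (K : R) (n : nat) : 0 < K ->
  UC n (fun (p : {p : C * BH | controlled K (fst p) (snd p)}) t => / (fst (proj1_sig p) - Phi u t))%C.
Proof.
intros hK.
apply (UC_inv n (fun (p : {p : C * BH | controlled K (fst p) (snd p)}) t => fst (proj1_sig p) - Phi u t)%C (/ K)).
- apply Rinv_0_lt_compat, hK.
- intros [p hp] t; apply (controlled_lower K _ _ t hp).
- apply (UC_plus n (fun p _ => fst (proj1_sig p)) (fun _ t => - Phi u t)%C).
  + apply (UC_const n _ K); intros [p hp]; apply hp.
  + replace (fun (_ : {p : C * BH | controlled K (fst p) (snd p)}) t => - Phi u t)%C
      with (fun (_ : {p : C * BH | controlled K (fst p) (snd p)}) t => (- (1)) * Phi u t)%C
      by (apply functional_extensionality; intros _; apply functional_extensionality; intros t; ring).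
    apply UC_mult; [|apply UC_Phi, hu].
    apply (UC_const n (fun _ => (- (1))%C) 1); intros; rewrite Cmod_opp, Cmod_1; lra.
Qed.

Lemma psi_rdecay (K : R) (N : nat) : 0 < K ->
  exists D, forall z B, controlled K z B -> rdecay N (psi z) D.
Proof.
intros hK; destruct (UC_rdecay N _ (symbol_UC K N hK)) as [D HD]; exists D.
intros z B h; exact (HD (exist _ (z, B) h)).
Qed.

Lemma symbol_cont (K : R) (z : C) (B : BH) : controlled K z B ->
  C_cont (fun t => / (z - Phi u t))%C.
Proof.
intros h; destruct (controlled_lower K z B 0 h) as [hK _].
apply (symbol_UC K 0 hK) with (i := exist (fun p : C * BH => controlled K (fst p) (snd p)) (z, B) h).
Qed.

Lemma symbol_le (K : R) (z : C) (B : BH) (t : R) : controlled K z B ->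
  (z - Phi u t)%C <> 0 /\ Cmod (/ (z - Phi u t))%C <= K.
Proof.
intros h; destruct (controlled_lower K z B t h) as [hK hl].
assert (hi := Rinv_0_lt_compat K hK).
assert (hn : (z - Phi u t)%C <> 0) by (intros e; rewrite e, Cmod_0 in hl; lra).
split; [exact hn|]; rewrite Cmod_inv by exact hn; rewrite <- (Rinv_inv K).
apply Rinv_le_contravar; assumption.
Qed.

Lemma chi_psi_conv (K : R) (z : C) (B : BH) (m : Z) : controlled K z B ->
  is_zseries (V := C_NormedModule) (fun n => psi z n * chi z (m - n)%Z)%C
    (if Z.eq_dec m 0 then RtoC 1 else RtoC 0).
Proof.
intros h.
assert (h1 := fourier_coef_mult_Phi (chi z) _ K m (chi_rapid z) (symbol_cont K z B h)
  (fun t => proj2 (symbol_le K z B t h))).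
cbv beta in h1; replace (fun t => Phi (chi z) t * / (z - Phi u t))%C with (fun _ : R => RtoC 1) in h1.
2: { apply functional_extensionality; intros t; rewrite Phi_chi; symmetry; apply Cinv_r.
     apply (symbol_le K z B t h). }
rewrite fourier_coef_one in h1.
apply (is_zseries_reflect _ _ m) in h1.
revert h1; apply is_zseries_ext; intros n.
replace (m - (m - n))%Z with n by lia; apply Cmult_comm.
Qed.

Lemma resolvent_entries (K : R) (N : nat) : 0 < K -> exists C0, forall z B, controlled K z B ->
  forall i k l, ~ (s | l)%Z ->
  br (Z.of_nat (max i k)) ^ N * Cmod (B (E (pt s k l)) (pt s i l) - psi z (Z.of_nat i - Z.of_nat k)) <= C0.
Proof.
intros hK; destruct (psi_rdecay K (N + 4) hK) as [D HD], (hu 2%nat) as [A hA], (c_decay N) as [P [hP [c1 c2]]].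
exists (K * ((K + A) * D * wtot * wtot + P * D * wtot)); intros z B h i k l hl.
assert (hpsi := HD z B h).
destruct (isT_exists s hs (psi z) D) as [Y hY]; [apply (rdecay_le 2 (N + 4)); [lia|exact hpsi]|].
assert (hchi : rdecay 2 (chi z) (K + A)).
{ intros m; eapply Rle_trans; [apply (chi_rdecay z 2 A hA)|]; apply Rplus_le_compat_r, h. }
assert (hB : inverse_of (minus (minus (scal z (one : BH)) b) c) B) by (rewrite <- minus_plus_BH; apply h).
assert (H := resolvent_entry_decay s hs _ _ _ _ N _ _ hchi hpsi (isT_chi z) hY
  (fun m => chi_psi_conv K z B m h) c B P hP c1 c2 hB k i l l hl hl).
rewrite (isT_entry s hs _ Y k i l l hY hl hl) in H; destruct (Z.eq_dec l l); [|tauto].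
eapply Rle_trans; [exact H|]; apply Rmult_le_compat_r; [|apply h].
assert (hA0 := rdecay_ge_0 _ _ _ hchi); assert (hD := rdecay_ge_0 _ _ _ hpsi); assert (hw := wtot_ge_1).
apply Rplus_le_le_0_compat; repeat apply Rmult_le_pos; lra.
Qed.

(** On [E 0] the operator [z - a] acts as [lam], the sum of the coefficients [chi], so [B] acts as
    its inverse. That this inverse is the sum [beta] of the coefficients [psi] follows from the
    symbols at 0: [1 - X Y] has symbol [1 - lam * beta], and it has symbol 0 because its columns
    decay. *)
Lemma resolvent_E_0 (K : R) (z : C) (B : BH) : controlled K z B ->
  exists beta, is_zseries (V := C_NormedModule) (psi z) beta /\ B (E 0) = scal beta (E 0).
Proof.
intros h; destruct (controlled_lower K z B 0 h) as [hK _].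
(* [parametrix_col] needs exponent 6 to give columns that decay with exponent 2, as [eig_col] asks;
   exponent 3 is for [eig_T]. *)
destruct (psi_rdecay K 6 hK) as [D HD], (hu 3%nat) as [A hA].
assert (hpsi := HD z B h).
assert (hp2 : rdecay 2 (psi z) D) by (apply (rdecay_le 2 6); [lia|exact hpsi]).
assert (hchi := chi_rdecay z 3 A hA).
assert (hc2 : rdecay 2 (chi z) (Cmod z + A)) by (apply (rdecay_le 2 3); [lia|exact hchi]).
destruct (isT_exists s hs (psi z) D hp2) as [Y hY].
destruct (ex_zseries_C _ _ (rdecay_wt _ _ hp2)) as [beta hbeta].
destruct (ex_zseries_C _ _ (rdecay_wt _ _ hc2)) as [lam hlam].
assert (hat0 : forall v l, is_zseries (V := C_NormedModule) v l ->
  is_zseries (V := C_NormedModule) (fun m => v m * ez m 0)%C l).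
{ intros v l0; apply is_zseries_ext; intros m; rewrite ez_at_0; symmetry; apply Cmult_1_r. }
assert (hX := eig_T s hs 0 _ _ _ lam hchi (isT_chi z) (hat0 _ _ hlam)).
assert (hY' := eig_T s hs 0 _ _ _ beta (rdecay_le 3 6 _ _ ltac:(lia) hpsi) hY (hat0 _ _ hbeta)).
assert (h1 := eig_minus s 0 _ _ _ _ (eig_one s 0) (eig_mult s 0 _ _ _ _ hX hY')).
set (X := minus (scal z (one : BH)) b) in *.
assert (h2 : eig s 0 (minus one (mult X Y)) 0).
{ apply (eig_col s 0 _ ((Cmod z + A) * D * wtot * wtot)); intros k.
  exact (parametrix_col s hs _ _ _ _ 2 _ _ hc2 hpsi (isT_chi z) hY
    (fun m => chi_psi_conv K z B m h) k 1 (one_unit s hs)). }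
assert (e := eig_unique s hs 0 _ _ _ h1 h2).
assert (e1 : (lam * beta)%C = 1) by (transitivity (1 - (1 - lam * beta))%C; [ring|rewrite e; ring]).
exists beta; split; [exact hbeta|].
assert (hH : minus (scal z (one : BH)) (plus b c) = minus X c) by apply minus_plus_BH.
destruct h as [[_ hB] _]; rewrite hH in hB.
assert (e2 : B (minus (X (E 0)) (c (E 0))) = E 0).
{ change ((mult B (minus X c) : BH) (E 0) = E 0); rewrite hB; reflexivity. }
rewrite c_E_0, (isT_E_0 s hs _ X lam (isT_chi z) hlam) in e2.
rewrite (linear_minus B _ _ (op_linear B)), (linear_scal B (op_linear B)) in e2.
rewrite (linear_zero B (op_linear B) : B (zero : l2) = zero) in e2.
rewrite <- e2 at 2; apply l2_ext; intros j.
change (B (E 0) j = beta * (lam * B (E 0) j + - (1) * 0))%C.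
transitivity (lam * beta * B (E 0) j)%C; [rewrite e1|]; ring.
Qed.

End Resolvent.

(** * Contour integrals of the resolvent *)

(* The smooth algebra in terms of matrix entries: up to a rapidly decreasing Toeplitz part, the
   block of [b] at [l] is a rapidly decreasing matrix, locally uniformly continuous in [l]; on
   [E 0] the operator acts through the value of the symbol at [0]. *)
Definition smooth_entries (s : Z) (b : BH) : Prop :=
  exists (u : Z -> C) (beta : C), rapid u /\ is_zseries (V := C_NormedModule) u beta /\
    b (E 0) = scal beta (E 0) /\
    (forall N, exists K, forall i k l, ~ (s | l)%Z ->
      br (Z.of_nat (max i k)) ^ N *
        Cmod (b (E (pt s k l)) (pt s i l) - u (Z.of_nat i - Z.of_nat k)%Z) <= K) /\
    (forall k l, ~ (s | l)%Z -> b (E (pt s k l)) 0%Z = 0 /\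
      forall i l', ~ (s | l')%Z -> l' <> l -> b (E (pt s k l)) (pt s i l') = 0) /\
    (forall x : Zs s, Zs_unit x -> forall eps, 0 < eps -> exists K, forall l1 l2,
      ~ (s | l1)%Z -> ~ (s | l2)%Z -> agree s K x l1 -> agree s K x l2 -> forall i k,
      Cmod (b (E (pt s k l1)) (pt s i l1) - b (E (pt s k l2)) (pt s i l2)) <= eps).

Lemma C_RInt_unique (f : R -> C) (v w : C) : is_RInt (V := C_R_NormedModule) f 0 1 v ->
  is_RInt (V := C_R_NormedModule) f 0 1 w -> v = w.
Proof. exact (filterlim_locally_unique (V := C_R_NormedModule) _ v w). Qed.

Lemma ex_C_RInt (f : R -> C) : C_cont f -> exists v, is_RInt (V := C_R_NormedModule) f 0 1 v.
Proof.
intros hf.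
exact (ex_RInt_continuous (V := C_R_CompleteNormedModule) f 0 1 (fun t _ => hf t)).
Qed.

Lemma C_cont_eps (f : R -> C) : C_cont f <->
  forall t eps, 0 < eps -> locally t (fun t' => Cmod (f t' - f t) < eps).
Proof.
split; intros H t.
- intros eps he; apply (H t (fun z => Cmod (z - f t) < eps)), locally_Cmod, he.
- apply (proj2 (filterlim_locally (U := C_UniformSpace) f (f t))); intros eps.
  apply (filter_imp _ _) with (2 := H t eps (cond_pos eps)); intros t' h.
  apply C_ball_Cmod, h.
Qed.

Lemma BH_continuous_eps (f : R -> BH) (t : R) :
  (forall eps, 0 < eps -> locally t (fun t' => norm (minus (f t') (f t)) < eps)) ->
  continuous (U := BH_UniformSpace) f t.
Proof.
intros H; apply (proj2 (filterlim_locally (U := BH_UniformSpace) f (f t))); intros eps.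
apply (H eps (cond_pos eps)).
Qed.

(* The paths are controlled on [0, 1] only; composing with [clamp] makes the integrands continuous
   on all of R. *)
Definition clamp (t : R) : R := Rmax 0 (Rmin 1 t).

Lemma clamp_range (t : R) : 0 <= clamp t <= 1.
Proof.
unfold clamp, Rmax, Rmin; destruct (Rle_dec 1 t); destruct (Rle_dec 0 _); lra.
Qed.

Lemma clamp_id (t : R) : 0 <= t <= 1 -> clamp t = t.
Proof.
intros h; unfold clamp, Rmax, Rmin; destruct (Rle_dec 1 t); destruct (Rle_dec 0 _); lra.
Qed.

Lemma clamp_lip (t t' : R) : Rabs (clamp t' - clamp t) <= Rabs (t' - t).
Proof.
unfold clamp, Rmax, Rmin; destruct (Rle_dec 1 t), (Rle_dec 1 t');
  repeat destruct (Rle_dec 0 _); unfold Rabs; repeat destruct Rcase_abs; lra.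
Qed.

Lemma clamp_cont (f : R -> C) : (forall t, 0 <= t <= 1 -> continuous (U := C_UniformSpace) f t) ->
  C_cont (fun t => f (clamp t)).
Proof.
intros H t; apply (continuous_comp clamp f); [|apply H, clamp_range].
apply (proj2 (filterlim_locally clamp (clamp t))); intros eps; exists eps; intros t' h.
eapply Rle_lt_trans; [apply clamp_lip|exact h].
Qed.

Lemma clamp_bounded (f : R -> C) : C_cont (fun t => f (clamp t)) -> exists K, forall t, Cmod (f (clamp t)) <= K.
Proof.
intros H; destruct (bounded_continuity (V := C_R_NormedModule) (fun t => f (clamp t)) 0 1) as [K hK].
- intros t _; apply H.
- exists K; intros t; rewrite <- (clamp_id (clamp t)) by apply clamp_range.
  rewrite <- C_R_norm; left; apply hK, clamp_range.
Qed.

(** Entries of an operator-valued integral are the integrals of the entries. *)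
Lemma entry_R_linear (y : l2) (j : Z) :
  is_linear (U := realify BH_NormedModule) (V := C_R_NormedModule) (fun a : BH => a y j).
Proof.
destruct (linear_norm _ (entry_linear y j)) as [M [hM HM]].
apply Build_is_linear; [reflexivity| |].
- intros k a; transitivity (RtoC k * a y j)%C; [reflexivity|].
  apply injective_projections; simpl; unfold scal; simpl; unfold mult; simpl; ring.
- exists M; split; [exact hM|]; intros a; rewrite C_R_norm; apply HM.
Qed.

Lemma resolvent_identity (a : BH) (z z0 : C) (B B0 : BH) :
  inverse_of (minus (scal z (one : BH)) a) B -> inverse_of (minus (scal z0 (one : BH)) a) B0 ->
  norm (minus B B0) <= Cmod (z - z0) * norm B * norm B0.
Proof.
intros [_ h1] [h2 _].
assert (e : minus B B0 = scal (z0 - z)%C (mult B B0 : BH)).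
{ apply BH_ext; intros y.
  set (x := B0 y).
  assert (e2 : y = minus (scal z0 x) (a x)).
  { change (y = (mult (minus (scal z0 (one : BH)) a) B0 : BH) y); rewrite h2; reflexivity. }
  assert (e1 : x = B (minus (scal z x) (a x))).
  { change (x = (mult B (minus (scal z (one : BH)) a) : BH) x); rewrite h1; reflexivity. }
  change (minus (B y) x = scal (z0 - z)%C (B x)).
  transitivity (minus (B (minus (scal z0 x) (a x))) (B (minus (scal z x) (a x))));
    [rewrite <- e2, <- e1; reflexivity|].
  rewrite !(linear_minus B _ _ (op_linear B)), !(linear_scal B (op_linear B)).
  apply l2_ext; intros j.
  change (z0 * B x j + - (1) * B (a x) j + - (1) * (z * B x j + - (1) * B (a x) j) = (z0 - z) * B x j)%C; ring. }
rewrite e; eapply Rle_trans; [apply norm_scal_BH|].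
replace (z0 - z)%C with (- (z - z0))%C by ring; rewrite Cmod_opp, Rmult_assoc.
apply Rmult_le_compat_l; [apply Cmod_ge_0|apply norm_mult_le].
Qed.

(** No bound for [B] is given in advance. With [q = norm (B - B0)] the resolvent identity and
    [norm B <= norm B0 + q] bound [q] by [d / 2] plus at most half of [q], which is absorbed. *)
Lemma resolvent_local (a : BH) (z z0 : C) (B B0 : BH) (d : R) : d <= 1 / 2 ->
  inverse_of (minus (scal z (one : BH)) a) B -> inverse_of (minus (scal z0 (one : BH)) a) B0 ->
  Cmod (z - z0) * (norm B0 * (norm B0 + 1)) <= d / 2 -> norm (minus B B0) <= d.
Proof.
intros hd hB hB0 hz; assert (h := resolvent_identity a z z0 B B0 hB hB0).
assert (n0 : 0 <= norm B0) by apply BH_norm_ge_0.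
assert (nB : 0 <= norm B) by apply BH_norm_ge_0.
assert (nc := Cmod_ge_0 (z - z0)).
assert (ht : norm B <= norm B0 + norm (minus B B0)).
{ replace B with (plus B0 (minus B B0)) at 1.
  - exact (norm_triangle (V := BH_NormedModule) B0 (minus B B0)).
  - apply BH_ext; intros y; apply l2_ext; intros j.
    change (B0 y j + (B y j + - (1) * B0 y j) = B y j)%C; ring. }
set (q := norm (minus B B0)) in *; set (m := norm B0) in *; set (p := norm B) in *.
set (e := Cmod (z - z0)) in *.
assert (hq : 0 <= q) by apply BH_norm_ge_0.
assert (hem : 0 <= e * m) by (apply Rmult_le_pos; assumption).
assert (hemm : 0 <= e * m * m) by (apply Rmult_le_pos; assumption).
assert (h1 : e * m * p <= e * m * (m + q)) by (apply Rmult_le_compat_l; lra).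
assert (h3 : e * m * m + e * m <= d / 2) by lra.
assert (h4 : e * m * q <= d / 2 * q) by (apply Rmult_le_compat_r; lra).
assert (h5 : d / 2 * q <= q / 2) by nra.
lra.
Qed.

(** * The integral along a single path *)

Section PathIntegral.
Variables (s : Z) (hs : (2 <= s)%Z) (u : Z -> C) (b c : BH) (F : Z -> nat * Zs s -> C).
Hypotheses (hu : rapid u) (hb : isT s u b) (hF : rapid_decay F).
Hypothesis hF0 : forall n, C0_on (fun p : nat * Zs s => Zs_unit (snd p)) (F n).
Hypothesis hc : is_zseries (V := BH_NormedModule) (iterm s F) c.
Variables (w z : R -> C) (B : R -> BH).
Hypotheses (hw : C_cont (fun t => w (clamp t))) (hz : C_cont (fun t => z (clamp t))).
Hypothesis hB : forall t, 0 <= t <= 1 -> inverse_of (minus (scal (z t) (one : BH)) (plus b c)) (B t).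

Lemma resolvent_clamp (t : R) : inverse_of (minus (scal (z (clamp t)) (one : BH)) (plus b c)) (B (clamp t)).
Proof. apply hB, clamp_range. Qed.

Lemma B_eps (t eps : R) : 0 < eps -> locally t (fun t' => norm (minus (B (clamp t')) (B (clamp t))) < eps).
Proof.
intros he; set (B0 := B (clamp t)).
assert (n0 : 0 <= norm B0) by apply BH_norm_ge_0.
set (d := Rmin (1 / 2) (eps / 2)).
assert (hd : 0 < d) by (unfold d, Rmin; destruct (Rle_dec _ _); lra).
assert (hd1 : d <= 1 / 2) by apply Rmin_l.
assert (hd2 : d <= eps / 2) by apply Rmin_r.
assert (hm : 0 < norm B0 * (norm B0 + 1) + 1) by nra.
assert (h : 0 < d / 2 / (norm B0 * (norm B0 + 1) + 1)) by (apply Rdiv_lt_0_compat; lra).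
apply (filter_imp _ _) with (2 := proj1 (C_cont_eps _) hz t _ h); intros t' ht.
apply Rle_lt_trans with d; [|lra].
apply (resolvent_local (plus b c) (z (clamp t')) (z (clamp t)) _ _ d hd1 (resolvent_clamp t') (resolvent_clamp t)).
fold B0; set (m := norm B0 * (norm B0 + 1)) in *.
assert (nc := Cmod_ge_0 (z (clamp t') - z (clamp t))).
apply Rle_trans with (Cmod (z (clamp t') - z (clamp t)) * (m + 1)); [nra|].
apply Rle_trans with (d / 2 / (m + 1) * (m + 1)); [|right; field; lra].
apply Rmult_le_compat_r; lra.
Qed.

Lemma wB_continuous (t : R) :
  continuous (U := BH_UniformSpace) (fun t => scal (w (clamp t)) (B (clamp t)) : BH) t.
Proof.
apply BH_continuous_eps; intros eps he.
set (B0 := B (clamp t)); set (w0 := w (clamp t)).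
assert (n0 : 0 <= norm B0) by apply BH_norm_ge_0.
assert (c0 := Cmod_ge_0 w0).
set (e1 := Rmin 1 (eps / (2 * (Cmod w0 + 1)))).
assert (he1 : 0 < e1).
{ unfold e1, Rmin; destruct (Rle_dec _ _); [lra|]; apply Rdiv_lt_0_compat; lra. }
assert (h1 : e1 <= 1) by apply Rmin_l.
assert (h2 : e1 * (2 * (Cmod w0 + 1)) <= eps).
{ apply Rle_trans with (eps / (2 * (Cmod w0 + 1)) * (2 * (Cmod w0 + 1))); [|right; field; lra].
  apply Rmult_le_compat_r; [lra|apply Rmin_r]. }
assert (he2 : 0 < eps / (4 * (norm B0 + 1))) by (apply Rdiv_lt_0_compat; lra).
apply (filter_imp _ _) with (2 := filter_and _ _ (B_eps t e1 he1) (proj1 (C_cont_eps _) hw t _ he2)).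
intros t' [k1 k2]; fold B0 in k1; fold w0 in k2.
set (B1 := B (clamp t')) in *; set (w1 := w (clamp t')) in *.
assert (e : minus (scal w1 B1 : BH) (scal w0 B0) =
  plus (scal (w1 - w0)%C (plus B0 (minus B1 B0)) : BH) (scal w0 (minus B1 B0))).
{ apply BH_ext; intros y; apply l2_ext; intros j.
  change (w1 * B1 y j + - (1) * (w0 * B0 y j) =
    (w1 - w0) * (B0 y j + (B1 y j + - (1) * B0 y j)) + w0 * (B1 y j + - (1) * B0 y j))%C; ring. }
change (norm (minus (scal w1 B1 : BH) (scal w0 B0)) < eps); rewrite e.
eapply Rle_lt_trans; [apply (norm_triangle (V := BH_NormedModule))|].
assert (k3 := norm_scal_BH (w1 - w0)%C (plus B0 (minus B1 B0))).
assert (k4 := norm_scal_BH w0 (minus B1 B0)).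
assert (k5 := norm_triangle (V := BH_NormedModule) B0 (minus B1 B0)).
change (BH_norm (scal (w1 - w0)%C (plus B0 (minus B1 B0)) : BH) + BH_norm (scal w0 (minus B1 B0) : BH) < eps).
change (BH_norm (scal (w1 - w0)%C (plus B0 (minus B1 B0)) : BH) <= Cmod (w1 - w0) * BH_norm (plus B0 (minus B1 B0))) in k3.
change (BH_norm (scal w0 (minus B1 B0) : BH) <= Cmod w0 * BH_norm (minus B1 B0)) in k4.
change (BH_norm (plus B0 (minus B1 B0)) <= BH_norm B0 + BH_norm (minus B1 B0)) in k5.
change (BH_norm (minus B1 B0) < e1) in k1.
change (norm B0) with (BH_norm B0) in *.
assert (c1 := Cmod_ge_0 (w1 - w0)).
assert (k6 : Cmod (w1 - w0) * BH_norm (plus B0 (minus B1 B0)) <= Cmod (w1 - w0) * (BH_norm B0 + 1))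
  by (apply Rmult_le_compat_l; lra).
assert (k7 : Cmod (w1 - w0) * (BH_norm B0 + 1) <= eps / 4).
{ apply Rle_trans with (eps / (4 * (BH_norm B0 + 1)) * (BH_norm B0 + 1)); [|right; field; lra].
  apply Rmult_le_compat_r; lra. }
assert (k8 : Cmod w0 * BH_norm (minus B1 B0) <= Cmod w0 * e1) by (apply Rmult_le_compat_l; lra).
lra.
Qed.

Lemma path_bound : exists K, 0 < K /\ forall t,
  controlled b c K (z (clamp t)) (B (clamp t)) /\ Cmod (w (clamp t)) <= K.
Proof.
destruct (clamp_bounded w hw) as [K1 h1], (clamp_bounded z hz) as [K2 h2].
(* The resolvent is continuous along the path, so its norm is bounded on the compact parameter
   interval. *)
destruct (bounded_continuity (V := R_NormedModule) (fun t => BH_norm (B (clamp t))) 0 1) as [K3 h3].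
{ intros t _; apply (filterlim_comp _ _ _ (fun t => B (clamp t)) BH_norm _ (locally (T := BH_UniformSpace) (B (clamp t)))).
  - exact (BH_continuous_eps (fun t => B (clamp t)) t (fun eps he => B_eps t eps he)).
  - apply (filterlim_norm (V := BH_NormedModule)). }
exists (Rmax 1 (Rmax K1 (Rmax K2 K3))); split.
{ apply Rlt_le_trans with 1; [lra|apply Rmax_l]. }
assert (m1 : K1 <= Rmax 1 (Rmax K1 (Rmax K2 K3))) by (eapply Rle_trans; [|apply Rmax_r]; apply Rmax_l).
assert (m2 : K2 <= Rmax 1 (Rmax K1 (Rmax K2 K3)))
  by (eapply Rle_trans; [|apply Rmax_r]; eapply Rle_trans; [|apply Rmax_r]; apply Rmax_l).
assert (m3 : K3 <= Rmax 1 (Rmax K1 (Rmax K2 K3)))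
  by (eapply Rle_trans; [|apply Rmax_r]; eapply Rle_trans; [|apply Rmax_r]; apply Rmax_r).
intros t; split; [split; [apply resolvent_clamp|split]|].
- specialize (h3 (clamp t) (clamp_range t)); rewrite clamp_id in h3 by apply clamp_range.
  change (Rabs (BH_norm (B (clamp t))) < K3) in h3.
  assert (h4 := Rle_abs (BH_norm (B (clamp t)))); change (norm (B (clamp t))) with (BH_norm (B (clamp t))); lra.
- specialize (h2 t); lra.
- specialize (h1 t); lra.
Qed.

(** The reciprocals at two points of the path differ by at most [K * K] times the distance of the
    points, uniformly on the circle, and so do their Fourier coefficients. *)
Lemma psi_cont (m : Z) : C_cont (fun t => psi u (z (clamp t)) m).
Proof.
destruct path_bound as [K [hK H]]; apply C_cont_eps; intros t eps he.
assert (hd : 0 < eps / (K * K + 1)) by (apply Rdiv_lt_0_compat; nra).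
apply (filter_imp _ _) with (2 := proj1 (C_cont_eps _) hz t _ hd); intros t' ht.
destruct (H t) as [H0 _], (H t') as [H1 _].
set (z0 := z (clamp t)) in *; set (z1 := z (clamp t')) in *.
assert (s0 := fun x => symbol_le s hs u b c F hu hb hF hc K z0 _ x H0).
assert (s1 := fun x => symbol_le s hs u b c F hu hb hF hc K z1 _ x H1).
assert (c0 := symbol_cont s hs u b c F hu hb hF hc K z0 _ H0).
assert (c1 := symbol_cont s hs u b c F hu hb hF hc K z1 _ H1).
assert (hi := is_RInt_minus (V := C_R_NormedModule) _ _ _ _ _ _ (is_fourier_coef _ m c1) (is_fourier_coef _ m c0)).
unfold psi; apply Rle_lt_trans with (Cmod (z1 - z0) * (K * K)).
- apply (is_RInt_C_le _ _ _) with (2 := hi); intros x _.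
  change (Cmod (/ (z1 - Phi u x) * ez (- m) x - / (z0 - Phi u x) * ez (- m) x) <= Cmod (z1 - z0) * (K * K)).
  destruct (s0 x) as [n0 b0], (s1 x) as [n1 b1].
  replace (/ (z1 - Phi u x) * ez (- m) x - / (z0 - Phi u x) * ez (- m) x)%C
    with (- (z1 - z0) * (/ (z1 - Phi u x) * / (z0 - Phi u x)) * ez (- m) x)%C by (field; split; assumption).
  rewrite !Cmod_mult, ez_mod, Cmod_opp, Rmult_1_r.
  apply Rmult_le_compat_l; [apply Cmod_ge_0|]; apply Rmult_le_compat; auto; apply Cmod_ge_0.
- assert (nc := Cmod_ge_0 (z1 - z0)).
  apply Rle_lt_trans with (Cmod (z1 - z0) * (K * K + 1)); [nra|].
  apply Rlt_le_trans with (eps / (K * K + 1) * (K * K + 1)); [|right; field; nra].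
  apply Rmult_lt_compat_r; [nra|exact ht].
Qed.

Lemma path_integral_smooth : exists v : BH,
  is_RInt (V := realify BH_NormedModule) (fun t => scal (w (clamp t)) (B (clamp t)) : BH) 0 1 v /\
  smooth_entries s v.
Proof.
destruct (ex_RInt_continuous (V := BH_R_CompleteNormedModule)
  (fun t => scal (w (clamp t)) (B (clamp t)) : BH) 0 1 (fun t _ => wB_continuous t)) as [v hv].
exists v; split; [exact hv|].
assert (He : forall y j, is_RInt (V := C_R_NormedModule) (fun t => w (clamp t) * B (clamp t) y j)%C 0 1 (v y j)).
{ intros y j; exact (is_RInt_linear (U := realify BH_NormedModule) (V := C_R_NormedModule)
    (fun a : BH => a y j) _ 0 1 v (entry_R_linear y j) hv). }
destruct path_bound as [K [hK H]].
(* The Toeplitz coefficients of the integral are the integrals of those of the resolvents. *)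
assert (Hu : forall m, exists um, is_RInt (V := C_R_NormedModule)
  (fun t => w (clamp t) * psi u (z (clamp t)) m)%C 0 1 um).
{ intros m; apply ex_C_RInt, (C_cont_mult (fun t => w (clamp t)) (fun t => psi u (z (clamp t)) m) hw (psi_cont m)). }
destruct (ex_choice _ Hu) as [um hum].
assert (Hbeta : forall t, exists beta, is_zseries (V := C_NormedModule) (psi u (z (clamp t))) beta /\
  B (clamp t) (E 0) = scal beta (E 0)).
{ intros t; apply (resolvent_E_0 s hs u b c F hu hb hF hc K), H. }
destruct (ex_choice _ Hbeta) as [beta hbeta].
destruct (psi_rdecay s hs u b c F hu hb hF hc K 2 hK) as [D2 hD2].
(* Termwise integration: the new coefficients sum to the integral of the values on [E 0], which ties
   [E 0] to the blocks. *)
destruct (is_RInt_zseries (fun m t => w (clamp t) * psi u (z (clamp t)) m)%C um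
  (fun t => w (clamp t) * beta t)%C (K * D2)) as [I [hI1 hI2]].
{ exact hum. }
{ intros m t; rewrite Cmod_mult, Rmult_assoc; apply Rmult_le_compat; try apply Cmod_ge_0; [apply H|].
  apply rdecay_wt; apply (hD2 _ (B (clamp t))), H. }
{ intros t; exact (is_zseries_Cmul (w (clamp t)) _ _ (proj1 (hbeta t))). }
exists um, I; split; [|split; [exact hI2|split; [|split; [|split]]]].
- intros N; destruct (psi_rdecay s hs u b c F hu hb hF hc K N hK) as [D hD].
  exists (K * D); intros m; assert (hp := br_pow_pos m N).
  assert (h : Cmod (um m) <= (K * D) / br m ^ N).
  { apply (is_RInt_C_le _ _ _) with (2 := hum m); intros t _.
    rewrite Cmod_mult; unfold Rdiv; rewrite Rmult_assoc.
    apply Rmult_le_compat; try apply Cmod_ge_0; [apply H|].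
    apply le_div_of_mult; [exact hp|]; apply (hD _ (B (clamp t))), H. }
  apply (Rmult_le_compat_l (br m ^ N)) in h; [|lra].
  eapply Rle_trans; [exact h|right; field; lra].
- apply l2_ext; intros j.
  apply (C_RInt_unique _ _ _ (He (E 0) j)).
  change (scal I (E 0) j) with (I * E 0 j)%C; rewrite Cmult_comm.
  assert (h := is_RInt_Cmul (E 0 j) _ _ _ _ hI1); revert h; apply is_RInt_ext; intros t _.
  change (E 0 j * (w (clamp t) * beta t) = w (clamp t) * B (clamp t) (E 0) j)%C.
  rewrite (proj2 (hbeta t)), l2_scal_coord; ring.
- intros N; destruct (resolvent_entries s hs u b c F hu hb hF hc K N hK) as [C0 hC0].
  exists (K * C0); intros i k l hl; assert (hp := br_pow_pos (Z.of_nat (max i k)) N).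
  assert (h : Cmod (v (E (pt s k l)) (pt s i l) - um (Z.of_nat i - Z.of_nat k)%Z)
    <= K * C0 / br (Z.of_nat (max i k)) ^ N).
  { apply (is_RInt_C_le _ _ _) with (2 := is_RInt_minus (V := C_R_NormedModule) _ _ _ _ _ _ (He _ _) (hum _)).
    intros t _.
    change (Cmod (w (clamp t) * B (clamp t) (E (pt s k l)) (pt s i l)
      - w (clamp t) * psi u (z (clamp t)) (Z.of_nat i - Z.of_nat k)%Z) <= K * C0 / br (Z.of_nat (max i k)) ^ N).
    replace (w (clamp t) * B (clamp t) (E (pt s k l)) (pt s i l)
      - w (clamp t) * psi u (z (clamp t)) (Z.of_nat i - Z.of_nat k)%Z)%C
      with (w (clamp t) * (B (clamp t) (E (pt s k l)) (pt s i l) - psi u (z (clamp t)) (Z.of_nat i - Z.of_nat k)%Z))%C by ring.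
    rewrite Cmod_mult; unfold Rdiv; rewrite Rmult_assoc.
    apply Rmult_le_compat; try apply Cmod_ge_0; [apply H|].
    apply le_div_of_mult; [exact hp|]; apply hC0; [apply H|exact hl]. }
  apply (Rmult_le_compat_l (br (Z.of_nat (max i k)) ^ N)) in h; [|lra].
  eapply Rle_trans; [exact h|right; field; lra].
- intros k l hl.
  assert (Z0 : forall j, (forall t, B (clamp t) (E (pt s k l)) j = 0) -> v (E (pt s k l)) j = 0).
  { intros j hj; apply Cmod_eq_0, Rle_antisym; [|apply Cmod_ge_0].
    apply (is_RInt_C_le _ _ _) with (2 := He _ _); intros t _; rewrite hj, Cmult_0_r, Cmod_0; lra. }
  split; [|intros i l' hl' hne]; apply Z0; intros t;
    apply (resolvent_block s hs u b c F hb hF hc _ _ k l (resolvent_clamp t) hl); assumption.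
- intros x hx eps he.
  assert (ht : 1 <= wtot) by apply wtot_ge_1.
  assert (hp : 0 < K * (K * K * wtot)) by (repeat apply Rmult_lt_0_compat; lra).
  (* One factor [K] bounds the weight [w], two bound the resolvents in [resolvent_entry_diff], and
     [wtot] comes from summing over [n]. *)
  destruct (F_uniform s hs F hF hF0 x (eps / (K * (K * K * wtot))) hx) as [K0 hK0].
  { apply Rdiv_lt_0_compat; lra. }
  exists K0; intros l1 l2 h1 h2 a1 a2 i k.
  apply (is_RInt_C_le _ _ _) with (2 := is_RInt_minus (V := C_R_NormedModule) _ _ _ _ _ _ (He _ _) (He _ _)).
  intros t _.
  change (Cmod (w (clamp t) * B (clamp t) (E (pt s k l1)) (pt s i l1)
      - w (clamp t) * B (clamp t) (E (pt s k l2)) (pt s i l2)) <= eps).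
  replace (w (clamp t) * B (clamp t) (E (pt s k l1)) (pt s i l1)
      - w (clamp t) * B (clamp t) (E (pt s k l2)) (pt s i l2))%C
    with (w (clamp t) * (B (clamp t) (E (pt s k l1)) (pt s i l1) - B (clamp t) (E (pt s k l2)) (pt s i l2)))%C by ring.
  rewrite Cmod_mult.
  assert (hd := resolvent_entry_diff s hs u b c F hb hF hc _ _ l1 l2 _ i k (resolvent_clamp t) h1 h2 (hK0 l1 l2 h1 h2 a1 a2)).
  destruct (H t) as [[_ [hBn _]] hw'].
  assert (n0 : 0 <= norm (B (clamp t))) by apply BH_norm_ge_0.
  set (e' := eps / (K * (K * K * wtot))) in *.
  assert (he' : 0 <= e' * wtot) by (apply Rmult_le_pos; [left; apply Rdiv_lt_0_compat|]; lra).
  apply Rle_trans with (K * (K * K * (e' * wtot))).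
  + apply Rmult_le_compat; try apply Cmod_ge_0; [exact hw'|].
    eapply Rle_trans; [exact hd|]; apply Rmult_le_compat_r; [exact he'|].
    apply Rmult_le_compat; assumption.
  + right; unfold e'; field; lra.
Qed.

End PathIntegral.

(** * From smooth matrix entries back to the smooth algebra *)

Section Extension.
Variables (s : Z) (hs : (2 <= s)%Z).

(** Integers that converge to [x]. With [S n] at least one digit is kept, so they are not divisible
    by [s] when [x] is a unit. *)
Definition rep (x : Zs s) (n : nat) : Z := zs_res x (S n).

Lemma rep_unit (x : Zs s) (n : nat) : Zs_unit x -> ~ (s | rep x n)%Z.
Proof.
intros hx h; apply hx; unfold rep in h.
rewrite <- (zs_compat s x 1 (S n)) by lia; change (Z.of_nat 1) with 1%Z; rewrite Z.pow_1_r.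
apply Z.mod_divide; [lia|exact h].
Qed.

Lemma rep_agree (x : Zs s) (n K : nat) : (K <= S n)%nat -> agree s K x (rep x n).
Proof. intros h; exact (zs_compat s x K (S n) h). Qed.

Section ContinuousExtension.
Variable f : Z -> C.
Hypothesis hf : forall x : Zs s, Zs_unit x -> forall eps, 0 < eps -> exists K, forall l1 l2,
  ~ (s | l1)%Z -> ~ (s | l2)%Z -> agree s K x l1 -> agree s K x l2 -> Cmod (f l1 - f l2) <= eps.

(** The limit of [f l] as the integers [l] not divisible by [s] tend to [x]. *)
Definition ext (x : Zs s) : C := epsilon (inhabits (RtoC 0)) (fun L => forall eps, 0 < eps ->
  exists K, forall l, ~ (s | l)%Z -> agree s K x l -> Cmod (f l - L) <= eps).

Lemma ext_spec (x : Zs s) : Zs_unit x -> forall eps, 0 < eps ->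
  exists K, forall l, ~ (s | l)%Z -> agree s K x l -> Cmod (f l - ext x) <= eps.
Proof.
intros hx; apply (epsilon_spec (inhabits (RtoC 0)) (fun L => forall eps, 0 < eps ->
  exists K, forall l, ~ (s | l)%Z -> agree s K x l -> Cmod (f l - L) <= eps)).
destruct (C_cauchy_lim (fun n => f (rep x n))) as [L HL].
- intros eps he; destruct (hf x hx eps he) as [K HK]; exists K; intros n m hn hm.
  apply HK; try apply rep_unit, hx; apply rep_agree; lia.
- exists L; intros eps he; assert (he2 : 0 < eps / 2) by lra.
  destruct (hf x hx _ he2) as [K HK], (HL _ he2) as [n0 Hn]; exists K; intros l hl ha.
  replace (f l - L)%C with ((f l - f (rep x (max n0 K))) + (f (rep x (max n0 K)) - L))%C by ring.
  eapply Rle_trans; [apply Cmod_triangle|].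
  assert (h1 := HK l (rep x (max n0 K)) hl (rep_unit x _ hx) ha (rep_agree x (max n0 K) K ltac:(lia))).
  assert (h2 := Hn (max n0 K) ltac:(lia)); lra.
Qed.

Lemma ext_le (x : Zs s) (B : R) : Zs_unit x -> (forall l, ~ (s | l)%Z -> Cmod (f l) <= B) ->
  Cmod (ext x) <= B.
Proof.
intros hx H; apply le_epsilon; intros eps he; destruct (ext_spec x hx eps he) as [K HK].
assert (h1 := HK (rep x K) (rep_unit x K hx) (rep_agree x K K ltac:(lia))).
assert (h2 := H (rep x K) (rep_unit x K hx)).
replace (ext x) with (f (rep x K) + - (f (rep x K) - ext x))%C by ring.
eapply Rle_trans; [apply Cmod_triangle|]; rewrite Cmod_opp; lra.
Qed.

Lemma ext_of_Z (l : Z) : ~ (s | l)%Z -> ext (Zs_of_Z s l) = f l.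
Proof.
intros hl; assert (h : Cmod (f l - ext (Zs_of_Z s l)) <= 0).
{ apply le_epsilon; intros eps he; rewrite Rplus_0_l.
  destruct (ext_spec (Zs_of_Z s l) (Zs_unit_of_Z s hs l hl) eps he) as [K HK].
  apply HK; [exact hl|reflexivity]. }
assert (h0 := Cmod_ge_0 (f l - ext (Zs_of_Z s l))).
assert (e : (f l - ext (Zs_of_Z s l))%C = 0) by (apply Cmod_eq_0; lra).
transitivity (f l - (f l - ext (Zs_of_Z s l)))%C; [ring|rewrite e; ring].
Qed.

(** Both limits are compared at one integer that is close enough to [y] for its value to approximate
    [ext y], and congruent to [x] modulo [s ^ K]. *)
Lemma ext_local (x : Zs s) (eps : R) : Zs_unit x -> 0 < eps ->
  exists K, forall y, Zs_unit y -> zs_res x K = zs_res y K -> Cmod (ext y - ext x) <= eps.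
Proof.
intros hx he; assert (he2 : 0 < eps / 2) by lra.
destruct (ext_spec x hx _ he2) as [K HK]; exists K; intros y hy e.
destruct (ext_spec y hy _ he2) as [K' HK'].
set (l := rep y (max K K')).
assert (hl : ~ (s | l)%Z) by apply rep_unit, hy.
assert (h1 : Cmod (f l - ext y) <= eps / 2) by (apply HK'; [exact hl|apply rep_agree; lia]).
assert (h2 : Cmod (f l - ext x) <= eps / 2).
{ apply HK; [exact hl|]; unfold agree; rewrite e; apply (rep_agree y _ K); lia. }
replace (ext y - ext x)%C with (- (f l - ext y) + (f l - ext x))%C by ring.
eapply Rle_trans; [apply Cmod_triangle|]; rewrite Cmod_opp; lra.
Qed.

End ContinuousExtension.

(** * Compactness of the s-adic units *)

Lemma cover_list {T I : Type} (O : I -> T -> Prop) (P : nat -> T -> Prop) (M : nat) :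
  (forall m, (m < M)%nat -> exists L : list I, forall x, P m x -> exists i, In i L /\ O i x) ->
  exists L : list I, forall m x, (m < M)%nat -> P m x -> exists i, In i L /\ O i x.
Proof.
induction M as [|M IH]; intros H.
- exists nil; intros m x hm; lia.
- destruct IH as [L HL]; [intros m hm; apply H; lia|].
  destruct (H M ltac:(lia)) as [L' HL'].
  exists (L ++ L'); intros m x hm hx; destruct (Nat.eq_dec m M) as [->|hne].
  + destruct (HL' x hx) as [i [h1 h2]]; exists i; split; [apply in_or_app; right; exact h1|exact h2].
  + destruct (HL m x ltac:(lia) hx) as [i [h1 h2]]; exists i; split; [apply in_or_app; left; exact h1|exact h2].
Qed.

Lemma zs_res_range (x : Zs s) (n : nat) : (0 <= zs_res x n < s ^ Z.of_nat n)%Z.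
Proof.
rewrite <- (zs_compat s x n n (Nat.le_refl n)); apply Z.mod_pos_bound, Z.pow_pos_nonneg; lia.
Qed.

(* Konig: if no finite subfamily covers the units, then the same holds for a decreasing sequence of
   residue classes, which shrink to a point of some member of the cover. *)
Lemma units_cover (I : Type) (O : I -> nat * Zs s -> Prop) (m : nat) :
  (forall i, open (O i)) -> (forall x, Zs_unit x -> exists i, O i (m, x)) ->
  exists L : list I, forall x, Zs_unit x -> exists i, In i L /\ O i (m, x).
Proof.
intros hO hcov; apply NNPP; intros hno.
set (bad := fun (n : nat) (r : Z) => ~ exists L : list I, forall x, Zs_unit x ->
  zs_res x n = r -> exists i, In i L /\ O i (m, x)).
assert (h0 : bad 0%nat 0%Z).
{ intros [L HL]; apply hno; exists L; intros x hx; apply HL; [exact hx|].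
  assert (h := zs_res_range x 0); change (s ^ Z.of_nat 0)%Z with 1%Z in h; lia. }
assert (hstep : forall n r, bad n r -> exists r', bad (S n) r' /\ (r' mod s ^ Z.of_nat n = r)%Z).
{ intros n r hbad; apply NNPP; intros hn; apply hbad.
  destruct (cover_list (fun i x => O i (m, x))
    (fun r' x => Zs_unit x /\ zs_res x n = r /\ zs_res x (S n) = Z.of_nat r')
    (Z.to_nat (s ^ Z.of_nat (S n)))) as [L HL].
  - intros r' _; destruct (Z.eq_dec (Z.of_nat r' mod s ^ Z.of_nat n) r) as [e|e].
    + apply NNPP; intros h; apply hn; exists (Z.of_nat r'); split; [|exact e].
      intros [L HL]; apply h; exists L; intros x [h1 [_ h3]]; apply HL; assumption.
    + exists nil; intros x [_ [h2 h3]]; elim e.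
      rewrite <- h2, <- h3; apply zs_compat; lia.
  - exists L; intros x hx hr.
    assert (h := zs_res_range x (S n)).
    apply (HL (Z.to_nat (zs_res x (S n))) x); [apply Z2Nat.inj_lt; lia|].
    split; [exact hx|split; [exact hr|rewrite Z2Nat.id; lia]]. }
(* The proof of badness travels with the residue, so that the next digit can be chosen by
   recursion. *)
set (next := fun n (p : {r | bad n r}) =>
  let q := constructive_indefinite_description _ (hstep n (proj1_sig p) (proj2_sig p)) in
  exist (bad (S n)) (proj1_sig q) (proj1 (proj2_sig q))).
set (sq := fix sq (n : nat) : {r | bad n r} :=
  match n with O => exist (bad 0%nat) 0%Z h0 | S n => next n (sq n) end).
set (r := fun n => proj1_sig (sq n)).
assert (hbad : forall n, bad n (r n)) by (intros n; apply (proj2_sig (sq n))).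
assert (hr : forall n, (r (S n) mod s ^ Z.of_nat n = r n)%Z).
{ intros n; unfold r; simpl; unfold next.
  destruct (constructive_indefinite_description _ (hstep n (proj1_sig (sq n)) (proj2_sig (sq n)))) as [r' [h1 h2]].
  exact h2. }
(* A class without units would be covered by the empty list. *)
assert (hne : forall n, exists x : Zs s, Zs_unit x /\ zs_res x n = r n).
{ intros n; apply NNPP; intros h; apply (hbad n); exists nil; intros x h1 h2.
  elim h; exists x; auto. }
clearbody r.
assert (hcomp : forall k n, (k <= n)%nat -> (r n mod s ^ Z.of_nat k)%Z = r k).
{ intros k n hk; induction hk as [|n hk IH].
  - destruct (hne k) as [x [_ hx]]; rewrite <- hx; apply Z.mod_small, zs_res_range.
  - rewrite <- IH, <- (hr n); symmetry; apply (Zs_of_Z_compat s (r (S n)) k n hk). }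
set (x := Mk_Zs s r hcomp).
assert (hx : Zs_unit x).
{ destruct (hne 1%nat) as [x' [h1 h2]]; unfold Zs_unit; simpl; rewrite <- h2; exact h1. }
destruct (hcov x hx) as [i hi].
destruct (hO i _ hi) as [eps heps].
destruct (INR_unbounded (/ eps)) as [n hn].
apply (hbad n); exists (i :: nil); intros y _ hy; exists i; split; [left; reflexivity|].
apply heps; split; [reflexivity|]; split; [apply cond_pos|].
intros k hk; simpl.
assert (he := cond_pos eps).
assert (hkn : (k <= n)%nat).
{ apply INR_le; assert (INR k < / eps); [|lra].
  apply (Rmult_lt_reg_r eps); [exact he|]; rewrite Rinv_l by lra; exact hk. }
rewrite <- (hcomp k n hkn), <- hy; apply zs_compat, hkn.
Qed.

Lemma compact_levels (M : nat) :
  compact_set (fun p : nat * Zs s => (fst p < M)%nat /\ Zs_unit (snd p)).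
Proof.
intros I O hO hcov.
destruct (cover_list O (fun m p => fst p = m /\ Zs_unit (snd p)) M) as [L HL].
- intros m hm; destruct (units_cover I O m hO) as [L HL].
  + intros x hx; apply hcov; split; assumption.
  + exists L; intros [m' x] [e hx]; simpl in e; subst m'; apply HL, hx.
- exists L; intros p [h1 h2]; apply (HL (fst p)); auto.
Qed.

(** The coefficients are forced by the matrix: after removal of the Toeplitz part, [F n] at level
    [m] must be the entry on the n-th diagonal whose smaller level is [m], extended continuously
    from integers to units. *)
Lemma smooth_entries_HS_smooth (b : BH) : smooth_entries s b -> HS_smooth s b.
Proof.
intros [u [beta [hu [hbeta [hE0 [hdec [hblock hcont]]]]]]].
destruct (hu 2%nat) as [A hA].
destruct (isT_exists s hs u A hA) as [Y hY].
(* One of [Z.to_nat n] and [Z.to_nat (- n)] is 0, so the two levels differ by [n] and the smaller is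
   [m]. *)
set (f := fun (n : Z) (m : nat) (l : Z) =>
  (b (E (pt s (m + Z.to_nat (- n)) l)) (pt s (m + Z.to_nat n) l) - u n)%C).
assert (hfc : forall n m, forall x : Zs s, Zs_unit x -> forall eps, 0 < eps -> exists K, forall l1 l2,
  ~ (s | l1)%Z -> ~ (s | l2)%Z -> agree s K x l1 -> agree s K x l2 -> Cmod (f n m l1 - f n m l2) <= eps).
{ intros n m x hx eps he; destruct (hcont x hx eps he) as [K HK]; exists K; intros l1 l2 h1 h2 a1 a2.
  assert (h := HK l1 l2 h1 h2 a1 a2 (m + Z.to_nat n)%nat (m + Z.to_nat (- n))%nat).
  unfold f; match goal with |- Cmod ?z <= _ => match type of h with Cmod ?z' <= _ =>
    replace z with z' by ring end end; exact h. }
set (F := fun (n : Z) (p : nat * Zs s) => ext (f n (fst p)) (snd p)).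
assert (hrd : forall N, exists K, forall n m x, Zs_unit x ->
  (1 + INR m + IZR (Z.abs n)) ^ N * Cmod (F n (m, x)) <= K).
{ intros N; destruct (hdec N) as [K HK]; exists K; intros n m x hx.
  (* The larger level is [m + |n|]: decay in the larger level is joint decay in [(m, n)]. *)
  assert (hbr : br (Z.of_nat (max (m + Z.to_nat n) (m + Z.to_nat (- n)))) = 1 + INR m + IZR (Z.abs n)).
  { unfold br; replace (Z.abs (Z.of_nat (max (m + Z.to_nat n) (m + Z.to_nat (- n)))))
      with (Z.of_nat m + Z.abs n)%Z by lia.
    rewrite plus_IZR, <- INR_IZR_INZ; ring. }
  assert (hp : 0 < (1 + INR m + IZR (Z.abs n)) ^ N) by (rewrite <- hbr; apply br_pow_pos).
  assert (h : Cmod (F n (m, x)) <= K / (1 + INR m + IZR (Z.abs n)) ^ N).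
  { apply (ext_le (f n m) (hfc n m) x _ hx); intros l hl.
    apply le_div_of_mult; [exact hp|]; rewrite <- hbr.
    assert (h := HK (m + Z.to_nat n)%nat (m + Z.to_nat (- n))%nat l hl).
    replace (Z.of_nat (m + Z.to_nat n) - Z.of_nat (m + Z.to_nat (- n)))%Z with n in h by lia; exact h. }
  apply (Rmult_le_compat_l ((1 + INR m + IZR (Z.abs n)) ^ N)) in h; [|lra].
  eapply Rle_trans; [exact h|right; field; lra]. }
assert (hF : rapid_decay F).
{ intros N; destruct (hrd N) as [K HK]; exists K; exact HK. }
assert (hF0 : forall n, C0_on (fun p : nat * Zs s => Zs_unit (snd p)) (F n)).
{ intros n; split.
  - intros [m x] hx; apply (proj2 (filterlim_locally (U := C_UniformSpace) _ _)); intros eps.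
    destruct (ext_local (f n m) (hfc n m) x (eps / 2) hx) as [K HK]; [assert (h := cond_pos eps); lra|].
    (* A ball of this radius fixes the residue of index [K]. *)
    assert (hd : 0 < / (INR K + 1)) by (apply Rinv_0_lt_compat; assert (h := pos_INR K); lra).
    exists (mkposreal _ hd); intros [m' y] [h1 [_ h2]] hy.
    change (m = m') in h1; subst m'; simpl in h2, hy.
    assert (e : zs_res x K = zs_res y K).
    { apply h2; assert (h := pos_INR K); apply (Rmult_lt_reg_r (INR K + 1)); [lra|].
      rewrite Rmult_assoc, Rinv_l by lra; lra. }
    assert (h := HK y hy e); assert (he := cond_pos eps).
    apply C_ball_Cmod, (Rle_lt_trans _ (eps / 2)); [exact h|lra].
  (* The first power of decay makes [F n] smaller than [eps] from level [M] on, and the levels below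
     [M] form a compact set. *)
  - intros eps; destruct (hrd 1%nat) as [K HK], (INR_unbounded (K / eps)) as [M hM].
    exists (fun p : nat * Zs s => (fst p < M)%nat /\ Zs_unit (snd p)).
    split; [apply compact_levels|split; [intros p h; apply h|]].
    intros [m x] hx hn; simpl in hx, hn.
    assert (hm : (M <= m)%nat) by (destruct (le_lt_dec M m); [assumption|tauto]).
    assert (h := HK n m x hx); rewrite pow_1 in h.
    assert (hz := IZR_le 0 _ (Z.abs_nonneg n)); apply le_INR in hm.
    assert (he := cond_pos eps); assert (hc := Cmod_ge_0 (F n (m, x))).
    apply (Rmult_lt_compat_r eps) in hM; [|exact he].
    replace (K / eps * eps) with K in hM by (field; lra).
    assert (hM0 := pos_INR M).
    destruct (Rlt_le_dec (Cmod (F n (m, x))) eps) as [hlt|hge]; [exact hlt|exfalso].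
    apply (Rlt_irrefl K); eapply Rlt_le_trans; [exact hM|]; eapply Rle_trans; [|exact h].
    apply Rmult_le_compat; [exact hM0|left; exact he|lra|exact hge]. }
destruct (F_bounded s hs F hF) as [P [hP HP]].
destruct (ex_zseries_BH (iterm s F) P) as [c hc].
{ intros n; apply (iterm_spec s hs F n _ (HP n)). }
exists (Phi u), Y, c; split; [apply Phi_smooth, hu|split; [|split]].
- revert hY; apply (is_zseries_ext (V := BH_NormedModule)); intros m.
  rewrite (fourier_coef_Phi u m hu); reflexivity.
- exists F; split; [exact hF0|split; [exact hF|exact hc]].
- apply BH_ext_basis, (Z_pt_ind s hs).
  + change (b (E 0) = plus (Y (E 0)) (c (E 0))).
    rewrite hE0, (isT_E_0 s hs u Y beta hY hbeta), (c_E_0 s hs c F hF hc).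
    symmetry; apply (plus_zero_r (G := l2_AbelianMonoid)).
  + intros k l hl; destruct (hblock k l hl) as [b0 b1].
    assert (hcc : forall j, is_zseries (V := C_NormedModule) (fun n => iterm s F n (E (pt s k l)) j) (c (E (pt s k l)) j)).
    { intros j; apply (c_coord s c F hc). }
    apply (l2_ext_pt s hs).
    * change (b (E (pt s k l)) 0%Z = Y (E (pt s k l)) 0%Z + c (E (pt s k l)) 0%Z)%C.
      rewrite b0, (isT_pt_0 s hs u Y k l hY hl), (c_0 s hs c F hF hc); ring.
    * intros i l' hl'.
      change (b (E (pt s k l)) (pt s i l') = Y (E (pt s k l)) (pt s i l') + c (E (pt s k l)) (pt s i l'))%C.
      rewrite (isT_entry s hs u Y k i l l' hY hl hl').
      set (n0 := (Z.of_nat i - Z.of_nat k)%Z).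
      assert (hit : forall n, iterm s F n (E (pt s k l)) (pt s i l') =
        if Z.eq_dec l l' then if Z.eq_dec n n0 then f n0 (min i k) l else RtoC 0 else RtoC 0).
      { intros n; rewrite (iterm_E s hs F hF n k l hl); unfold n0.
        destruct (Z.leb_spec 0 (Z.of_nat k + n)) as [h|h].
        - rewrite l2_scal_coord, (E_pt s hs _ _ _ _ hl hl'); destruct (Z.eq_dec l l') as [<-|e]; [|apply Cmult_0_r].
          destruct (Nat.eq_dec (Z.to_nat (Z.of_nat k + n)) i), (Z.eq_dec n (Z.of_nat i - Z.of_nat k));
            try lia; [|apply Cmult_0_r].
          rewrite Cmult_1_r; unfold F; simpl fst; simpl snd.
          rewrite ext_of_Z by (auto; apply hfc).
          f_equal; [assumption|lia].
        - change ((zero : l2) (pt s i l')) with (RtoC 0).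
          destruct (Z.eq_dec l l'); [|reflexivity]; destruct (Z.eq_dec n (Z.of_nat i - Z.of_nat k)); [lia|reflexivity]. }
      assert (hs1 := is_zseries_single (V := C_NormedModule) (fun n => iterm s F n (E (pt s k l)) (pt s i l')) n0).
      cbv beta in hs1; rewrite hit in hs1.
      assert (hs2 := is_zseries_unique (V := C_NormedModule) _ _ _ (hcc (pt s i l')) (hs1 ltac:(
        intros n hn; rewrite hit; destruct (Z.eq_dec l l'); [destruct (Z.eq_dec n n0); [tauto|reflexivity]|reflexivity]))).
      rewrite hs2; destruct (Z.eq_dec l l') as [<-|e].
      -- destruct (Z.eq_dec n0 n0); [|tauto]; unfold f, n0.
         replace (Nat.min i k + Z.to_nat (- (Z.of_nat i - Z.of_nat k)))%nat with k by lia.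
         replace (Nat.min i k + Z.to_nat (Z.of_nat i - Z.of_nat k))%nat with i by lia; ring.
      -- rewrite b1 by congruence; ring.
Qed.

End Extension.

(** * Linear combinations of path integrals and the functional calculus *)

Lemma smooth_entries_zero (s : Z) (hs : (2 <= s)%Z) : smooth_entries s zero.
Proof.
assert (h0 : forall y j, (zero : BH) y j = RtoC 0) by reflexivity.
exists (fun _ => RtoC 0), (RtoC 0); split; [|split; [|split; [|split; [|split]]]].
- intros N; exists 0; intros m; rewrite Cmod_0; lra.
- exact (is_zseries_single (V := C_NormedModule) (fun _ => RtoC 0) 0%Z (fun _ _ => eq_refl)).
- apply l2_ext; intros j; change (RtoC 0 = 0 * E 0 j)%C; ring.
- intros N; exists 0; intros i k l hl; rewrite h0; unfold Cminus; rewrite Cplus_opp_r, Cmod_0; lra.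
- intros k l hl; split; [apply h0|intros; apply h0].
- intros x hx eps he; exists 0%nat; intros; rewrite !h0; unfold Cminus; rewrite Cplus_opp_r, Cmod_0; lra.
Qed.

Lemma smooth_entries_plus (s : Z) (a b : BH) :
  smooth_entries s a -> smooth_entries s b -> smooth_entries s (plus a b).
Proof.
intros [u [be [hu [hz [h0 [hd [hb hc]]]]]]] [u' [be' [hu' [hz' [h0' [hd' [hb' hc']]]]]]].
assert (hp : forall y j, (plus a b : BH) y j = (a y j + b y j)%C) by reflexivity.
exists (fun m => u m + u' m)%C, (be + be')%C; split; [|split; [|split; [|split; [|split]]]].
- intros N; destruct (hu N) as [K hK], (hu' N) as [K' hK']; exists (K + K'); intros m.
  specialize (hK m); specialize (hK' m); assert (h := br_pow_pos m N).
  assert (h1 := Cmod_triangle (u m) (u' m)); nra.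
- exact (is_zseries_plus _ _ _ _ hz hz').
- apply l2_ext; intros j; rewrite hp, h0, h0', !l2_scal_coord; ring.
- intros N; destruct (hd N) as [K hK], (hd' N) as [K' hK']; exists (K + K'); intros i k l hl.
  specialize (hK i k l hl); specialize (hK' i k l hl); rewrite hp.
  set (x := a (E (pt s k l)) (pt s i l)) in *; set (y := b (E (pt s k l)) (pt s i l)) in *.
  set (n := (Z.of_nat i - Z.of_nat k)%Z) in *.
  replace (x + y - (u n + u' n))%C with ((x - u n) + (y - u' n))%C by ring.
  assert (h := br_pow_pos (Z.of_nat (max i k)) N); assert (h1 := Cmod_triangle (x - u n) (y - u' n)); nra.
- intros k l hl; destruct (hb k l hl) as [b0 b1], (hb' k l hl) as [b0' b1']; split.
  + rewrite hp, b0, b0'; ring.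
  + intros i l' hl' hne; rewrite hp, b1, b1' by assumption; ring.
- intros x hx eps he; destruct (hc x hx (eps / 2)) as [K hK], (hc' x hx (eps / 2)) as [K' hK']; try lra.
  exists (max K K'); intros l1 l2 h1 h2 a1 a2 i k; rewrite !hp.
  assert (e1 := hK l1 l2 h1 h2 (agree_le s K (max K K') x l1 ltac:(lia) a1) (agree_le s K (max K K') x l2 ltac:(lia) a2) i k).
  assert (e2 := hK' l1 l2 h1 h2 (agree_le s K' (max K K') x l1 ltac:(lia) a1) (agree_le s K' (max K K') x l2 ltac:(lia) a2) i k).
  match goal with |- Cmod (?p + ?q - (?p' + ?q')) <= _ =>
    replace (p + q - (p' + q'))%C with ((p - p') + (q - q'))%C by ring;
    assert (h := Cmod_triangle (p - p') (q - q')) end; lra.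
Qed.

Lemma smooth_entries_scal (s : Z) (c : C) (a : BH) : smooth_entries s a -> smooth_entries s (scal c a).
Proof.
intros [u [be [hu [hz [h0 [hd [hb hc]]]]]]].
assert (hp : forall y j, (scal c a : BH) y j = (c * a y j)%C) by reflexivity.
assert (hc0 := Cmod_ge_0 c).
exists (fun m => c * u m)%C, (c * be)%C; split; [|split; [|split; [|split; [|split]]]].
- intros N; destruct (hu N) as [K hK]; exists (Cmod c * K); intros m; specialize (hK m).
  rewrite Cmod_mult, <- Rmult_assoc, (Rmult_comm _ (Cmod c)), Rmult_assoc.
  apply Rmult_le_compat_l; assumption.
- exact (is_zseries_Cmul c _ _ hz).
- apply l2_ext; intros j; rewrite hp, h0, !l2_scal_coord; ring.
- intros N; destruct (hd N) as [K hK]; exists (Cmod c * K); intros i k l hl.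
  specialize (hK i k l hl); rewrite hp.
  match goal with |- _ * Cmod (c * ?x - c * ?y) <= _ => replace (c * x - c * y)%C with (c * (x - y))%C by ring end.
  rewrite Cmod_mult, <- Rmult_assoc, (Rmult_comm _ (Cmod c)), Rmult_assoc.
  apply Rmult_le_compat_l; assumption.
- intros k l hl; destruct (hb k l hl) as [b0 b1]; split.
  + rewrite hp, b0; ring.
  + intros i l' hl' hne; rewrite hp, b1 by assumption; ring.
(* Adding 1 keeps the quotient meaningful for [c = 0]. *)
- intros x hx eps he; destruct (hc x hx (eps / (Cmod c + 1))) as [K hK]; [apply Rdiv_lt_0_compat; lra|].
  exists K; intros l1 l2 h1 h2 a1 a2 i k; rewrite !hp.
  assert (e1 := hK l1 l2 h1 h2 a1 a2 i k).
  match goal with |- Cmod (c * ?x - c * ?y) <= _ => replace (c * x - c * y)%C with (c * (x - y))%C by ring end.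
  rewrite Cmod_mult; apply Rle_trans with ((Cmod c + 1) * (eps / (Cmod c + 1))); [|right; field; lra].
  apply Rmult_le_compat; try apply Cmod_ge_0; [lra|exact e1].
Qed.

(** Complex differentiability refers to the topology of the absolute value, continuity of paths to
    that of the product; the two have the same neighbourhoods. *)
Lemma holomorphic_continuous (g : C -> C) (z : C) : ex_derive (K := C_AbsRing) (V := C_NormedModule) g z ->
  filterlim g (locally (T := C_UniformSpace) z) (locally (T := C_UniformSpace) (g z)).
Proof.
intros h P HP; apply locally_C.
exact (ex_derive_continuous (K := C_AbsRing) (V := C_NormedModule) g z h P HP).
Qed.

Lemma path_continuous (p : C1_path) (t : R) : 0 <= t <= 1 -> continuous (U := C_UniformSpace) (path p) t.
Proof.
intros ht; apply (ex_derive_continuous (K := R_AbsRing) (V := C_R_NormedModule) (path p) t).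
exists (velocity p t); apply path_derive, ht.
Qed.

(** Off the spectrum an inverse exists, so the operator chosen by [resolvent] is one. *)
Lemma resolvent_inverse (s : Z) (a : BH) (z : C) : ~ spectrum s a z ->
  inverse_of (minus (scal z (one : BH)) a) (resolvent a z).
Proof.
intros h; apply NNPP in h; destruct h as [b [_ hb]].
exact (the_op_spec (inverse_of (minus (scal z (one : BH)) a)) b hb).
Qed.

Theorem theorem3p11 (s : Z) (hs : (2 <= s)%Z) (a : BH) (ha : HS_smooth s a)
    (U : C -> Prop) (hU : open (T := C_UniformSpace) U)
    (hspec : forall z, spectrum s a z -> U z)
    (g : C -> C) (hg : holomorphic_on U g)
    (G : list C1_path) (hG : surrounds G (spectrum s a) U) :
  exists b : BH, is_cauchy_calculus a g G b /\ HS_smooth s b.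
Proof.
destruct hG as [_ [hchain _]].
destruct ha as [phi [b [c [hphi [hb [[F [hF0 [hF hc]]] ->]]]]]].
assert (hpath : forall p, In p G -> exists v : BH,
  is_RInt (V := realify BH_NormedModule)
    (fun t => scal (velocity p t) (scal (g (path p t)) (resolvent (plus b c) (path p t))) : BH) 0 1 v /\
  smooth_entries s v).
{ intros p hp.
  assert (hgp : forall t, 0 <= t <= 1 -> U (path p t) /\ ~ spectrum s (plus b c) (path p t)).
  { intros t ht; apply hchain; exists p, t; auto. }
  assert (hz : C_cont (fun t => path p (clamp t))) by (apply clamp_cont, path_continuous).
  (* The velocity and [g] are merged into one scalar weight in front of the resolvent. *)
  assert (hw : C_cont (fun t => velocity p (clamp t) * g (path p (clamp t)))%C).
  { apply C_cont_mult; [apply clamp_cont, velocity_continuous|].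
    intros t; apply (filterlim_comp _ _ _ (fun t => path p (clamp t)) g _ _ _ (hz t)).
    apply holomorphic_continuous, hg, hgp, clamp_range. }
  destruct (path_integral_smooth s hs (fourier_coef phi) b c F (smooth_rapid phi hphi) hb hF hF0 hc
    (fun t => velocity p t * g (path p t))%C (path p) (fun t => resolvent (plus b c) (path p t)) hw hz) as [v [hv hs']].
  { intros t ht; apply (resolvent_inverse s), hgp, ht. }
  exists v; split; [|exact hs'].
  revert hv; apply is_RInt_ext; intros t ht.
  rewrite Rmin_left, Rmax_right in ht by lra.
  rewrite clamp_id by lra; symmetry; apply (scal_assoc (V := BH_ModuleSpace)). }
assert (hint : exists v : BH, is_contour_int (V := BH_NormedModule)
  (fun z => scal (g z) (resolvent (plus b c) z)) G v /\ smooth_entries s v).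
(* The integrand of the chain is a sum over its paths, so the integral and its entries are assembled
   path by path. *)
{ clear hchain; unfold is_contour_int; induction G as [|p G IH].
  - exists zero; split; [|apply smooth_entries_zero, hs].
    assert (h := is_RInt_const (V := realify BH_NormedModule) 0 1 (zero : BH)).
    exact (eq_ind _ (fun v : BH => is_RInt (V := realify BH_NormedModule) (fun _ => zero : BH) 0 1 v)
      h _ (scal_zero_r (V := realify BH_NormedModule) (1 - 0))).
  - destruct IH as [v [h1 h2]]; [intros q hq; apply hpath; right; exact hq|].
    destruct (hpath p (or_introl eq_refl)) as [vp [k1 k2]].
    exists (plus vp v); split; [|apply smooth_entries_plus; assumption].
    exact (is_RInt_plus (V := realify BH_NormedModule) _ _ _ _ _ _ k1 h1). }
destruct hint as [v [h1 h2]].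
exists (scal (/ two_pi_i)%C v); split; [exists v; split; [exact h1|reflexivity]|].
apply (smooth_entries_HS_smooth s hs), smooth_entries_scal, h2.
Qed.
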